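(* Let $W$ be a planar white noise. For $q:\mathbb{R}^2\to\mathbb{R}$ let $f=q\ast W$, $X_u=f(u)$ for $u\in\mathbb{Z}^2$, and $\alpha^X(u)=\sup_{r\in\mathbb{N}^*}\frac{X_{u+re_1}-X_u}{r}$ for $u\in\mathbb{Z}^2$. In the context of site percolation on $\mathbb{Z}^2$ the following holds. (i) If $q$ is admissible with exponent $\beta$ for some $\beta>\frac52$, then there exists $\ell_1\in(0,\infty)$ such that, for any $\ell>\ell_1$, almost surely, the set $\{u\in\mathbb{Z}^2:\alpha^X(u)\le\ell\}$ contains a unique infinite cluster, and the set $\{u\in\mathbb{Z}^2:\alpha^X(u)\ge\ell\}$ only contains finite clusters. (ii) There exists an absolute constant $\delta_0>0$ such that, if $q$ is admissible with exponent $\beta$ for some $\beta>16$ and $X$ satisfies the correlation condition with parameters $(1,\delta_0)$, then there exists $\ell_2\in(0,\infty)$ such that, for any $\ell<\ell_2$, almost surely, the set $\{u\in\mathbb{Z}^2:\alpha^X(u)>\ell\}$ contains a unique infinite cluster and the set $\{u\in\mathbb{Z}^2:\alpha^X(u)<\ell\}$ only contains finite clusters.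
   Context: $\mathbb{N}^*=\{1,2,\dots\}$ and $e_1=(1,0)$. A planar white noise $W$ is a centered Gaussian field indexed by $L^2(\mathbb{R}^2)$ such that $\mathbb{E}[W(\varphi_1)W(\varphi_2)]=\int_{\mathbb{R}^2}\varphi_1(x)\varphi_2(x)\,dx$ for all $\varphi_1,\varphi_2\in L^2(\mathbb{R}^2)$. A function $q:\mathbb{R}^2\to\mathbb{R}$ is called admissible with exponent $\beta>1$ if: (1) $q\in\mathcal{C}^4(\mathbb{R}^2)$ and $\partial^\alpha q\in L^2(\mathbb{R}^2)$ for every $\alpha=(\alpha_1,\alpha_2)\in\mathbb{N}^2$ with $\alpha_1+\alpha_2\le 4$; (2) $q(-x)=q(x)$ for all $x$; (3) there is a constant $C>0$ such that $|\partial^\alpha q(x)|\le C\|x\|^{-\beta}$ for all $\alpha\in\mathbb{N}^2$ with $\alpha_1+\alpha_2\le 2$ and all $\|x\|\ge1$. $f=q\ast W$ denotes the field $f(x)=W(q(x-\cdot))$, $x\in\mathbb{R}^2$, a stationary centered Gaussian field with $\mathbb{E}[f(x)f(y)]=(q\ast q)(x-y)$, regarded as a random twice continuously differentiable function. $X=(X_u)_{u\in\mathbb{Z}^2}$ satisfies the correlation condition with parameters $(R,\delta)\in\mathbb{N}^*\times(0,\infty)$ if $\mathrm{Var}(X_u)=\mathbb{E}[X_u^2]=1$ for all $u\in\mathbb{Z}^2$ and $\sum_{u\in\mathbb{Z}^2,\ \|u\|_\infty\ge R}|\mathrm{Cov}(X_u,X_0)|<\delta$. A cluster of a subset of $\mathbb{Z}^2$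 is a connected component of it for the nearest-neighbor graph structure of $\mathbb{Z}^2$. *)

(* Defs.v *)
From HB Require Import structures.
From mathcomp Require Import all_boot all_order all_algebra.
From mathcomp Require Import all_classical all_reals all_analysis.

Set Implicit Arguments.
Unset Strict Implicit.
Unset Printing Implicit Defensive.

Import Order.TTheory GRing.Theory Num.Theory.
Import numFieldNormedType.Exports.

Local Open Scope classical_set_scope.
Local Open Scope ring_scope.

Section Plane.
Context {R : realType}.

Definition lebesgue2 :
    {measure set (measurableTypeR R * measurableTypeR R) -> \bar R} :=
  (@lebesgue_measure R \x @lebesgue_measure R)%E.

(* The norm `|x| that the library puts on R * R is the sup norm. *)
Definition norm2 (x : R * R) : R := Num.sqrt (x.1 ^+ 2 + x.2 ^+ 2).

Definition partial1 (q : R * R -> R) : R * R -> R := 'D_((1, 0) : R * R) q.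
Definition partial2 (q : R * R -> R) : R * R -> R := 'D_((0, 1) : R * R) q.

Definition partial (a : nat * nat) (q : R * R -> R) : R * R -> R :=
  iter a.1 partial1 (iter a.2 partial2 q).

(* C^k: the iterated partial derivatives of order at most k, taken in any
   order of differentiation, exist everywhere and are continuous. *)
Fixpoint Ck (k : nat) (q : R * R -> R) : Prop :=
  continuous q /\
  if k is k'.+1 then
    [/\ forall x, derivable q x ((1, 0) : R * R),
        forall x, derivable q x ((0, 1) : R * R),
        Ck k' (partial1 q) & Ck k' (partial2 q)]
  else True.

Definition admissible (q : R * R -> R) (beta : R) : Prop :=
  [/\ 1 < beta,
      Ck 4 q /\ (forall a : nat * nat, (a.1 + a.2 <= 4)%N ->
                   partial a q \in Lfun lebesgue2 2%:E),
      forall x, q (- x) = q x &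
      exists C : R, 0 < C /\
        forall a : nat * nat, (a.1 + a.2 <= 2)%N ->
        forall x, 1 <= norm2 x -> `|partial a q x| <= C * norm2 x `^ (- beta)].

End Plane.

Section Gaussian.
Context {R : realType} d {Omega : measurableType d} (P : probability Omega R).

(* [normal_prob 0 s] is only the Gaussian law when [s != 0]; the degenerate
   Gaussian law is the Dirac mass. *)
Definition centered_gaussian (X : Omega -> R) : Prop :=
  measurable_fun setT X /\
  exists s : R, 0 <= s /\
    forall V : set R, measurable V ->
      pushforward P X V = if s == 0 then \d_(0 : R) V else normal_prob 0 s V.

Definition centered_gaussian_field (T : Type) (D : set T) (Z : T -> Omega -> R)
    : Prop :=
  forall (n : nat) (t : 'I_n -> T) (a : 'I_n -> R), (forall i, D (t i)) ->
    centered_gaussian (fun w => \sum_(i < n) a i * Z (t i) w).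

(* The index set L^2(R^2) is represented by square-integrable functions rather
   than by their classes: the covariance formula makes [W phi] and [W psi]
   almost surely equal when [phi] and [psi] agree almost everywhere.  The values
   of [W] outside [Lfun lebesgue2 2%:E] are irrelevant. *)
Definition white_noise (W : (R * R -> R) -> {RV P >-> R}) : Prop :=
  centered_gaussian_field [set phi | phi \in Lfun lebesgue2 2%:E]
    (fun phi => W phi : Omega -> R) /\
  forall phi1 phi2 : R * R -> R,
    phi1 \in Lfun lebesgue2 2%:E -> phi2 \in Lfun lebesgue2 2%:E ->
    ('E_P[W phi1 \* W phi2] = \int[lebesgue2]_x (phi1 x * phi2 x)%:E)%E.

(* [f] is a version of the field x |-> W(q(x - .)) with C^2 sample paths. *)
Definition convolution_field (q : R * R -> R) (W : (R * R -> R) -> {RV P >-> R})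
    (f : R * R -> {RV P >-> R}) : Prop :=
  (forall x : R * R, {ae P, forall w, f x w = W (fun y => q (x - y)) w}) /\
  (forall w, Ck 2 (fun x => f x w)).

Definition lattice_field (f : R * R -> {RV P >-> R}) (u : int * int)
    : {RV P >-> R} :=
  f (u.1%:~R, u.2%:~R).

Definition correlation_condition (X : int * int -> {RV P >-> R})
    (r : nat) (delta : R) : Prop :=
  (forall u, ('V_P[X u] = 1)%E /\ ('E_P[X u \* X u] = 1)%E) /\
  (\esum_(u in [set u : int * int | (r%:Z <= Num.max `|u.1| `|u.2|)%R])
     `|covariance P (X u) (X (0, 0)%R)| < delta%:E)%E.

(* The supremum is taken in the extended reals. *)
Definition alpha (X : int * int -> {RV P >-> R}) (w : Omega) (u : int * int)
    : \bar R :=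
  ereal_sup [set ((X (u.1 + r%:Z, u.2) w - X u w) / r%:R)%:E
            | r in [set r : nat | (0 < r)%N]].

End Gaussian.

Section Percolation.

Definition nearest_neighbor : rel (int * int) :=
  fun u v => `|u.1 - v.1| + `|u.2 - v.2| == 1.

Definition connected_in (A : set (int * int)) (u v : int * int) : Prop :=
  exists p : seq (int * int),
    [/\ path nearest_neighbor u p, last u p = v & forall x, x \in u :: p -> A x].

Definition cluster_of (A C : set (int * int)) : Prop :=
  exists2 u, A u & C = [set v | connected_in A u v].

Definition unique_infinite_cluster (A : set (int * int)) : Prop :=
  exists! C : set (int * int), cluster_of A C /\ infinite_set C.

Definition only_finite_clusters (A : set (int * int)) : Prop :=
  forall C : set (int * int), cluster_of A C -> finite_set C.

End Percolation.

(* Main.v *)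
Require Import Defs.
From HB Require Import structures.
From mathcomp Require Import all_boot all_order all_algebra.
From mathcomp Require Import all_classical all_reals all_analysis.
From mathcomp Require Import measurable_realfun.
From mathcomp Require Import zify ring lra.

Set Implicit Arguments.
Unset Strict Implicit.
Unset Printing Implicit Defensive.

Import Order.TTheory GRing.Theory Num.Theory.
Import numFieldNormedType.Exports.

Local Open Scope classical_set_scope.
Local Open Scope ring_scope.

(** Both parts are a Peierls argument. A site where alpha is large has some
    forward slope at least [l1]; a site where alpha is at most [l2] has all its
    first [n] forward slopes at most [l2]. If a finite set [S] of sites consists
    of such exceptional sites with probability at most [18 ^- #|S|], then almost
    surely the king-connected clusters of exceptional sites are finite and few,
    and planar duality applies: the boundary between a connected set and a
    component of its complement is king-connected, by a discrete Poincare lemma.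

    For (i), fix a displacement [r u] for each [u] in [S]. At most
    [2 * sum r] pairs of the points [u + r u] collide and the covariances are
    summable, so the sum of the increments has variance of order [sum r]; a
    Chernoff bound is then summed over [r] as a product of geometric series.

    For (ii), cut the rows into segments of length [n = 2 k]: the sites of [S] in
    a first half are near records of X on their segment. A Cholesky factor
    close to the identity turns X into an orthonormal family [g], up to errors
    that exceed a threshold on a segment with tiny probability. Off the bad
    segments one counts near records of [g], each having probability of order
    [1 / k]; only characteristic functions of [g] are used, the events being
    smoothed by a partition of unity into trigonometric polynomials, products
    of which have factorizing expectations. *)

(** * Planar duality on the square lattice *)

(** The hypotheses describe a field only through the laws of its linear combinations, and the
    estimates ask for no more. Joint deviations at many sites are bounded by adding the variables
    and applying Chernoff to the sum: as its variance is linear in the number of terms, the bound is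
    already a product over the sites, without independence. Records do need a product structure.
    Indicators are then replaced by trigonometric polynomials, because the product-to-sum formula
    reduces a product of cosines to characteristic functions of linear combinations. The constant 18
    is twice nine: nine king moves per step of a contour, and a factor 1/2 left for Borel-Cantelli.
    First halves of segments are used because a site there has at least [k] successors in its
    segment, so that being a record costs at most 1/[k]. Records are only near records for three
    reasons, all absorbed by one slack: the positive threshold, the error of the orthonormalization
    and the width of the cells. *)

Section Connectivity.
Variables (e : rel (int * int)).
Implicit Types (A B : set (int * int)) (u v x y : int * int).

Definition conn A u v : Prop :=
  exists p : seq (int * int),
    [/\ path e u p, last u p = v & forall x, x \in u :: p -> A x].

Lemma conn_refl A u : A u -> conn A u u.
Proof. by move=> Au; exists [::]; split=> // x; rewrite inE => /eqP ->. Qed.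

Lemma conn_cons A u v w : A u -> e u v -> conn A v w -> conn A u w.
Proof.
move=> Au uv [p [vp <- pA]]; exists (v :: p); split=> //=; first by rewrite uv.
by move=> x; rewrite inE => /predU1P[->|/pA].
Qed.

Lemma conn_edge A u v : A u -> A v -> e u v -> conn A u v.
Proof. by move=> Au Av uv; apply: conn_cons uv _ => //; exact: conn_refl. Qed.

Lemma conn_indl A v (Q : int * int -> Prop) :
  (A v -> Q v) ->
  (forall x y, A x -> e x y -> conn A y v -> Q y -> Q x) ->
  forall u, conn A u v -> Q u.
Proof.
move=> Q0 QS u [p [+ + pA]]; elim: p u pA => [|y p IH] u pA /=.
  by move=> _ uv; rewrite uv; apply: Q0; rewrite -uv; apply: pA; rewrite mem_head.
move=> /andP[uy yp] pv.
have yA x : x \in y :: p -> A x by move=> xp; apply: pA; rewrite inE xp orbT.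
apply: (QS u y) => //; first by apply: pA; rewrite mem_head.
  by exists p.
exact: IH.
Qed.

Lemma conn_trans A v u w : conn A u v -> conn A v w -> conn A u w.
Proof.
move=> uv vw; move: u uv; apply: conn_indl => // x y Ax xy _ IH.
exact: conn_cons xy IH.
Qed.

Lemma conn_left A u v : conn A u v -> A u.
Proof. by move=> [p [_ _ +]]; apply; rewrite mem_head. Qed.

Lemma conn_right A u v : conn A u v -> A v.
Proof. by move=> [p [_ <- +]]; apply; rewrite mem_last. Qed.

Lemma conn_sub A B u v : A `<=` B -> conn A u v -> conn B u v.
Proof. by move=> AB [p [up pv pA]]; exists p; split=> // x /pA /AB. Qed.

Hypothesis esym : symmetric e.

Lemma conn_sym A u v : conn A u v -> conn A v u.
Proof.
move=> uv; have Av := conn_right uv; move: u uv.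
apply: conn_indl => [|x y Ax xy yv IH]; first exact: conn_refl.
by apply: conn_trans IH _; apply: conn_edge => //; [exact: conn_left yv|rewrite esym].
Qed.

Definition component A u : set (int * int) := [set v | conn A u v].

Lemma component_conn A u v : component A u v -> conn (component A u) u v.
Proof.
move=> /conn_sym uv; apply: conn_sym; move: v uv.
apply: conn_indl => [Au|x y Ax xy yu IH]; first exact/conn_refl/conn_refl.
by apply: (conn_cons _ xy IH); apply/conn_sym/(conn_cons Ax xy).
Qed.

Lemma component_conn2 A u v w :
  component A u v -> component A u w -> conn (component A u) v w.
Proof.
by move=> /component_conn /conn_sym uv /component_conn; exact: conn_trans.
Qed.

Lemma component_edge A u v w :
  component A u v -> e v w -> A w -> component A u w.
Proof.
move=> uv vw Aw; apply: (conn_trans uv).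
by apply: conn_edge => //; exact: conn_right uv.
Qed.

(** First entrance: the path is cut just before its first site in [C], so that the part leading to
    [b] stays outside [C]. *)
Lemma conn_hit A C x y : conn A x y -> ~ C x -> C y ->
  exists a b, [/\ C a, ~ C b, A a, e b a & conn (A `&` ~` C) x b].
Proof.
move=> xy nCx Cy; move: x xy nCx; apply: conn_indl => // x z Ax xz zy IH nCx.
have [Cz|/IH[a [b [Ca Cb Aa ba zb]]]] := pselect (C z).
  by exists z, x; split=> //; [exact: conn_left zy|exact: conn_refl].
by exists a, b; split=> //; apply: conn_cons xz zb.
Qed.

End Connectivity.

Definition king : rel (int * int) :=
  fun u v => (`|u.1 - v.1| <= 1) && (`|u.2 - v.2| <= 1).

Lemma nn_sym : symmetric nearest_neighbor.
Proof. by move=> u v; rewrite /nearest_neighbor distrC [X in _ + X]distrC. Qed.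

Lemma nnP u v : nearest_neighbor u v <->
  [\/ v = (u.1 + 1, u.2), u = (v.1 + 1, v.2), v = (u.1, u.2 + 1)
    | u = (v.1, v.2 + 1)].
Proof.
case: u v => u1 u2 [v1 v2]; rewrite /nearest_neighbor /=; split => [/eqP uv|].
  have : [|| (v1 == u1 + 1) && (v2 == u2), (u1 == v1 + 1) && (v2 == u2),
    (v1 == u1) && (v2 == u2 + 1) | (u1 == v1) && (u2 == v2 + 1)] by lia.
  by case/or4P => /andP[/eqP-> /eqP->]; [apply: Or41|apply: Or42|apply: Or43|apply: Or44].
by case=> -[-> ->]; apply/eqP; lia.
Qed.

Section Poincare.

Fixpoint sump (c : int -> bool) (n : nat) : bool :=
  if n is n'.+1 then sump c n' (+) c n'%:Z else false.

(** The primitive of [c] modulo 2 that vanishes at 0. [Negz n] stands for -n-1, and there the values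
    of [c] from -n-1 to -1 are added. *)
Definition antidiff (c : int -> bool) (x : int) : bool :=
  match x with
  | Posz n => sump c n
  | Negz n => sump (fun y => c (- y - 1)) n.+1
  end.

Lemma antidiffS c x : antidiff c (x + 1) = antidiff c x (+) c x.
Proof.
case: x => [n|[|n]].
- by rewrite (_ : n%:Z + 1 = n.+1) //; lia.
- by rewrite (_ : Negz 0 + 1 = 0) //=; rewrite (_ : - 0%:Z - 1 = Negz 0) ?addbb.
- rewrite (_ : Negz n.+1 + 1 = Negz n); last by rewrite !NegzE; lia.
  rewrite /= (_ : - (n.+1)%:Z - 1 = Negz n.+1); last by rewrite NegzE; lia.
  by rewrite -[RHS]addbA addbb addbF.
Qed.

Lemma int_shift_const (T : Type) (f : int -> T) :
  (forall x, f (x + 1) = f x) -> forall x, f x = f 0.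
Proof.
move=> fS; case=> [n|n].
  elim: n => // n IH; rewrite -IH -(fS n); congr f; lia.
elim: n => [|n IH]; first by rewrite -fS.
by rewrite -IH -(fS (Negz n.+1)); congr f; rewrite !NegzE; lia.
Qed.

(* The discrete Poincare lemma on Z^2, modulo 2. *)
Lemma potential (a b : int * int -> bool) :
  (forall x y, a (x, y) (+) b (x + 1, y) = b (x, y) (+) a (x, y + 1)) ->
  exists h : int * int -> bool, forall x y,
    h (x + 1, y) = h (x, y) (+) a (x, y) /\ h (x, y + 1) = h (x, y) (+) b (x, y).
Proof.
move=> closed.
pose V x := antidiff (fun y => b (x, y)).
(* [a] is integrated along the row at height 0, then [b] up the column. *)
exists (fun u => antidiff (fun x => a (x, 0)) u.1 (+) V u.1 u.2) => x y /=.
split; last by rewrite /V antidiffS addbA.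
rewrite antidiffS.
(* The defect of the horizontal relation. Closedness makes it independent of the height, and at
   height 0, where [V] vanishes, it is zero. *)
pose D y := V (x + 1) y (+) V x y (+) a (x, y) (+) a (x, 0).
have : D y = D 0.
  apply: (@int_shift_const _ D) => z; rewrite /D /V !antidiffS.
  move: (closed x z); rewrite /=.
  move: (a (x, z)) (a (x, z + 1)) (a (x, 0)) (b (x, z)) (b (x + 1, z)).
  by move: (antidiff _ z) (antidiff _ z); do 7!case.
rewrite /D /V /=.
move: (a (x, y)) (a (x, 0)) (antidiff (fun y0 => b (x, y0)) y).
by move: (antidiff _ y) (antidiff _ x); do 5!case.
Qed.

End Poincare.

Section Boundary.
Variables C D : set (int * int).
Hypothesis disjCD : forall u, D u -> ~ C u.
Hypothesis connC : forall u v, C u -> C v -> conn nearest_neighbor C u v.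
Hypothesis connD : forall u v, D u -> D v -> conn nearest_neighbor D u v.
Hypothesis closedD : forall u v, D u -> nearest_neighbor u v -> D v \/ C v.

Definition boundary : set (int * int) :=
  [set u | D u /\ exists2 v, C v & nearest_neighbor u v].

(* Were the boundary to split into two parts at king distance greater than one,
   the edges from [C] to the first part would form a closed cochain; its
   potential is constant on [C] and on [D], but changes along the edges to the
   first part and not along those to the second. *)
Lemma boundary_conn u v : boundary u -> boundary v -> conn king boundary u v.
Proof.
move=> Bu Bv; apply: contrapT => nuv.
pose B1 := [set w | conn king boundary u w].
have B1u : B1 u by exact: conn_refl.
have B1B w : B1 w -> boundary w by exact: conn_right.
have B1king x y : B1 x -> king x y -> boundary y -> B1 y.
  by move=> B1x xy By; exact: component_edge B1x xy By.
pose f x y := `[< B1 x /\ C y >] || `[< B1 y /\ C x >].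
have fC x y : f x y = f y x by rewrite /f orbC.
have bP x y z : D x -> C y -> nearest_neighbor x y -> B1 z -> king z x -> B1 x.
  by move=> Dx Cy xy B1z zx; apply: (B1king z) => //; split=> //; exists y.
have [|h hP] := @potential (fun x => f x (x.1 + 1, x.2)) (fun x => f x (x.1, x.2 + 1)).
  move=> x y /=.
  pose p0 := (x, y); pose p1 := (x + 1, y); pose p2 := (x, y + 1).
  pose p3 := (x + 1, y + 1).
  rewrite -/p0 -/p1 -/p2 -/p3.
  have k x' y' : x' \in [:: p0; p1; p2; p3] -> y' \in [:: p0; p1; p2; p3] -> king x' y'.
    by rewrite !inE /king => /or4P[]/eqP-> /or4P[]/eqP-> /=; lia.
  have e01 : nearest_neighbor p0 p1 by apply/nnP; apply: Or41.
  have e02 : nearest_neighbor p0 p2 by apply/nnP; apply: Or43.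
  have e13 : nearest_neighbor p1 p3 by apply/nnP; apply: Or43.
  have e23 : nearest_neighbor p2 p3 by apply/nnP; apply: Or41.
  have [[z zp B1z]|nB1] := pselect (exists2 z, z \in [:: p0; p1; p2; p3] & B1 z); last first.
    have nb z : z \in [:: p0; p1; p2; p3] -> ~ B1 z by move=> zp B1z; apply: nB1; exists z.
    have nf a b : a \in [:: p0; p1; p2; p3] -> b \in [:: p0; p1; p2; p3] -> f a b = false.
      by move=> ap bp; rewrite /f; apply/negbTE/norP; split; apply/asboolPn => -[/nb].
    by rewrite !nf // ?inE ?eqxx ?orbT.
  (* The corners of a unit square are king neighbours, so one corner in [B1] puts all its boundary
     corners in [B1]. On this square [f] is then the coboundary of the indicator of [D], hence
     closed. *)
  have fE a b : a \in [:: p0; p1; p2; p3] -> b \in [:: p0; p1; p2; p3] ->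
      nearest_neighbor a b -> f a b = `[< D a >] (+) `[< D b >].
    move=> ap bp ab.
    have ba : nearest_neighbor b a by rewrite nn_sym.
    rewrite /f; apply/idP/idP.
      case/orP => /asboolP[/B1B[Dx _] Cy].
        by rewrite (asboolT Dx) (asboolF (fun Db => disjCD Db Cy)).
      by rewrite (asboolT Dx) (asboolF (fun Db => disjCD Db Cy)).
    case: (asboolP (D a)) => Da; case: (asboolP (D b)) => Db //= _.
      apply/orP; left; apply/asboolP.
      have [//|Cb] := closedD Da ab.
      by split=> //; apply: (bP a b z) => //; exact: k.
    apply/orP; right; apply/asboolP.
    have [//|Ca] := closedD Db ba.
    by split=> //; apply: (bP b a z) => //; exact: k.
  rewrite !fE ?inE ?eqxx ?orbT //.
  by case: `[< D p0 >]; case: `[< D p1 >]; case: `[< D p2 >]; case: `[< D p3 >].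
have hE x y : nearest_neighbor x y -> h y = h x (+) f x y.
  case: x y => x1 x2 [y1 y2] /nnP[] [-> ->] /=.
  - by case: (hP x1 x2).
  - by case: (hP y1 y2) => -> _; rewrite fC -addbA addbb addbF.
  - by case: (hP x1 x2).
  - by case: (hP y1 y2) => _ ->; rewrite fC -addbA addbb addbF.
have hconst (E : set (int * int)) : (forall x y, E x -> E y -> f x y = false) ->
    forall x y, conn nearest_neighbor E x y -> h x = h y.
  move=> fE x y; move: x; apply: conn_indl => // x z Ex xz zy <-.
  by rewrite (hE _ _ xz) fE ?addbF //; exact: conn_left zy.
have [Du [u' Cu' uu']] := Bu; have [Dv [v' Cv' vv']] := Bv.
have hC : h u' = h v'.
  apply: (hconst C); last exact: connC.
  move=> x y Cx Cy; apply/negbTE/norP; split; apply/asboolPn => -[/B1B[Dz _] _];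
  exact: disjCD Dz _.
have hD : h u = h v.
  apply: (hconst D); last exact: connD.
  move=> x y Dx Dy; apply/negbTE/norP; split; apply/asboolPn => -[_];
  exact: disjCD.
have : h u' = ~~ h v'.
  rewrite (hE _ _ uu') (hE _ _ vv') -hD (_ : f u u' = true); last first.
    by apply/orP; left; apply/asboolP.
  rewrite (_ : f v v' = false) ?addbF ?addbT //.
  apply/negbTE/norP; split; apply/asboolPn; first by case.
  by case=> /B1B[Dv' _] _; exact: disjCD Dv' Cv'.
by rewrite hC; case: (h v').
Qed.

End Boundary.

(** * Contours and infinite clusters *)

Section Percolation.
Implicit Types (A B C K : set (int * int)) (u v : int * int) (n : nat).

Definition box n : set (int * int) := [set u : int * int | `|u.1| <= n%:Z /\ `|u.2| <= n%:Z].

Lemma finite_box n : finite_set (box n).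
Proof.
have fI : finite_set [set x : int | `|x| <= n%:Z].
  apply: (@sub_finite_set _ _ [set (i%:Z - n%:Z) | i in `I_(n + n).+1]).
    move=> x /= xn; exists (absz (x + n%:Z)); rewrite /=; lia.
  exact: finite_image (finite_II _).
apply: sub_finite_set (finite_setX fI fI).
by move=> [x y] [].
Qed.

Lemma in_box u m n : (absz u.1 <= m)%N -> (absz u.2 <= n)%N -> box (m + n) u.
Proof. by move=> um un; split; lia. Qed.

Lemma sub_box m n : (m <= n)%N -> box m `<=` box n.
Proof. by move=> mn u [u1 u2]; split; lia. Qed.

Lemma finite_sub_box A : finite_set A -> exists n, A `<=` box n.
Proof.
move=> /finite_seqP[s ->]; elim: s => [|u s [n IH]].
  by exists 0%N => x; rewrite /= in_nil.
exists (absz u.1 + absz u.2 + n)%N => x /=; rewrite inE => /predU1P[->|/IH].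
  exact: (sub_box (leq_addr _ _) (in_box (leqnn _) (leqnn _))).
by apply: sub_box; exact: leq_addl.
Qed.

Lemma infinite_notin_box A n : infinite_set A -> exists2 u, A u & ~ box n u.
Proof.
move=> infA; apply: contrapT => nex; apply: infA.
apply: sub_finite_set (finite_box n) => u Au.
by apply: contrapT => nbu; apply: nex; exists u.
Qed.

(** The path is self-avoiding, so that a bound for sets of distinct sites applies to it. *)
Definition long K u n : Prop :=
  exists p : seq (int * int),
    [/\ path king u p, uniq (u :: p), size p = n & forall x, x \in u :: p -> K x].

Lemma king_path_dist u p : path king u p ->
  `|(last u p).1 - u.1| <= (size p)%:Z /\ `|(last u p).2 - u.2| <= (size p)%:Z.
Proof.
elim: p u => [|v p IH] u /=; first by rewrite !subrr.
by rewrite {1}/king => /andP[/andP[uv1 uv2] /IH[h1 h2]]; split; lia.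
Qed.

(** Removing loops keeps the endpoints, and a king step moves each coordinate by at most one: at
    least [n] steps remain, of which the first [n] are kept. *)
Lemma conn_long K u v n : conn king K u v ->
  n%:Z <= `|v.1 - u.1| \/ n%:Z <= `|v.2 - u.2| -> long K u n.
Proof.
move=> [p [up pv pK]]; case: (shortenP up) pv => p' up' uniqp' sub pv nuv.
have np : (n <= @size (int * int) p')%N.
  by have [] := king_path_dist up'; rewrite pv; case: nuv; lia.
exists (take n p'); split.
- exact: take_path.
- by move: uniqp' => /= /andP[unp uniqp]; rewrite take_uniq // andbT;
    apply: contra unp; exact: mem_take.
- by rewrite size_takel.
- move=> x xp; apply: pK; move: xp; rewrite !inE => /orP[->//|/mem_take /sub ->].
  by rewrite orbT.
Qed.

Lemma infinite_conn_long K u n : infinite_set (component king K u) -> long K u n.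
Proof.
move=> /(@infinite_notin_box _ (absz u.1 + absz u.2 + n)%N)[v uv nbv].
apply: (conn_long uv); apply: contrapT => nn; apply: nbv; split.
  by have : ~ (n%:Z <= `|v.1 - u.1|); [move=> h; apply: nn; left|lia].
by have : ~ (n%:Z <= `|v.2 - u.2|); [move=> h; apply: nn; right|lia].
Qed.

Lemma nn_king u v : nearest_neighbor u v -> king u v.
Proof. by rewrite /nearest_neighbor /king => /eqP; lia. Qed.

Lemma conn_nn_king K u v : conn nearest_neighbor K u v -> conn king K u v.
Proof.
move: u; apply: conn_indl => [|x y Kx xy _]; first exact: conn_refl.
exact/conn_cons/nn_king.
Qed.

Lemma hline A (x y : int) n : (forall i, (i <= n)%N -> A (x + i%:Z, y)) ->
  conn nearest_neighbor A (x, y) (x + n%:Z, y).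
Proof.
elim: n => [|n IH] An; first by rewrite addr0; apply: conn_refl; rewrite -[x]addr0; exact: An.
apply: (conn_trans (IH _)) => [i ni|]; first exact/An/ltnW.
apply: conn_edge; [exact/An/leqnSn|exact: An|].
by apply/nnP; apply: Or41; congr pair; rewrite /=; lia.
Qed.

Lemma vline A (x y : int) n : (forall i, (i <= n)%N -> A (x, y + i%:Z)) ->
  conn nearest_neighbor A (x, y) (x, y + n%:Z).
Proof.
elim: n => [|n IH] An; first by rewrite addr0; apply: conn_refl; rewrite -[y]addr0; exact: An.
apply: (conn_trans (IH _)) => [i ni|]; first exact/An/ltnW.
apply: conn_edge; [exact/An/leqnSn|exact: An|].
by apply/nnP; apply: Or43; congr pair; rewrite /=; lia.
Qed.

Lemma hline2 A (x x' y : int) : (forall t, x <= t <= x' \/ x' <= t <= x -> A (t, y)) ->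
  conn nearest_neighbor A (x, y) (x', y).
Proof.
move=> AA; have [xx'|xx'] := leP x x'.
  have := @hline A x y (absz (x' - x)); rewrite (_ : x + _ = x'); last by lia.
  by apply=> i ni; apply: AA; lia.
have := @hline A x' y (absz (x' - x)); rewrite (_ : x' + _ = x); last by lia.
move=> h; apply: (conn_sym nn_sym); apply: h => i ni; apply: AA; lia.
Qed.

Lemma vline2 A (x y y' : int) : (forall t, y <= t <= y' \/ y' <= t <= y -> A (x, t)) ->
  conn nearest_neighbor A (x, y) (x, y').
Proof.
move=> AA; have [yy'|yy'] := leP y y'.
  have := @vline A x y (absz (y' - y)); rewrite (_ : y + _ = y'); last by lia.
  by apply=> i ni; apply: AA; lia.
have := @vline A x y' (absz (y' - y)); rewrite (_ : y' + _ = y); last by lia.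
move=> h; apply: (conn_sym nn_sym); apply: h => i ni; apply: AA; lia.
Qed.

(** A coordinate that exceeds [n] in absolute value is kept while the other one moves to n+1; then
    it can move in turn. Every site off the box thus reaches the same corner. *)
Lemma conn_outside n u v : ~ box n u -> ~ box n v ->
  conn nearest_neighbor (~` box n) u v.
Proof.
suff corner w : ~ box n w -> conn nearest_neighbor (~` box n) w (n%:Z + 1, n%:Z + 1).
  by move=> /corner nu /corner /(conn_sym nn_sym); exact: conn_trans.
case: w => x y nbw.
have [yn|yn] := ltP n%:Z `|y|.
  apply: (@conn_trans _ _ (n%:Z + 1, y)); first by apply: hline2 => t _ [] /=; lia.
  by apply: vline2 => t _ [] /=; lia.
have xn : n%:Z < `|x| by rewrite ltNge; apply/negP => xn; apply: nbw.
apply: (@conn_trans _ _ (x, n%:Z + 1)); first by apply: vline2 => t _ [] /=; lia.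
by apply: hline2 => t _ [] /=; lia.
Qed.

Variable K : set (int * int).
Hypothesis Kfin : forall u, exists n, ~ long K u n.

Lemma subset_only_finite_clusters B : B `<=` K -> only_finite_clusters B.
Proof.
move=> BK C [u Bu ->]; apply: contrapT => infC.
have [n nlong] := Kfin u; apply/nlong/infinite_conn_long.
apply: sub_infinite_set infC => v uv.
exact/conn_nn_king/(conn_sub BK uv).
Qed.

Variable A : set (int * int).
Hypothesis AK : ~` A `<=` K.

Section ComponentOfComplement.
Variables (C : set (int * int)) (y : int * int).
Hypothesis connC : forall u v, C u -> C v -> conn nearest_neighbor C u v.
Hypothesis CK : forall u v, C u -> ~ C v -> nearest_neighbor u v -> K v.
Hypothesis nCy : ~ C y.
Let D := component nearest_neighbor (~` C) y.

Lemma component_boundary_sub : boundary C D `<=` K.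
Proof.
by move=> v [Dv [u Cu vu]]; apply: (CK Cu); [exact: conn_right Dv|rewrite nn_sym].
Qed.

Lemma component_boundary_conn u v : boundary C D u -> boundary C D v -> conn king K u v.
Proof.
move=> Bu Bv; apply: conn_sub component_boundary_sub _.
apply: boundary_conn Bu Bv => //.
- by move=> w /(@conn_right _ _ _ _).
- by move=> w z; apply: component_conn2; exact: nn_sym.
- move=> w z Dw wz; have [Cz|nCz] := pselect (C z); [by right|left].
  by apply: component_edge wz _ => //; exact: nn_sym.
Qed.

(** The last site before the first entrance into [C] is still in the component [D]. The set [E]
    serves to locate it: below, the outside of a box or a half axis. *)
Lemma boundary_hit E z x : conn nearest_neighbor E z x -> D z -> C x ->
  exists2 b, boundary C D b & E b.
Proof.
move=> zx Dz Cx.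
have [a [b [Ca nCb _ ba zb]]] := conn_hit zx (conn_right Dz) Cx.
exists b; last by case: (conn_right zb).
split; last by exists a.
by apply: (conn_trans Dz); apply: conn_sub zb => w [].
Qed.

End ComponentOfComplement.

Lemma cluster_compl_adj u v w : component nearest_neighbor A u v ->
  ~ component nearest_neighbor A u w -> nearest_neighbor v w -> K w.
Proof. by move=> uv nuw vw; apply: AK => Aw; apply: nuw; exact: component_edge uv vw Aw. Qed.

(** For two distinct infinite clusters, the boundary between [C1] and the component of its
    complement containing [C2] would meet the outside of every box. Being king-connected in [K], it
    would contain arbitrarily long paths from one of its sites. *)
Lemma infinite_clusters_meet u1 u2 :
  infinite_set (component nearest_neighbor A u1) ->
  infinite_set (component nearest_neighbor A u2) ->
  component nearest_neighbor A u1 u2.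
Proof.
set C1 := component _ _ u1; set C2 := component _ _ u2 => inf1 inf2.
apply: contrapT => n12.
have C12 v : C2 v -> ~ C1 v.
  by move=> u2v u1v; apply: n12; apply: conn_trans u1v _; exact/(conn_sym nn_sym).
pose D := component nearest_neighbor (~` C1) u2.
have C2D v : C2 v -> D v.
  by move=> /(component_conn nn_sym); exact: conn_sub C12.
have connC u v : C1 u -> C1 v -> conn nearest_neighbor C1 u v.
  by apply: component_conn2; exact: nn_sym.
have CK u v : C1 u -> ~ C1 v -> nearest_neighbor u v -> K v by exact: cluster_compl_adj.
have infB : infinite_set (boundary C1 D).
  move=> /finite_sub_box[n Bn].
  have [x C1x nx] := infinite_notin_box n inf1.
  have [z C2z nz] := infinite_notin_box n inf2.
  by have [b /Bn bn nbn] := boundary_hit (conn_outside nz nx) (C2D _ C2z) C1x.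
have [b Bb _] := infinite_notin_box 0 infB.
have [n nlong] := Kfin b; apply/nlong/infinite_conn_long.
by apply: sub_infinite_set infB => v Bv; exact: component_boundary_conn Bb Bv.
Qed.

Hypothesis Kfar : exists N, forall a, (N <= a)%N -> ~ long K (a%:Z, 0) a.

(** Were all clusters finite, so would be the component of the origin once a box is added to [A].
    Its outer boundary is a contour in [K] that meets the positive half axis at some (a, 0) beyond
    the box, and also the negative half axis; this makes a path of length a from (a, 0). *)
Lemma infinite_cluster_exists :
  exists u, infinite_set (component nearest_neighbor A u).
Proof.
apply: contrapT => noinf.
have fincl u : finite_set (component nearest_neighbor A u).
  by apply: contrapT => infu; apply: noinf; exists u.
have [N farN] := Kfar.
(* Filling the box of radius [N] pushes the contour to distances where [farN] applies. *)
pose S := A `|` box N.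
pose C := component nearest_neighbor S 0.
have S0 : S 0 by right; split; rewrite normr0.
have C0 : C 0 by exact: conn_refl.
have : finite_set C.
  (* A site of [C] off the box is joined within [A] to a neighbour of the box, hence lies in one of
     finitely many finite clusters. *)
  apply: (@sub_finite_set _ _ (box N `|`
    \bigcup_(b in box N.+1) component nearest_neighbor A b)); last first.
    rewrite finite_setU; split; first exact: finite_box.
    by apply: bigcup_finite; [exact: finite_box|move=> b _; exact: fincl].
  move=> v Cv; have [bv|nbv] := pselect (box N v); [by left|right].
  have b0 : box N 0 by split; rewrite normr0.
  have [a [b [ba nbb _ eba vb]]] := conn_hit (conn_sym nn_sym Cv) nbv b0.
  exists b.
    have := nn_king eba; rewrite /king => /andP[h1 h2].
    by move: ba => [ba1 ba2]; split; lia.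
  apply: (conn_sym nn_sym); apply: conn_sub vb => w [[]//].
move=> /finite_sub_box[M CM].
pose y : int * int := (M.+1%:Z, 0).
have ybox : ~ box M y by rewrite /y => -[] /=; lia.
have nCy : ~ C y by move=> /CM.
pose D := component nearest_neighbor (~` C) y.
have connC u v : C u -> C v -> conn nearest_neighbor C u v.
  by apply: component_conn2; exact: nn_sym.
have CS u v : C u -> ~ C v -> nearest_neighbor u v -> ~ S v.
  by move=> Cu nCv uv Sv; apply: nCv; exact: component_edge Cu uv Sv.
have CK u v : C u -> ~ C v -> nearest_neighbor u v -> K v.
  by move=> Cu nCv uv; apply: AK => Av; apply: (CS _ _ Cu nCv uv); left.
have BS b : boundary C D b -> ~ box N b.
  move=> [Db [a Ca ba]] bb; rewrite nn_sym in ba.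
  by apply: (CS a b Ca (conn_right Db) ba); right.
have Dout z : ~ box M z -> D z.
  by move=> nz; apply: conn_sub (conn_outside ybox nz) => w nw /CM.
have [b Bb [b1 b2]] : exists2 b, boundary C D b & 0 <= b.1 /\ b.2 = 0.
  apply: (boundary_hit (x := 0) (z := y) (E := [set b : int * int | 0 <= b.1 /\ b.2 = 0])) => //.
    by apply: hline2 => t /= th; split=> //; lia.
  exact: Dout.
have [b' Bb' [b1' b2']] : exists2 b, boundary C D b & b.1 <= 0 /\ b.2 = 0.
  apply: (boundary_hit (x := 0) (z := (- M.+1%:Z, 0)) (E := [set b : int * int | b.1 <= 0 /\ b.2 = 0])) => //.
    by apply: hline2 => t /= th; split=> //; lia.
  by apply: Dout => -[] /=; lia.
have bN := BS _ Bb.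
have Nb : (N <= absz b.1)%N.
  by rewrite leqNgt; apply/negP => bN'; apply: bN; split; lia.
apply: (farN _ Nb); rewrite (_ : (_, 0) = b); last first.
  by case: b b1 b2 {Bb bN Nb} => x z /= x0 ->; congr pair; lia.
apply: (conn_long (component_boundary_conn connC CK Bb Bb')).
by left; lia.
Qed.

Lemma compl_unique_infinite_cluster : unique_infinite_cluster A.
Proof.
have [u infu] := infinite_cluster_exists.
have Au v : infinite_set (component nearest_neighbor A v) -> A v.
  by move=> /(infinite_notin_box 0)[w /conn_left].
exists (component nearest_neighbor A u); split.
  by split=> //; exists u => //; exact: Au.
move=> C' [[v Av ->] infv].
have uv := infinite_clusters_meet infu infv.
apply/seteqP; split=> w uw; last exact: conn_trans uv uw.
by apply: conn_trans uw; exact/(conn_sym nn_sym).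
Qed.

End Percolation.

(** * Peierls argument *)

Section MeasureUnion.
Context {R : realType} d {T : measurableType d} (mu : {measure set T -> \bar R}).

Lemma measure_big_setU_le (I : Type) (s : seq I) (Q : pred I) (F : I -> set T) :
  (forall i, Q i -> measurable (F i)) ->
  (mu (\big[setU/set0]_(i <- s | Q i) F i) <= \sum_(i <- s | Q i) mu (F i))%E.
Proof.
move=> mF; elim: s => [|i s IH]; first by rewrite !big_nil measure0.
rewrite !big_cons; case: ifPn => // Qi.
have mU : measurable (\big[setU/set0]_(j <- s | Q j) F j) by exact: bigsetU_measurable.
by apply: le_trans (measureU2 _ (mF _ Qi) mU) _; exact: leeD2l.
Qed.

Lemma ae_forall_count (I : countType) (Q : I -> T -> Prop) :
  (forall i, {ae mu, forall w, Q i w}) -> {ae mu, forall w i, Q i w}.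
Proof.
move=> aeQ.
have : {ae mu, forall w (n : nat), if unpickle n is Some i then Q i w else True}.
  by apply: ae_foralln => n; case: unpickle => [i|]; [exact: aeQ|exact: aeW].
by apply: filterS => w Qw i; have := Qw (pickle i); rewrite pickleK.
Qed.

End MeasureUnion.

Section Peierls.

(** The null shift is included because [king] is reflexive; hence nine choices per step. *)
Definition king_shifts : seq (int * int) :=
  [seq (i, j) | i <- [:: -1; 0; 1], j <- [:: -1; 0; 1]].

Fixpoint king_paths (n : nat) (u : int * int) : seq (seq (int * int)) :=
  if n is n'.+1 then
    flatten [seq [seq (u + s) :: p | p <- king_paths n' (u + s)] | s <- king_shifts]
  else [:: [::]].

Lemma king_pathsS n u : king_paths n.+1 u =
  flatten [seq [seq (u + s) :: p | p <- king_paths n (u + s)] | s <- king_shifts].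
Proof. by []. Qed.

Lemma size_king_paths n u : size (king_paths n u) = (9 ^ n)%N.
Proof.
elim: n u => // n IH u; rewrite [LHS]/= !size_cat !size_map !IH /=.
by rewrite expnS; lia.
Qed.

Lemma mem_king_paths n u p : path king u p -> size p = n -> p \in king_paths n u.
Proof.
elim: n u p => [|n IH] u [|v p] //.
rewrite king_pathsS => /andP[uv vp] [pn].
apply/flattenP; exists [seq v :: q | q <- king_paths n v]; last first.
  by apply: map_f; exact: IH.
apply/mapP; exists (v - u); last by rewrite subrKC.
case: u v uv {vp} => u1 u2 [v1 v2]; rewrite /king /= => /andP[h1 h2].
have -> : ((v1, v2) : int * int) - (u1, u2) = (v1 - u1, v2 - u2) by [].
have k x : `|x| <= 1 :> int -> x \in [:: -1; 0; 1] by rewrite !inE; lia.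
by apply/allpairsP; exists (v1 - u1, v2 - u2); split; rewrite //=; apply: k; rewrite distrC.
Qed.

Context {R : realType} d {Omega : measurableType d} (P : probability Omega R).
Variables (K : Omega -> set (int * int)) (eps : R).
Hypothesis mK : forall u, measurable [set w | K w u].
Hypothesis eps0 : 0 <= eps.
Hypothesis eps18 : eps <= 18%:R^-1.
Hypothesis PK : forall s : seq (int * int), uniq s ->
  (P [set w | forall u, u \in s -> K w u] <= (eps ^+ size s)%:E)%E.

Let allK (s : seq (int * int)) := [set w | forall u, u \in s -> K w u].

Let measurable_allK s : measurable (allK s).
Proof.
elim: s => [|u s IH].
  by rewrite (_ : allK _ = setT) //; apply/seteqP; split=> // w _ v; rewrite in_nil.
rewrite (_ : allK _ = [set w | K w u] `&` allK s); first exact: measurableI.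
apply/seteqP; split=> [w wK|w [wu ws] v].
  by split=> [|v vs]; apply: wK; rewrite inE ?eqxx ?vs ?orbT.
by rewrite inE => /predU1P[->|/ws].
Qed.

Let M (u : int * int) (n : nat) : set Omega :=
  \big[setU/set0]_(p <- king_paths n u | uniq (u :: p) && (size p == n)) allK (u :: p).

Let measurable_M u n : measurable (M u n).
Proof. by apply: bigsetU_measurable => p _; exact: measurable_allK. Qed.

Let long_M u n w : long (K w) u n -> M u n w.
Proof.
move=> [p [up uniqp pn pK]]; rewrite /M -bigcup_seq_cond; exists p => //=.
by rewrite mem_king_paths // pn eqxx andbT.
Qed.

(** Union bound: at most 9^n paths, each visiting n+1 distinct sites, and 9 [eps] is at most 1/2. *)
Let M_le u n : (P (M u n) <= (1 / (2 ^ n.+1)%:R)%:E)%E.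
Proof.
apply: (@le_trans _ _ (\sum_(p <- king_paths n u | uniq (u :: p) && (size p == n))
    P (allK (u :: p)))%E); first by apply: measure_big_setU_le => p _; exact: measurable_allK.
apply: (@le_trans _ _ (\sum_(p <- king_paths n u) (eps ^+ n.+1)%:E)%E).
  rewrite big_mkcond /=; apply: lee_sum => p _; case: ifPn => [/andP[up /eqP pn]|_].
    by have := @PK (u :: p) up; rewrite /= pn.
  by rewrite lee_fin exprn_ge0.
rewrite sumEFin lee_fin big_const_seq count_predT size_king_paths iter_addr_0.
rewrite -[leLHS]mulr_natl [in leLHS]natrX exprSr mulrA -exprMn.
have h9 : 9%:R * eps <= 2^-1 by have := eps18; lra.
apply: (@le_trans _ _ (2^-1 ^+ n * 2^-1)).
  apply: ler_pM => //; [by rewrite exprn_ge0 // mulr_ge0| |lra].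
  by apply: lerXn2r => //; rewrite nnegrE ?mulr_ge0 // invr_ge0.
by rewrite -exprSr natrX div1r exprVn.
Qed.

(** Borel-Cantelli, applied to the paths from a fixed site and to the paths of length n from (n, 0).
    The second family rules out contours around large boxes. *)
Lemma peierls : {ae P, forall w, (forall u, exists n, ~ long (K w) u n) /\
  (exists N, forall a, (N <= a)%N -> ~ long (K w) (a%:Z, 0) a)}.
Proof.
have BC (F : nat -> set Omega) : (forall n, measurable (F n)) ->
    (forall n, (P (F n) <= (1 / (2 ^ n.+1)%:R)%:E)%E) ->
    {ae P, forall w, exists N, forall n, (N <= n)%N -> ~ F n w}.
  move=> mF leF; exists (lim_sup_set F); split.
  - by apply: bigcap_measurable => // n _; apply: bigcup_measurable.
  - apply: lim_sup_set_cvg0 => //.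
    apply: (@le_lt_trans _ _ 1%:E); last exact: ltry.
    apply: le_trans (epsilon_trick0 xpredT (@ler01 R)).
    by apply: lee_nneseries => n *; [exact: measure_ge0|exact: leF].
  - move=> w /= nw n _; apply: contrapT => nF; apply: nw; exists n => k nk Fk.
    by apply: nF; exists k.
have ae1 : {ae P, forall w u, exists n, ~ long (K w) u n}.
  apply: ae_forall_count => u; apply: filterS (BC (M u) _ _) => // w [N NF].
  by exists N => /long_M; exact: NF.
have ae2 := BC (fun n => M (n%:Z, 0) n) (fun n => measurable_M _ n) (fun n => M_le _ n).
apply: filterS2 ae1 ae2 => w w1 [N NF]; split=> //.
by exists N => a /NF nM /long_M.
Qed.

End Peierls.

(** [A] and [B] are quantified inside the almost sure event, which depends on [K] alone: the level
    sets of [alpha] will enter only through inclusions in [K]. *)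
Lemma ae_percolation (R : realType) d (Omega : measurableType d)
    (P : probability Omega R) (K : Omega -> set (int * int)) (eps : R) :
  (forall u, measurable [set w | K w u]) -> 0 <= eps -> eps <= 18%:R^-1 ->
  (forall s : seq (int * int), uniq s ->
     (P [set w | forall u, u \in s -> K w u] <= (eps ^+ size s)%:E)%E) ->
  {ae P, forall w (A B : set (int * int)), ~` A `<=` K w -> B `<=` K w ->
     unique_infinite_cluster A /\ only_finite_clusters B}.
Proof.
move=> mK eps0 eps18 PK; apply: filterS (peierls mK eps0 eps18 PK) => w [Kfin Kfar] A B AK BK.
split; first exact: compl_unique_infinite_cluster AK Kfar.
exact: subset_only_finite_clusters BK.
Qed.

(** * Gaussian integrals *)

Section LebesgueShift.
Context {R : realType}.
Local Notation mu := (@lebesgue_measure R).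

Lemma measurable_addr (c : R) :
  measurable_fun setT ((fun x => x + c) : measurableTypeR R -> measurableTypeR R).
Proof. exact: measurable_funD. Qed.

Lemma lebesgue_measure_shift (c : R) (A : set R) : measurable A ->
  pushforward mu ((fun x => x + c) : measurableTypeR R -> measurableTypeR R) A = mu A.
Proof.
move=> mA; apply/esym/lebesgue_measure_unique => //=; first exact: measurable_addr.
move=> _ _ [[a b]] _ <-; rewrite /pushforward.
rewrite (_ : _ @^-1` _ = `](a - c), (b - c)]%classic); last first.
  by apply/seteqP; split=> x /=; rewrite !in_itv /= ltrBlDr lerBrDr.
by rewrite !lebesgue_measure_itv /= !lte_fin ltrD2r -!EFinD opprB addrA subrK.
Qed.

Lemma ge0_integral_shift (c : R) (f : R -> \bar R) : measurable_fun setT f ->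
  (forall x, 0 <= f x)%E -> (\int[mu]_x f (x + c)%R = \int[mu]_x f x)%E.
Proof.
move=> mf f0.
rewrite [RHS](eq_measure_integral (pushforward mu
  ((fun x => x + c) : measurableTypeR R -> measurableTypeR R))).
- exact: measurable_addr.
- by move=> mD; rewrite ge0_integral_pushforward.
- by move=> ? A mA _; exact/esym/lebesgue_measure_shift.
Qed.

Lemma ge0_integral_normal_prob (s : R) (f : R -> \bar R) : measurable_fun setT f ->
  (forall x, 0 <= f x)%E ->
  (\int[normal_prob 0 s]_x f x = \int[mu]_x (f x * (normal_pdf 0 s x)%:E))%E.
Proof.
move=> mf f0.
have dom := normal_prob_dominates (0 : R) s.
rewrite -(Radon_Nikodym_SigmaFinite.change_of_variables dom) //.
apply: ae_eq_integral => //.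
- apply: emeasurable_funM => //; apply: (measurable_int mu).
  exact: Radon_Nikodym_SigmaFinite.f_integrable.
- apply: emeasurable_funM => //; apply/measurable_EFinP.
  exact: measurable_normal_pdf.
apply: ae_eqe_mul2l => /=.
apply: integral_ae_eq => //=.
- exact: Radon_Nikodym_SigmaFinite.f_integrable.
- by apply/measurable_EFinP; exact: measurable_normal_pdf.
- by move=> E _ mE; rewrite -Radon_Nikodym_SigmaFinite.f_integral.
Qed.

End LebesgueShift.

Section CenteredGaussian.
Context {R : realType} d {T : measurableType d} (P : probability T R).
Variables (Z : T -> R) (s : R).
Hypothesis mZ : measurable_fun setT Z.
Hypothesis lawZ : forall V : set R, measurable V ->
  pushforward P Z V = if s == 0 then \d_(0 : R) V else normal_prob 0 s V.

Lemma normal_pdf_tilt (t x : R) : s != 0 ->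
  expR (t * x) * normal_pdf 0 s x =
  expR (t ^+ 2 * s ^+ 2 / 2) * normal_pdf 0 s (x - t * s ^+ 2).
Proof.
move=> sn0; rewrite normal_pdfE // mulrCA [RHS]mulrCA /normal_fun -!expRD.
by congr (_ * expR _); field.
Qed.

Lemma ge0_gaussian_integral (g : R -> R) : measurable_fun setT g ->
  (forall x, 0 <= g x) ->
  (\int[P]_w (g (Z w))%:E = if s == 0%R then (g 0%R)%:E
    else \int[lebesgue_measure]_x ((g x)%:E * (normal_pdf 0 s x)%:E))%E.
Proof.
move=> mg g0.
have mEg : measurable_fun setT (fun x => (g x)%:E) by exact/measurable_EFinP.
have Eg0 x : (0 <= (g x)%:E)%E by rewrite lee_fin.
have [sz|sn0] := eqVneq s 0.
  transitivity (\int[pushforward P Z]_x (g x)%:E)%E.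
    by rewrite ge0_integral_pushforward.
  rewrite (eq_measure_integral (\d_(0 : R))).
    by rewrite integral_dirac // diracT mul1e.
  by move=> A mA _; rewrite [LHS]lawZ // sz eqxx.
transitivity (\int[pushforward P (Z : T -> measurableTypeR R)]_x (g x)%:E)%E.
  by rewrite ge0_integral_pushforward.
transitivity (\int[normal_prob 0%R s]_x (g x)%:E)%E.
  by apply: eq_measure_integral => A mA _; rewrite [LHS]lawZ // (negbTE sn0).
by rewrite ge0_integral_normal_prob.
Qed.

(** Cameron-Martin formula in dimension one: weighting by an exponential shifts the Gaussian
    variable. Being stated for nonnegative functions, it also proves that exponential moments are
    finite. *)
Lemma ge0_gaussian_tilt (t : R) (f : R -> R) : measurable_fun setT f ->
  (forall x, 0 <= f x) ->
  (\int[P]_w (f (Z w) * expR (t * Z w))%R%:E =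
   (expR (t ^+ 2 * s ^+ 2 / 2))%:E * \int[P]_w (f (Z w + t * s ^+ 2))%:E)%E.
Proof.
move=> mf f0.
have mexp : measurable_fun setT (fun x => expR (t * x) : R).
  exact/measurableT_comp.
have mshift (c : R) : measurable_fun setT (fun x : R => f (x + c)).
  by apply: measurableT_comp => //; exact: measurable_addr.
have mpdf := measurable_normal_pdf (0 : R) s.
rewrite (ge0_gaussian_integral (g := fun x => f x * expR (t * x))); first last.
- by move=> x; rewrite mulr_ge0 ?expR_ge0.
- exact: measurable_funM.
rewrite (ge0_gaussian_integral (g := fun x => f (x + t * s ^+ 2))) //.
case: ifPn => [/eqP sz|sn0].
  by rewrite sz expr0n /= !mulr0 mul0r expR0 mulr1 mul1e addr0.
rewrite -[in RHS](@ge0_integral_shift _ (- (t * s ^+ 2))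
  (fun x : R => ((f (x + t * s ^+ 2))%:E * (normal_pdf 0 s x)%:E)%E)); first last.
- by move=> x; rewrite -EFinM lee_fin mulr_ge0 // normal_pdf_ge0.
- by apply/emeasurable_funM; exact/measurable_EFinP.
rewrite -ge0_integralZl ?lee_fin ?expR_ge0 //; first last.
- by move=> x _; rewrite -EFinM lee_fin mulr_ge0 // normal_pdf_ge0.
- apply/emeasurable_funM; apply/measurable_EFinP.
    apply: (@measurableT_comp _ _ _ _ _ _ (fun x : R => f (x + t * s ^+ 2))) => //.
    exact: measurable_addr.
  by apply: measurableT_comp => //; exact: measurable_addr.
apply: eq_integral => x _; rewrite -!EFinM; congr EFin.
by rewrite subrK -[LHS]mulrA normal_pdf_tilt // mulrCA.
Qed.

Lemma gaussian_mgf (t : R) :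
  (\int[P]_w (expR (t * Z w))%:E = (expR (t ^+ 2 * s ^+ 2 / 2))%:E)%E.
Proof.
have := @ge0_gaussian_tilt t (cst 1) (measurable_cst _) (fun=> ler01).
rewrite [X in (_ * X)%E](_ : _ = 1%:E); last first.
  by rewrite (eq_integral (cst 1%:E)) // integral_cst // mul1e; exact: probability_setT.
rewrite mule1 => <-.
by apply: eq_integral => w _; rewrite /= mul1r.
Qed.


Lemma integrable_expR_norm (c : R) :
  P.-integrable setT (fun w => (expR (c * `|Z w|))%:E).
Proof.
have mexp t : measurable_fun setT (fun w => (expR (t * Z w))%:E).
  by apply/measurable_EFinP; apply: measurableT_comp => //; exact: measurable_funM.
have int t : P.-integrable setT (fun w => (expR (t * Z w))%:E).
  apply/integrableP; split=> //.
  under eq_integral do rewrite gee0_abs ?lee_fin ?expR_ge0 //.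
  by rewrite gaussian_mgf ltry.
apply: (le_integrable _ _ _ (integrableD _ (int c) (int (- c)))) => //.
  apply/measurable_EFinP; apply: measurableT_comp => //; apply: measurable_funM => //.
  exact: measurableT_comp.
move=> w _; rewrite /= lee_fin (ger0_norm (expR_ge0 _)).
rewrite [leRHS]ger0_norm ?addr_ge0 ?expR_ge0 //.
have [z0|z0] := leP 0 (Z w).
  by rewrite ger0_norm // lerDl expR_ge0.
by rewrite ltr0_norm // mulrN mulNr lerDr expR_ge0.
Qed.

Lemma integrable_dom_expR (c : R) (g : T -> R) : measurable_fun setT g ->
  (forall w, `|g w| <= expR (c * `|Z w|)) -> P.-integrable setT (EFin \o g).
Proof.
move=> mg gle; apply: (le_integrable _ _ _ (integrable_expR_norm c)) => //.
  exact/measurable_EFinP.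
by move=> w _; rewrite /= lee_fin (ger0_norm (expR_ge0 _)).
Qed.

(** Domination by an exponential of |Z| permits differentiation under the integral. The weight [h]
    will be 1 for the first moment, [Z] for the second, and a sine for Stein's identity. *)
Lemma is_derive_gaussian_laplace (h : T -> R) (a : R) : measurable_fun setT h ->
  (forall w, `|h w| <= expR `|Z w|) ->
  is_derive a 1 (fun t => \int[P]_w (h w * expR (t * Z w)))
    (\int[P]_w (h w * Z w * expR (a * Z w))).
Proof.
move=> mh hle.
pose f (t : R) w := h w * expR (t * Z w).
pose M := `|a| + 1.
have Ia : `]a - 1, a + 1[%classic a by rewrite /= in_itv /=; lra.
have mexp t : measurable_fun setT (fun w => expR (t * Z w)).
  by apply: measurableT_comp => //; exact: measurable_funM.
have expt t w : `]a - 1, a + 1[%classic t -> expR (t * Z w) <= expR (M * `|Z w|).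
  rewrite /= in_itv /= => ta; rewrite ler_expR; apply: le_trans (ler_norm _) _.
  rewrite normrM ler_wpM2r // /M -lerBlDl; apply: le_trans (lerB_dist _ _) _.
  by rewrite ler_norml; move: ta; lra.
have intf t : `]a - 1, a + 1[%classic t -> P.-integrable setT (EFin \o f t).
  move=> It; apply: (@integrable_dom_expR (1 + M)); first exact: measurable_funM.
  move=> w; rewrite /f normrM (ger0_norm (expR_ge0 _)) mulrDl mul1r.
  by rewrite expRD ler_pM ?expR_ge0 // expt.
have der (t : R) w : is_derive t 1 (f ^~ w) (h w * Z w * expR (t * Z w)).
  rewrite /f; apply: is_derive_eq.
  by rewrite /= -![_ *: _]/(_ * _); ring.
have dE t w : partial1of2 f t w = h w * Z w * expR (t * Z w).
  by rewrite partial1of2E; have := der t w => /@derive_val.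
(* One |Z| bounds [h], another one the factor [Z], and [M] |Z| bounds the exponential for t within 1
   of [a]. *)
pose G w := expR ((2 + M) * `|Z w|).
have intG : P.-integrable setT (EFin \o G) by exact: integrable_expR_norm.
have Gub t w : `]a - 1, a + 1[%classic t -> setT w -> `|partial1of2 f t w| <= G w.
  move=> It _; rewrite dE !normrM (ger0_norm (expR_ge0 _)) /G.
  rewrite (_ : (2 + M) * _ = `|Z w| + `|Z w| + M * `|Z w|); last by ring.
  rewrite !expRD ler_pM ?expR_ge0 ?mulr_ge0 ?expt // ler_pM //.
  by apply: le_trans (expR_ge1Dx _); rewrite lerDr.
have derf t w : `]a - 1, a + 1[%classic t -> setT w -> derivable (f ^~ w) t 1.
  by move=> _ _; exact: (@ex_derive _ _ _ _ _ _ _ (der t w)).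
have G0 w : 0 <= G w by exact: expR_ge0.
apply: DeriveDef.
  exact: (derivable_under_integral measurableT Ia intf derf G0 intG Gub).
rewrite -derive1E (differentiation_under_integral measurableT Ia intf derf G0 intG Gub).
by apply: eq_Rintegral => w _; rewrite dE.
Qed.

Lemma gaussian_mgfR (t : R) : \int[P]_w expR (t * Z w) = expR (t ^+ 2 * s ^+ 2 / 2).
Proof. by rewrite /Rintegral gaussian_mgf. Qed.

Lemma is_derive_expR_sqr (t : R) :
  is_derive t 1 (fun x => expR (x ^+ 2 * s ^+ 2 / 2))
    (t * s ^+ 2 * expR (t ^+ 2 * s ^+ 2 / 2)).
Proof.
apply: is_derive_eq.
by rewrite /= -![_ *: _]/(_ * _); field.
Qed.

Lemma gaussian_moment1_tilt (a : R) :
  \int[P]_w (Z w * expR (a * Z w)) = a * s ^+ 2 * expR (a ^+ 2 * s ^+ 2 / 2).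
Proof.
have D1 := @is_derive_gaussian_laplace (cst 1) a (measurable_cst _).
have /D1 {D1} : forall w, `|cst 1 w : R| <= expR `|Z w|.
  by move=> w; rewrite normr1 -expR0 ler_expR.
rewrite (_ : (fun t => _) = fun t => expR (t ^+ 2 * s ^+ 2 / 2)); last first.
  apply/funext => t; rewrite -gaussian_mgfR.
  by apply: eq_Rintegral => w _; rewrite /= mul1r.
move=> /@derive_val; have /@derive_val -> := is_derive_expR_sqr a; move=> ->.
by apply: eq_Rintegral => w _; rewrite /= mul1r.
Qed.

Lemma gaussian_moment2 : \int[P]_w (Z w ^+ 2) = s ^+ 2.
Proof.
have := @is_derive_gaussian_laplace Z 0 mZ.
have Zle w : `|Z w| <= expR `|Z w|.
  by apply: le_trans (expR_ge1Dx _); rewrite lerDr.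
move=> /(_ Zle).
rewrite (_ : (fun t => _) = fun t => t * s ^+ 2 * expR (t ^+ 2 * s ^+ 2 / 2)); last first.
  by apply/funext => t; rewrite -gaussian_moment1_tilt.
move=> /@derive_val.
rewrite (_ : \int[P]_w (Z w * Z w * expR (0 * Z w)) = \int[P]_w (Z w ^+ 2)); last first.
  by apply: eq_Rintegral => w _; rewrite mul0r expR0 mulr1 expr2.
move=> <-.
have De := is_derive_expR_sqr 0.
have D2 : is_derive (0 : R) 1 (fun t => t * s ^+ 2 * expR (t ^+ 2 * s ^+ 2 / 2)) (s ^+ 2).
  apply: is_derive_eq.
  rewrite /= -![_ *: _]/(_ * _).
  by rewrite expr0n /= !mul0r expR0; ring.
by rewrite derive_val.
Qed.

Lemma measurable_cosZ (b c : R) : measurable_fun setT (fun w => cos (b * Z w + c)).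
Proof.
apply: (@measurableT_comp _ _ _ _ _ _ cos).
  by apply: continuous_measurable_fun; exact: continuous_cos.
by apply: measurable_funD => //; exact: measurable_funM.
Qed.

Lemma measurable_sinZ (b c : R) : measurable_fun setT (fun w => sin (b * Z w + c)).
Proof.
apply: (@measurableT_comp _ _ _ _ _ _ sin).
  by apply: continuous_measurable_fun; exact: continuous_sin.
by apply: measurable_funD => //; exact: measurable_funM.
Qed.

Lemma norm_cos_le1 (x : R) : `|cos x| <= 1.
Proof. by rewrite ler_norml cos_geN1 cos_le1. Qed.

Lemma norm_sin_le1 (x : R) : `|sin x| <= 1.
Proof. by rewrite ler_norml sin_geN1 sin_le1. Qed.

Lemma Rintegral_prob_cst (k : R) : \int[P]_w cst k w = k.
Proof.
rewrite Rintegral_cst // -[RHS]mulr1; congr (_ * _).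
exact: (congr1 fine (probability_setT P)).
Qed.

Lemma integrable_bounded_fun (k : R) (g : T -> R) : measurable_fun setT g ->
  (forall w, `|g w| <= k) -> P.-integrable setT (EFin \o g).
Proof.
move=> mg gk.
apply: (@le_integrable _ _ _ P setT measurableT _ (EFin \o cst k)); last exact: finite_measure_integrable_cst.
  exact/measurable_EFinP.
by move=> w _; rewrite /= lee_fin; apply: le_trans (gk w) (ler_norm _).
Qed.

Lemma gaussian_sin_tilt (b c t : R) :
  \int[P]_w (sin (b * Z w + c) * expR (t * Z w)) =
  expR (t ^+ 2 * s ^+ 2 / 2) *
  (cos (b * t * s ^+ 2) * \int[P]_w sin (b * Z w + c) +
   sin (b * t * s ^+ 2) * \int[P]_w cos (b * Z w + c)).
Proof.
have mexp : measurable_fun setT (fun w => expR (t * Z w)).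
  by apply: measurableT_comp => //; exact: measurable_funM.
have int1 : P.-integrable setT (EFin \o (fun w => expR (t * Z w))).
  apply: (@integrable_dom_expR `|t|) => // w.
  rewrite ger0_norm ?expR_ge0 // ler_expR; apply: le_trans (ler_norm _) _.
  by rewrite normrM.
have int2 : P.-integrable setT (EFin \o (fun w => sin (b * Z w + c) * expR (t * Z w))).
  apply: (@integrable_dom_expR `|t|).
    by apply: measurable_funM => //; exact: measurable_sinZ.
  move=> w; rewrite normrM (ger0_norm (expR_ge0 _)).
  rewrite -[leRHS]mul1r ler_pM ?norm_sin_le1 ?expR_ge0 //.
  rewrite ler_expR; apply: le_trans (ler_norm _) _.
  by rewrite normrM.
have intS := integrable_bounded_fun (measurable_sinZ b c) (fun w => norm_sin_le1 _).
have intC := integrable_bounded_fun (measurable_cosZ b c) (fun w => norm_cos_le1 _).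
(* One is added to the sine to make it nonnegative; the moment generating function removes its
   contribution. *)
have := @ge0_gaussian_tilt t (fun x => 1 + sin (b * x + c)).
have msin : measurable_fun setT (fun x : R => 1 + sin (b * x + c)).
  apply: measurable_funD => //.
  apply: (@measurableT_comp _ _ _ _ _ _ sin).
    by apply: continuous_measurable_fun; exact: continuous_sin.
  by apply: measurable_funD => //; exact: measurable_funM.
move=> /(_ msin).
have sin1 (x : R) : 0 <= 1 + sin (b * x + c).
  by have := sin_geN1 (b * x + c); lra.
move=> /(_ sin1) /(congr1 fine); rewrite fineM //; last first.
  apply: integrable_fin_num => //; apply: (@integrable_bounded_fun 2).
    by apply: measurableT_comp msin _; exact: measurable_funD.
  move=> w; rewrite ger0_norm //.
  have := sin_le1 (b * (Z w + t * s ^+ 2) + c); lra.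
have -> : fine (\int[P]_w ((1 + sin (b * Z w + c)) * expR (t * Z w))%R%:E)%E =
    expR (t ^+ 2 * s ^+ 2 / 2) + \int[P]_w (sin (b * Z w + c) * expR (t * Z w)).
  rewrite -gaussian_mgfR -RintegralD //.
  by congr fine; apply: eq_integral => w _; rewrite mulrDl mul1r.
have -> : fine (\int[P]_w (1 + sin (b * (Z w + t * s ^+ 2) + c))%:E)%E =
    1 + (cos (b * t * s ^+ 2) * \int[P]_w sin (b * Z w + c) +
         sin (b * t * s ^+ 2) * \int[P]_w cos (b * Z w + c)).
  have int0 : P.-integrable setT (EFin \o cst (1 : R)).
    exact: finite_measure_integrable_cst.
  have intSZ k : P.-integrable setT (EFin \o (fun w => k * sin (b * Z w + c))).
    rewrite (_ : _ \o _ = fun w => (k%:E * (sin (b * Z w + c))%:E)%E) //.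
    exact: integrableZl.
  have intCZ k : P.-integrable setT (EFin \o (fun w => k * cos (b * Z w + c))).
    rewrite (_ : _ \o _ = fun w => (k%:E * (cos (b * Z w + c))%:E)%E) //.
    exact: integrableZl.
  rewrite -!RintegralZl // -RintegralD //.
  rewrite -[X in _ = X + _]Rintegral_prob_cst.
  rewrite -RintegralD //; last first.
    rewrite (_ : _ \o _ = ((EFin \o (fun w => cos (b * t * s ^+ 2) * sin (b * Z w + c))%R) \+
      (EFin \o (fun w => sin (b * t * s ^+ 2) * cos (b * Z w + c))%R))%E) //.
    exact: integrableD.
  congr fine; apply: eq_integral => w _; congr EFin; congr (_ + _).
  rewrite (_ : b * (Z w + t * s ^+ 2) + c = (b * Z w + c) + b * t * s ^+ 2); last by ring.
  by rewrite sinD; ring.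
by rewrite /= mulrDr mulr1 => /addrI.
Qed.

(** Stein's identity for a sine, by differentiating the tilted integral at 0. *)
Lemma gaussian_sin_moment (b c : R) :
  \int[P]_w (Z w * sin (b * Z w + c)) = b * s ^+ 2 * \int[P]_w cos (b * Z w + c).
Proof.
have := @is_derive_gaussian_laplace (fun w => sin (b * Z w + c)) 0 (measurable_sinZ b c).
have sinle w : `|sin (b * Z w + c)| <= expR `|Z w|.
  apply: le_trans (norm_sin_le1 _) _; apply: le_trans (expR_ge1Dx _); rewrite lerDl //.
move=> /(_ sinle).
rewrite (_ : (fun t => _) = fun t => expR (t ^+ 2 * s ^+ 2 / 2) *
  (cos (b * t * s ^+ 2) * \int[P]_w sin (b * Z w + c) +
   sin (b * t * s ^+ 2) * \int[P]_w cos (b * Z w + c))); last first.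
  by apply/funext => t; rewrite -gaussian_sin_tilt.
move=> /@derive_val.
rewrite (_ : \int[P]_w (sin (b * Z w + c) * Z w * expR (0 * Z w)) =
  \int[P]_w (Z w * sin (b * Z w + c))); last first.
  by apply: eq_Rintegral => w _; rewrite mul0r expR0 mulr1 mulrC.
move=> <-.
have De := is_derive_expR_sqr 0.
set S := \int[P]_w sin (b * Z w + c); set C := \int[P]_w cos (b * Z w + c).
have D2 : is_derive (0 : R) 1 (fun t => expR (t ^+ 2 * s ^+ 2 / 2) *
    (cos (b * t * s ^+ 2) * S + sin (b * t * s ^+ 2) * C)) (b * s ^+ 2 * C).
  apply: is_derive_eq.
  rewrite /= -![_ *: _]/(_ * _).
  by rewrite expr0n /= !(mul0r, mulr0) expR0 sin0 cos0; ring.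
by rewrite derive_val.
Qed.

Lemma is_derive_gaussian_cos (c a : R) :
  is_derive a 1 (fun b => \int[P]_w cos (b * Z w + c))
    (- (a * s ^+ 2 * \int[P]_w cos (a * Z w + c))).
Proof.
rewrite -gaussian_sin_moment.
pose f (b : R) w := cos (b * Z w + c).
have Ia : `]a - 1, a + 1[%classic a by rewrite /= in_itv /=; lra.
have intf t : `]a - 1, a + 1[%classic t -> P.-integrable setT (EFin \o f t).
  by move=> _; apply: (@integrable_bounded_fun 1) => [|w]; [exact: measurable_cosZ|exact: norm_cos_le1].
have der (t : R) w : is_derive t 1 (f ^~ w) (- (Z w * sin (t * Z w + c))).
  rewrite /f; apply: is_derive_eq.
  by rewrite /= -![_ *: _]/(_ * _); ring.
have dE t w : partial1of2 f t w = - (Z w * sin (t * Z w + c)).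
  by rewrite partial1of2E; have := der t w => /@derive_val.
pose G w := expR (1 * `|Z w|).
have intG : P.-integrable setT (EFin \o G) by exact: integrable_expR_norm.
have Gub t w : `]a - 1, a + 1[%classic t -> setT w -> `|partial1of2 f t w| <= G w.
  move=> It _; rewrite dE normrN normrM /G mul1r -[leRHS]mulr1.
  rewrite ler_pM ?norm_sin_le1 //.
  by apply: le_trans (expR_ge1Dx _); rewrite lerDr.
have derf t w : `]a - 1, a + 1[%classic t -> setT w -> derivable (f ^~ w) t 1.
  by move=> _ _; exact: (@ex_derive _ _ _ _ _ _ _ (der t w)).
have G0 w : 0 <= G w by exact: expR_ge0.
apply: DeriveDef.
  exact: (derivable_under_integral measurableT Ia intf derf G0 intG Gub).
rewrite -derive1E (differentiation_under_integral measurableT Ia intf derf G0 intG Gub).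
have intZ : P.-integrable setT (EFin \o (fun w => Z w * sin (a * Z w + c))).
  apply: (@integrable_dom_expR 1).
    by apply: measurable_funM => //; exact: measurable_sinZ.
  by move=> w; have := Gub a w Ia Logic.I; rewrite dE normrN.
rewrite -[RHS]mulN1r -RintegralZl //.
by apply: eq_Rintegral => w _; rewrite dE mulN1r.
Qed.

(** By Stein's identity C' = - b s^2 C, so exp(b^2 s^2 / 2) C(b) is constant; its values at 0 and 1
    are compared. The phase [c] covers the real and imaginary parts of the characteristic function
    at once. *)
Lemma gaussian_cos (c : R) : \int[P]_w cos (Z w + c) = expR (- (s ^+ 2 / 2)) * cos c.
Proof.
pose C b := \int[P]_w cos (b * Z w + c).
have D (b : R) : is_derive b 1 (fun x : R => expR (x ^+ 2 * s ^+ 2 / 2) * C x) 0.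
  have De := is_derive_expR_sqr b; have DC := is_derive_gaussian_cos c b.
  apply: is_derive_eq.
  by rewrite -![_ *: _]/(_ * _) /C; ring.
have := is_derive_0_is_cst 1 0 D.
rewrite expr1n expr0n /= !mul0r mul1r expR0 mul1r.
have -> : C 0 = cos c.
  rewrite /C (_ : \int[P]_w _ = \int[P]_w (cst (cos c) w)).
    by rewrite Rintegral_prob_cst.
  by apply: eq_Rintegral => w _; rewrite mul0r add0r.
move=> <-; rewrite mulrA -expRD addNr expR0 mul1r.
by apply: eq_Rintegral => w _; rewrite mul1r.
Qed.

Lemma gaussian_chernoff (V a : R) : s ^+ 2 <= V -> 0 < V -> 0 <= a ->
  (P [set w | (a <= Z w)%R] <= (expR (- (a ^+ 2 / (2 * V))))%:E)%E.
Proof.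
move=> sV V0 a0.
have mA : measurable [set w | a <= Z w].
  rewrite (_ : [set w | _] = Z @^-1` `[a, +oo[%classic).
    by rewrite -[_ @^-1` _]setTI; exact: mZ.
  by apply/seteqP; split=> w /=; rewrite in_itv /= andbT.
(* The optimal parameter for the variance bound [V], meaningful for a degenerate law as well. *)
pose t := a / V.
have t0 : 0 <= t by rewrite divr_ge0 // ltW.
apply: (@le_trans _ _ (\int[P]_w (expR (- (t * a)) * expR (t * Z w))%:E)%E).
  rewrite -[X in P X]setIT -integral_indic //.
  apply: ge0_le_integral => //.
  - by apply/measurable_EFinP; exact: measurable_indic.
  - apply/measurable_EFinP; apply: measurable_funM => //.
    by apply: measurableT_comp => //; exact: measurable_funM.
  move=> w _; rewrite lee_fin indicE.
  case: (boolP (w \in _)) => [/set_mem /= Zw|_]; last by rewrite mulr_ge0 ?expR_ge0.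
  by rewrite -expRD -[leLHS]expR0 ler_expR addrC -mulrBr mulr_ge0 // subr_ge0.
under eq_integral do rewrite EFinM.
rewrite ge0_integralZl ?lee_fin ?expR_ge0 //; last first.
  by apply/measurable_EFinP/measurableT_comp => //; exact: measurable_funM.
rewrite gaussian_mgf -EFinM -expRD lee_fin ler_expR /t.
rewrite (_ : - (a ^+ 2 / (2 * V)) = - (a / V * a) + (a / V) ^+ 2 * V / 2); last first.
  by field; rewrite gt_eqF.
by rewrite lerD2l ler_pM2r // ler_wpM2l // sqr_ge0.
Qed.

End CenteredGaussian.

(** * Gaussian families *)

Section GaussianField.
Context {R : realType} d {T : measurableType d} (P : probability T R).

Definition gaussian_law (Z : T -> R) (s : R) : Prop :=
  [/\ measurable_fun setT Z, 0 <= s & forall V : set R, measurable V ->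
    pushforward P Z V = if s == 0 then \d_(0 : R) V else normal_prob 0 s V].

Definition lincomb (I : Type) (X : I -> T -> R) (L : seq (R * I)) (w : T) : R :=
  \sum_(p <- L) p.1 * X p.2 w.

Definition quad (I : Type) (c : I -> I -> R) (L : seq (R * I)) : R :=
  \sum_(p <- L) \sum_(p' <- L) p.1 * p'.1 * c p.2 p'.2.

(* [c] is the covariance of the jointly Gaussian centered family [X]. *)
Definition gaussian_field (I : Type) (X : I -> T -> R) (c : I -> I -> R) : Prop :=
  forall L : seq (R * I), exists s, gaussian_law (lincomb X L) s /\ s ^+ 2 = quad c L.

Variables (I : Type) (X : I -> T -> R) (c : I -> I -> R).
Hypothesis XG : gaussian_field X c.

Lemma gaussian_field_measurable u : measurable_fun setT (X u).
Proof.
have [s [[mZ _ _] _]] := XG [:: (1, u)].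
by apply: eq_measurable_fun mZ => w _; rewrite /lincomb big_seq1 mul1r.
Qed.

Lemma measurable_lincomb L : measurable_fun setT (lincomb X L).
Proof. by have [s [[]]] := XG L. Qed.

Lemma gaussian_field_chernoff (L : seq (R * I)) (V a : R) : quad c L <= V -> 0 < V -> 0 <= a ->
  (P [set w | (a <= lincomb X L w)%R] <= (expR (- (a ^+ 2 / (2 * V))))%:E)%E.
Proof.
have [s [[mZ s0 lawZ] <-]] := XG L.
by apply: (gaussian_chernoff mZ lawZ).
Qed.

Lemma gaussian_field_cos (L : seq (R * I)) (b : R) :
  \int[P]_w cos (lincomb X L w + b) = expR (- (quad c L / 2)) * cos b.
Proof.
have [s [[mZ s0 lawZ] <-]] := XG L.
exact: (gaussian_cos mZ lawZ).
Qed.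

End GaussianField.

(** * Quadratic forms with summable covariances *)

Section Schur.
Context {R : realType} (I : eqType) (c : I -> I -> R) (K : R).
Hypothesis csym : forall u v, c u v = c v u.
Hypothesis csum : forall (F : seq I) u, uniq F -> \sum_(v <- F) `|c u v| <= K.

(** Schur test: |m u * m v| is bounded by the half sum of the squares, and the two halves have equal
    totals by symmetry of [c]. *)
Lemma schur_uniq (F : seq I) (m : I -> R) : uniq F ->
  \sum_(u <- F) \sum_(v <- F) `|m u * m v * c u v| <= K * \sum_(u <- F) m u ^+ 2.
Proof.
move=> uF.
have h : \sum_(u <- F) \sum_(v <- F) m u ^+ 2 * `|c u v| <= K * \sum_(u <- F) m u ^+ 2.
  rewrite mulr_sumr; apply: ler_sum => u _.
  by rewrite -mulr_sumr mulrC ler_wpM2r ?sqr_ge0 ?csum.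
apply: (@le_trans _ _ (\sum_(u <- F) \sum_(v <- F)
    (m u ^+ 2 * `|c u v| / 2 + m v ^+ 2 * `|c u v| / 2))).
  apply: ler_sum => u _; apply: ler_sum => v _.
  rewrite !normrM -!mulrDl -[leLHS]mulrA -mulrA mulrC [leRHS]mulrC.
  have := sqr_ge0 (`|m u| - `|m v|); rewrite -(real_normK (num_real (m u))).
  rewrite -(real_normK (num_real (m v))) => mm.
  rewrite [leLHS]mulrC [`|c u v| * _ in leRHS]mulrC mulrA [leRHS]mulrC mulrA ler_wpM2r //.
  by move: mm; nra.
under eq_bigr do rewrite big_split /=.
rewrite big_split /= [X in _ + X]exchange_big /=.
rewrite [X in _ + X](_ : _ = \sum_(u <- F) \sum_(v <- F) m u ^+ 2 * `|c u v| / 2).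
  rewrite -big_split /=; under eq_bigr do rewrite -big_split /=.
  apply: le_trans h; apply: ler_sum => u _; apply: ler_sum => v _.
  by rewrite -splitr.
by apply: eq_bigr => u _; apply: eq_bigr => v _; rewrite csym.
Qed.

(** Repetitions in [F] become weights on its support; summing the multiplicity over [F] itself gives
    the sum of the squared multiplicities. *)
Lemma schur_count (F : seq I) :
  \sum_(u <- F) \sum_(v <- F) `|c u v| <= K * \sum_(u <- F) (count_mem u F)%:R.
Proof.
have undupE (f : I -> R) :
    \sum_(u <- F) f u = \sum_(u <- undup F) (count_mem u F)%:R * f u.
  rewrite -big_undup_iterop_count; apply: eq_bigr => u _.
  by rewrite mulr_natl.
rewrite undupE; under eq_bigr do rewrite undupE mulr_sumr.
rewrite (undupE (fun u => (count_mem u F)%:R)).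
have := schur_uniq (fun u => (count_mem u F)%:R) (undup_uniq F).
apply: le_trans; apply: ler_sum => u _; apply: ler_sum => v _.
by rewrite !normrM !normr_nat mulrA.
Qed.

Lemma quad_le_count (L : seq (R * I)) : all (fun p => `|p.1| <= 1) L ->
  quad c L <= K * \sum_(u <- map snd L) (count_mem u (map snd L))%:R.
Proof.
move=> /allP L1; apply: le_trans (schur_count _).
rewrite /quad big_map big_seq [leRHS]big_seq; apply: ler_sum => p pL.
rewrite big_map big_seq [leRHS]big_seq; apply: ler_sum => p' p'L.
apply: le_trans (ler_norm _) _; rewrite !normrM -[leRHS]mul1r ler_wpM2r //.
by rewrite -[leRHS]mul1r ler_pM // L1.
Qed.

End Schur.

(** * Large slopes *)

Definition hshift (u : int * int) (r : nat) : int * int := (u.1 + r%:Z, u.2).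

Lemma measurable_forall_fin d (T : measurableType d) (I : finType) (F : I -> set T) :
  (forall i, measurable (F i)) -> measurable [set w | forall i, F i w].
Proof.
move=> mF; rewrite (_ : [set w | _] = \bigcap_(i in [set: I]) F i).
  by apply: fin_bigcap_measurable.
by apply/seteqP; split=> w h i; [move=> _; exact: h|exact: (h i Logic.I)].
Qed.

Section Collisions.
Variables (n : nat) (u : 'I_n -> int * int) (r : 'I_n -> nat).
Hypothesis uinj : injective u.
Hypothesis r0 : forall i, (0 < r i)%N.
Let p i := hshift (u i) (r i).

Let collisions_le i : (\sum_j ((p i == p j) && (r j <= r i)) <= r i)%N.
Proof.
rewrite -big_mkcond sum1_card cardE /=.
rewrite -(size_map r) -[leqRHS](size_iota 1); apply: uniq_leq_size.
  rewrite map_inj_in_uniq ?enum_uniq // => j k.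
  rewrite !mem_enum !unfold_in => /andP[/eqP pj _] /andP[/eqP pk _] rjk.
  apply: uinj; have : p j = p k by rewrite -pj.
  rewrite /p /hshift rjk => -[/addIr u1 u2].
  by case: (u j) (u k) u1 u2 => a b [a' b'] /= -> ->.
move=> x /mapP[j]; rewrite mem_enum unfold_in => /andP[_ rji] ->.
by rewrite mem_iota r0 add1n ltnS.
Qed.

(* Colliding points lie on one row and have pairwise distinct displacements. *)
Lemma sum_collisions_le : (\sum_i \sum_j (p i == p j) <= 2 * \sum_i r i)%N.
Proof.
(* A colliding pair is charged to its member with the larger displacement. *)
apply: (@leq_trans (\sum_i \sum_j (((p i == p j) && (r j <= r i)) +
    ((p j == p i) && (r i <= r j))))%N).
  apply: leq_sum => i _; apply: leq_sum => j _; rewrite [p j == _]eq_sym.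
  case: eqP => //= _; have := leq_total (r j) (r i).
  by case: (r j <= r i)%N => //= ->.
under eq_bigr do rewrite big_split /=.
rewrite big_split /= mul2n -addnn; apply: leq_add; first exact: leq_sum.
by rewrite exchange_big /=; apply: leq_sum.
Qed.

(** Endpoints against endpoints give at most twice the sum of the displacements. The three other
    pairings give at most [n] each, and [n] is at most that sum: hence 5. *)
Lemma sum_count_le :
  (\sum_(v <- [seq p i | i <- enum 'I_n] ++ [seq u i | i <- enum 'I_n])
    count_mem v ([seq p i | i <- enum 'I_n] ++ [seq u i | i <- enum 'I_n])
   <= 5 * \sum_i r i)%N.
Proof.
have nr : (n <= \sum_i r i)%N.
  by rewrite -[leqLHS]muln1 -[X in (X * _)%N]card_ord -sum_nat_const; exact: leq_sum.
have uu v : (count_mem v [seq u i | i <- enum 'I_n] <= 1)%N.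
  by rewrite count_uniq_mem ?leq_b1 // map_inj_uniq ?enum_uniq.
have cE (f : 'I_n -> int * int) v : count_mem v [seq f i | i <- enum 'I_n] = (\sum_i (f i == v))%N.
  by rewrite count_map -sum1_count big_enum_cond /= big_mkcond.
have sE (f : 'I_n -> int * int) (F : int * int -> nat) :
    (\sum_(v <- [seq f i | i <- enum 'I_n]) F v = \sum_i F (f i))%N.
  by rewrite big_map big_enum.
have n1 (F : 'I_n -> nat) : (forall i, F i <= 1)%N -> (\sum_i F i <= n)%N.
  by move=> F1; rewrite -[leqRHS]muln1 -[X in (X * _)%N]card_ord -sum_nat_const; exact: leq_sum.
rewrite big_cat /= !sE.
under eq_bigr do rewrite count_cat.
under [X in (_ + X)%N]eq_bigr do rewrite count_cat.
rewrite !big_split /=.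
have h1 := sum_collisions_le.
have h2 : (\sum_i count_mem (p i) [seq p i | i <- enum 'I_n] <= 2 * \sum_i r i)%N.
  apply: leq_trans h1; rewrite leq_eqVlt; apply/orP; left; apply/eqP.
  by apply: eq_bigr => i _; rewrite cE; apply: eq_bigr => j _; rewrite eq_sym.
have h3 : (\sum_i count_mem (p i) [seq u i | i <- enum 'I_n] <= n)%N by exact: n1.
have h4 : (\sum_i count_mem (u i) [seq p i | i <- enum 'I_n] <= n)%N.
  apply: leq_trans h3; under eq_bigr do rewrite cE.
  rewrite exchange_big /=; apply: leq_sum => i _; rewrite cE.
  by rewrite leq_eqVlt; apply/orP; left; apply/eqP/eq_bigr => j _; rewrite eq_sym.
have h5 : (\sum_i count_mem (u i) [seq u i | i <- enum 'I_n] <= n)%N by exact: n1.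
apply: leq_trans (leq_add (leq_add h2 h3) (leq_add h4 h5)) _.
by move: nr; move: (\sum_i r i)%N; clear; lia.
Qed.

End Collisions.

Section LargeSlopes.
Context {R : realType} d {T : measurableType d} (P : probability T R).
Variables (X : int * int -> T -> R) (c : int * int -> int * int -> R) (K : R).
Hypothesis XG : gaussian_field P X c.
Hypothesis csym : forall u v, c u v = c v u.
Hypothesis csum : forall (F : seq (int * int)) u, uniq F -> \sum_(v <- F) `|c u v| <= K.
Hypothesis K0 : 0 < K.

Definition large_slope (lam : R) (w : T) : set (int * int) :=
  [set u | exists2 r : nat, (0 < r)%N & lam * r%:R <= X (hshift u r) w - X u w].

Let mX u : measurable_fun setT (X u) := gaussian_field_measurable XG u.

Let measurable_slope (lam : R) u r :
  measurable [set w | lam * r%:R <= X (hshift u r) w - X u w].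
Proof.
rewrite (_ : [set w | _] = (fun w => X (hshift u r) w - X u w) @^-1` `[lam * r%:R, +oo[%classic).
  by rewrite -[_ @^-1` _]setTI; apply: measurable_funB.
by apply/seteqP; split=> w /=; rewrite in_itv /= andbT.
Qed.

Lemma measurable_large_slope (lam : R) u : measurable [set w | large_slope lam w u].
Proof.
rewrite (_ : [set w | _] = \bigcup_(r in [set r : nat | (0 < r)%N])
    [set w | lam * r%:R <= X (hshift u r) w - X u w]).
  by apply: bigcup_measurable.
by apply/seteqP; split=> w /= [r r0 ru]; exists r.
Qed.

(** The event forces the sum of the increments, of variance at most 5 K N, above lam N, where N is
    the sum of the displacements. The Chernoff exponent is then linear in N and splits over the
    sites. *)
Lemma prob_slopes (lam : R) n (u : 'I_n -> int * int) (r : 'I_n -> nat) :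
  (0 < n)%N -> 0 <= lam -> injective u -> (forall i, (0 < r i)%N) ->
  (P [set w | forall i, (lam * (r i)%:R <= X (hshift (u i) (r i)) w - X (u i) w)%R] <=
   (\prod_i expR (- (lam ^+ 2 / (10 * K)) * (r i)%:R))%:E)%E.
Proof.
move=> n0 lam0 uinj r0.
pose L : seq (R * (int * int)) := [seq (1, hshift (u i) (r i)) | i <- enum 'I_n] ++
  [seq (- 1, u i) | i <- enum 'I_n].
pose N : R := (\sum_i r i)%:R.
have N0 : 0 < N.
  rewrite ltr0n; apply: leq_trans (r0 (Ordinal n0)) _.
  by rewrite (bigD1 (Ordinal n0)) //= leq_addr.
have LN : quad c L <= 5 * K * N.
  have L1 : all (fun p : R * (int * int) => `|p.1| <= 1) L.
    by rewrite /L all_cat !all_map; apply/andP; split; apply/allP => i _ /=;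
      rewrite ?normrN normr1.
  apply: le_trans (quad_le_count csym csum L1) _.
  rewrite [5 * K]mulrC -mulrA ler_pM2l // /N -natrM -natr_sum ler_nat.
  have := sum_count_le uinj r0.
  by rewrite /L map_cat -!map_comp.
apply: (@le_trans _ _ (P [set w | (lam * N <= lincomb X L w)%R])).
  apply: le_measure; rewrite ?inE.
  - by apply: measurable_forall_fin => i; exact: measurable_slope.
  - rewrite (_ : [set w | _] = lincomb X L @^-1` `[lam * N, +oo[%classic).
      by rewrite -[_ @^-1` _]setTI; exact: (measurable_lincomb XG).
    by apply/seteqP; split=> w /=; rewrite in_itv /= andbT.
  - move=> w /= h; rewrite /lincomb /L big_cat !big_map /=.
    rewrite -big_split /= /N natr_sum mulr_sumr; apply: ler_sum => i _.
    by rewrite mul1r mulN1r.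
apply: le_trans (gaussian_field_chernoff XG LN _ _) _.
- by rewrite !mulr_gt0.
- by rewrite mulr_ge0 // ltW.
rewrite lee_fin -expR_sum ler_expR -mulr_sumr -natr_sum -/N.
rewrite exprMn le_eqVlt; apply/orP; left; apply/eqP.
by field; rewrite !gt_eqF.
Qed.

Lemma prob_large_slope (lam : R) (s : seq (int * int)) : 0 <= lam ->
  expR (- (lam ^+ 2 / (10 * K))) <= 19%:R^-1 -> uniq s ->
  (P [set w | forall u, u \in s -> large_slope lam w u] <= (18%:R^-1 ^+ size s)%:E)%E.
Proof.
move=> lam0; set x := expR _ => x19 us.
have x0 : 0 <= x by exact: expR_ge0.
have mE : measurable [set w | forall u, u \in s -> large_slope lam w u].
  rewrite (_ : [set w | _] = [set w | forall i, large_slope lam w (tnth (in_tuple s) i)]).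
    by apply: measurable_forall_fin => i; exact: measurable_large_slope.
  apply/seteqP; split=> w h; first by move=> i; apply: h; exact: mem_tnth.
  by move=> v vs; have /tnthP[i ->] : v \in in_tuple s by []; exact: h.
have [s0|s0] := posnP (size s); first by rewrite s0 expr0 probability_le1.
set n := size s in s0 *.
pose u (i : 'I_n) := tnth (in_tuple s) i.
have uinj : injective u by exact: (elimT (tuple_uniqP (in_tuple s)) us).
(* Truncation to displacements at most [M] leaves a finite union; the bound is uniform in [M] and
   passes to the increasing limit. *)
pose F (M : nat) : set T := \big[setU/set0]_(r : {ffun 'I_n -> 'I_M})
  [set w | forall i, lam * (r i).+1%:R <= X (hshift (u i) (r i).+1) w - X (u i) w].
have mF0 (r : 'I_n -> nat) : measurable
    [set w | forall i, lam * (r i).+1%:R <= X (hshift (u i) (r i).+1) w - X (u i) w].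
  by apply: measurable_forall_fin => i; exact: measurable_slope.
have mF M : measurable (F M) by apply: bigsetU_measurable => r _; exact: mF0.
have FP M w : F M w <-> exists2 r : 'I_n -> nat, (forall i, r i < M)%N &
    forall i, lam * (r i).+1%:R <= X (hshift (u i) (r i).+1) w - X (u i) w.
  rewrite /F -bigcup_seq; split=> [[r _ h]|[r rM h]].
    by exists (fun i => nat_of_ord (r i)) => // i; exact: h.
  exists [ffun i => Ordinal (rM i)]; first by rewrite /= mem_index_enum.
  by move=> i; rewrite ffunE; exact: h.
(* x / (1 - x) is at most 1/18 when x is at most 1/19. *)
have geo M : \sum_(i < M) x ^+ i.+1 <= 18%:R^-1.
  have -> : \sum_(i < M) x ^+ i.+1 = x * \sum_(i < M) x ^+ i.
    by rewrite mulr_sumr; apply: eq_bigr => i _; rewrite exprS.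
  have := subrX1 x M; rewrite -opprB -[x - 1]opprB mulNr => /oppr_inj h.
  have xM : 0 <= x ^+ M by exact: exprn_ge0.
  have S0 : 0 <= \sum_(i < M) x ^+ i by apply: sumr_ge0 => i _; exact: exprn_ge0.
  nra.
have PF M : (P (F M) <= (18%:R^-1 ^+ n)%:E)%E.
  apply: le_trans (measure_big_setU_le _ _ _) _; first by move=> r _; exact: mF0.
  apply: (@le_trans _ _ (\sum_(r : {ffun 'I_n -> 'I_M}) (\prod_i x ^+ (r i).+1)%:E)%E).
    apply: lee_sum => r _.
    have := @prob_slopes lam n u (fun i => (r i).+1) s0 lam0 uinj (fun=> isT).
    rewrite (eq_bigr (fun i => x ^+ (r i).+1)) // => i _.
    by rewrite mulrC expRM_natl.
  rewrite sumEFin lee_fin -(bigA_distr_bigA (fun i j => x ^+ (nat_of_ord j).+1)) /=.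
  rewrite prodr_const card_ord; apply: lerXn2r => //; rewrite ?nnegrE ?invr_ge0 //.
    by apply: sumr_ge0 => i _; exact: exprn_ge0.
  exact: geo.
have cvgF : P (F M) @[M --> \oo] --> P (\bigcup_M F M).
  apply: nondecreasing_cvg_mu => //; first exact: bigcup_measurable.
  move=> M1 M2 M12; apply/subsetPset => w /FP[r rM h]; apply/FP; exists r => // i.
  exact: leq_trans (rM i) M12.
have le2 : (P (\bigcup_M F M) <= (18%:R^-1 ^+ n)%:E)%E.
  move/cvg_lim : (cvgF) => <- //; apply: lime_le; first by apply/cvg_ex; eexists; exact: cvgF.
  by apply: nearW => a; exact: PF.
apply: le_trans le2; apply: le_measure; rewrite ?inE.
- exact: mE.
- exact: bigcup_measurable.
move=> w /= h.
have /choice[r rh] : forall i, exists r : nat,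
    lam * r.+1%:R <= X (hshift (u i) r.+1) w - X (u i) w.
  by move=> i; have [|[//|r] _ hr] := h (u i); [exact: mem_tnth|exists r].
exists (\max_i r i).+1 => //; apply/FP; exists r => // i.
by rewrite ltnS; exact: leq_bigmax.
Qed.

End LargeSlopes.

(** * Records of a nearly independent sequence *)

Section Cholesky.
Context {R : realType}.

Let row_sum_block m (A : 'M[R]_1) (B : 'M[R]_(1, m)) (C : 'M[R]_(m, 1)) (D : 'M[R]_m) :
  (forall i, \sum_j `|block_mx A B C D (lshift m i) j| = `|A i 0| + \sum_j `|B i j|) /\
  (forall i, \sum_j `|block_mx A B C D (rshift 1 i) j| = `|C i 0| + \sum_j `|D i j|).
Proof.
split=> i; rewrite big_split_ord big_ord1; congr (_ + _).
- by rewrite block_mxEul.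
- by apply: eq_bigr => j _; rewrite block_mxEur.
- by rewrite block_mxEdl.
- by apply: eq_bigr => j _; rewrite block_mxEdr.
Qed.

Let col_sum_block m (A : 'M[R]_1) (B : 'M[R]_(1, m)) (C : 'M[R]_(m, 1)) (D : 'M[R]_m) :
  (forall j, \sum_i `|block_mx A B C D i (lshift m j)| = `|A 0 j| + \sum_i `|C i j|) /\
  (forall j, \sum_i `|block_mx A B C D i (rshift 1 j)| = `|B 0 j| + \sum_i `|D i j|).
Proof.
split=> j; rewrite big_split_ord big_ord1; congr (_ + _).
- by rewrite block_mxEul.
- by apply: eq_bigr => i _; rewrite block_mxEdl.
- by rewrite block_mxEur.
- by apply: eq_bigr => i _; rewrite block_mxEdr.
Qed.

(* Schur complements do not increase the absolute row sums of [S - 1], so the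
   Cholesky factor of a matrix close to [1] in row sum norm is close to [1] in
   row and column sum norms. *)
Lemma cholesky (m : nat) (S : 'M[R]_m) (r : 'I_m -> R) (delta : R) :
  delta <= 10%:R^-1 -> S^T = S -> (forall i, r i <= delta) ->
  (forall i, \sum_j `|(S - 1%:M) i j| <= r i) ->
  exists L : 'M[R]_m, [/\ L *m L^T = S, L \in unitmx,
    forall i, \sum_j `|(L - 1%:M) i j| <= 2 * r i &
    forall j, \sum_i `|(L - 1%:M) i j| <= 2 * delta].
Proof.
move=> d10; elim: m S r => [|m IH] S r symS rd Sr.
  exists 1%:M; split; [by apply/matrixP => -[]|exact: unitmx1| |];
    by move=> i; have := ltn_ord i; rewrite ltn0.
rewrite -[m.+1]/(1 + m)%N in S r symS rd Sr *.
pose a := ulsubmx S 0 0; pose b := dlsubmx S; pose S' := drsubmx S.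
have ulE : ulsubmx S = a%:M by rewrite [LHS]mx11_scalar.
have SE : S = block_mx a%:M b^T b S'.
  by rewrite -{1}[S]submxK ulE; congr block_mx; rewrite trmx_dlsub symS.
have SE1 : S - 1%:M = block_mx (a - 1)%:M b^T b (S' - 1%:M).
  rewrite [1%:M]scalar_mx_block opp_block_mx {1}SE add_block_mx !oppr0 !addr0.
  by rewrite -raddfN -raddfD.
have r0 := Sr (lshift m 0); have ri i := Sr (rshift 1 i).
rewrite SE1 (row_sum_block _ _ _ _).1 !mxE eqxx mulr1n in r0.
have {}r0 : `|a - 1| + \sum_j `|b j 0| <= r (lshift m 0).
  by apply: le_trans r0; rewrite lerD2l; apply: ler_sum => j _; rewrite [b^T _ _]mxE.
have {}ri i : `|b i 0| + \sum_j `|(S' - 1%:M) i j| <= r (rshift 1 i).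
  by have := ri i; rewrite SE1 (row_sum_block _ _ _ _).2.
have B0 : 0 <= \sum_j `|b j 0| by apply: sumr_ge0.
have Bd : \sum_j `|b j 0| <= delta.
  apply: le_trans (rd (lshift m 0)); apply: le_trans r0.
  by rewrite lerDr.
have a1 : `|a - 1| <= 10%:R^-1.
  apply: le_trans d10; apply: le_trans (rd (lshift m 0)); apply: le_trans r0.
  by rewrite lerDl.
have a9 : 9%:R / 10%:R <= a by move: a1; rewrite ler_norml; lra.
have a0 : 0 < a by lra.
pose s := Num.sqrt a.
have s0 : 0 < s by rewrite sqrtr_gt0.
have ss : s * s = a by rewrite -expr2 sqr_sqrtr // ltW.
have s9 : 9%:R / 10%:R <= s by nra.
have si : s^-1 <= 10%:R / 9%:R by rewrite -[leRHS]invrK lef_pV2 ?posrE //; lra.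
have s1 : `|s - 1| <= `|a - 1|.
  rewrite -ss (_ : s * s - 1 = (s - 1) * (s + 1)); last by ring.
  by rewrite normrM ler_peMr // ger0_norm; lra.
pose S2 := S' - a^-1 *: (b *m b^T).
have symS' : S'^T = S' by rewrite trmx_drsub symS.
(* As [a] is at least 9/10 and the entries of [b] sum to at most 1/10, the rank one correction adds
   at most |b_i| / 9 to row i, which has lost its entry b_i. The gain of 8/9 |b_i|, doubled by
   induction, pays for the new entry of [L], at most 10/9 |b_i|; hence a bound [r] that varies with
   the row. *)
have S2r i : \sum_j `|(S2 - 1%:M) i j| <= r (rshift 1 i) - `|b i 0| * (8%:R / 9%:R).
  have h : \sum_j `|(S2 - 1%:M) i j| <= \sum_j `|(S' - 1%:M) i j| + `|b i 0| / 9%:R.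
    apply: (@le_trans _ _ (\sum_j (`|(S' - 1%:M) i j| + a^-1 * `|b i 0| * `|b j 0|))).
      apply: ler_sum => j _.
      have -> : (S2 - 1%:M) i j = (S' - 1%:M) i j - a^-1 * (b i 0 * b j 0).
        by rewrite !mxE big_ord1 !mxE; ring.
      apply: le_trans (ler_normB _ _) _; rewrite lerD2l !normrM mulrA.
      by rewrite (@ger0_norm _ a^-1) // invr_ge0 ltW.
    rewrite big_split /= lerD2l -mulr_sumr mulrC mulrA mulrC ler_wpM2l //.
    rewrite ler_pdivrMr //; lra.
  by have := ri i; lra.
have symS2 : S2^T = S2.
  by rewrite linearB /= linearZ /= trmx_mul trmxK symS'.
have r2d i : r (rshift 1 i) - `|b i 0| * (8%:R / 9%:R) <= delta.
  by have := rd (rshift 1 i); have := normr_ge0 (b i 0); lra.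
have [L' [L'L' uL' rowL' colL']] := IH S2 _ symS2 r2d S2r.
exists (block_mx s%:M 0 (s^-1 *: b) L').
have LE1 : block_mx s%:M 0 (s^-1 *: b) L' - 1%:M =
    block_mx (s - 1)%:M 0 (s^-1 *: b) (L' - 1%:M).
  rewrite [1%:M]scalar_mx_block opp_block_mx add_block_mx !oppr0 !addr0.
  by rewrite -raddfN -raddfD.
split.
- rewrite tr_block_mx mulmx_block SE !trmx0 tr_scalar_mx linearZ /=.
  rewrite !mul0mx !mulmx0 !addr0 -scalar_mxM ss; congr block_mx.
  + by rewrite mul_scalar_mx scalerA divff ?scale1r // gt_eqF.
  + by rewrite mul_mx_scalar scalerA divff ?scale1r // gt_eqF.
  + rewrite L'L' /S2 -scalemxAl -scalemxAr scalerA.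
    by rewrite -invfM ss addrC subrK.
- by rewrite unitmxE det_lblock det_scalar1 unitrM -unitmxE uL' andbT unitfE gt_eqF.
- move=> i; rewrite LE1; case: (split_ordP i) => {}i ->.
    rewrite (row_sum_block _ _ _ _).1 big1 ?addr0; last by move=> j _; rewrite mxE normr0.
    rewrite [i]ord1 !mxE eqxx mulr1n.
    apply: le_trans s1 _; have := normr_ge0 (a - 1); lra.
  rewrite (row_sum_block _ _ _ _).2 mxE normrM (@ger0_norm _ s^-1) ?invr_ge0 ?(ltW s0) //.
  have := rowL' i; have := ler_wpM2r (normr_ge0 (b i 0)) si; have := normr_ge0 (b i 0).
  lra.
- move=> j; rewrite LE1; case: (split_ordP j) => {}j ->.
    rewrite (col_sum_block _ _ _ _).1 [j]ord1 !mxE eqxx mulr1n.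
    have -> : \sum_i `|(s^-1 *: b) i 0| = s^-1 * \sum_i `|b i 0|.
      rewrite mulr_sumr; apply: eq_bigr => i _.
      by rewrite mxE normrM (@ger0_norm _ s^-1) ?invr_ge0 ?(ltW s0).
    have := ler_wpM2r B0 si; have := rd (lshift m 0); have := normr_ge0 (a - 1); lra.
  by rewrite (col_sum_block _ _ _ _).2 mxE normr0 add0r.
Qed.

End Cholesky.

(** * Weights of near records *)

Section Records.
Context {R : realType} (N : nat) (w : nat -> R) (eta : R) (a : nat).
Hypothesis w0 : forall y, 0 <= w y.
Hypothesis weta : forall y, w y <= eta.

Let F (x : nat) : R := \sum_(y < x) w y.

Let F0 x : 0 <= F x. Proof. by apply: sumr_ge0. Qed.

Let FS x : F x.+1 = F x + w x. Proof. exact: big_ord_recr. Qed.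

Let Fshift y k : F (y + k) <= F y + k%:R * eta.
Proof.
elim: k => [|k IH]; first by rewrite addn0 mul0r addr0.
by rewrite addnS FS -natr1 mulrDl mul1r addrA lerD.
Qed.

Let exprD_ge (x y : R) n : 0 <= x -> 0 <= y ->
  x ^+ n.+1 + n.+1%:R * y * x ^+ n <= (x + y) ^+ n.+1.
Proof.
move=> x0 y0; elim: n => [|n IH]; first by rewrite !expr1 expr0 mulr1 mul1r.
rewrite [leRHS]exprS; apply: le_trans (ler_wpM2l (addr_ge0 x0 y0) IH).
rewrite -subr_ge0 -[n.+2%:R]natr1 [x ^+ n.+2]exprS.
rewrite [X in 0 <= X](_ : _ = n.+1%:R * (y * y) * x ^+ n).
  by rewrite mulr_ge0 ?exprn_ge0 // mulr_ge0 ?mulr_ge0.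
by rewrite [x ^+ n.+1]exprS; ring.
Qed.

(** Discrete form of the integral of F^n dF: a lower Riemann sum, as [F] is taken before its
    jump. *)
Let telescope (e : R) n x : 0 <= e ->
  \sum_(y < x) w y * (F y + e) ^+ n <= (F x + e) ^+ n.+1 / n.+1%:R.
Proof.
move=> e0; rewrite ler_pdivlMr ?ltr0n //.
elim: x => [|x IH].
  by rewrite big_ord0 mul0r exprn_ge0 // addr_ge0.
rewrite big_ord_recr /= mulrDl FS addrAC.
apply: le_trans (exprD_ge _ (addr_ge0 (F0 x) e0) (w0 x)).
by rewrite lerD // le_eqVlt; apply/orP; left; apply/eqP; ring.
Qed.

Let sum_ord_cond_le (g : nat -> R) m x : (forall y, 0 <= g y) ->
  \sum_(y : 'I_m | (y < x)%N) g y <= \sum_(y < x) g y.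
Proof.
move=> g0; suff -> : \sum_(y : 'I_m | (y < x)%N) g y = \sum_(y < minn m x) g y.
  rewrite -!(big_mkord xpredT) [leRHS](big_cat_nat (n := minn m x)) ?geq_minr //=.
  by rewrite lerDl sumr_ge0.
elim: m => [|m IH]; first by rewrite min0n big_mkcond !big_ord0.
rewrite big_mkcond big_ord_recr -big_mkcond /= IH; case: ltnP => mx.
  by rewrite (minn_idPl mx) big_ord_recr.
by rewrite addr0 (minn_idPr (leqW mx)).
Qed.

Definition near_records n (b : 'I_n -> bool) (x : nat) (f : {ffun 'I_n -> 'I_N}) : bool :=
  [forall j : 'I_n, f j < x]%N &&
  [forall j : 'I_n, forall j' : 'I_n, b j ==> (j < j')%N ==> (f j' <= f j + a)%N].

Let cons_ffun n (p : 'I_N * {ffun 'I_n -> 'I_N}) : {ffun 'I_n.+1 -> 'I_N} :=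
  [ffun j => if unlift ord0 j is Some i then p.2 i else p.1].

Let cons_ffun0 n p : @cons_ffun n p ord0 = p.1.
Proof. by rewrite ffunE unlift_none. Qed.

Let cons_ffunS n p i : @cons_ffun n p (lift ord0 i) = p.2 i.
Proof. by rewrite ffunE liftK. Qed.

Let cons_ffun_bij n : bijective (@cons_ffun n).
Proof.
exists (fun f : {ffun 'I_n.+1 -> 'I_N} =>
  (f ord0, [ffun i : 'I_n => f (lift ord0 i)])) => [[y f]|f].
  rewrite cons_ffun0; congr pair; apply/ffunP => i.
  by rewrite ffunE cons_ffunS.
apply/ffunP => j; case: (unliftP ord0 j) => [i ->|->].
  by rewrite cons_ffunS ffunE.
by rewrite cons_ffun0.
Qed.

(** For independent continuous values, [j] dominates its successors with probability 1 / (n - j),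
    independently for distinct [j]. The induction removes the first index: if it is marked with
    value y, the others lie at most at y + a, and summing over y integrates F^n into F^(n+1) /
    (n+1). The slack and the atoms cost (a+1) [eta] per index, kept inside the power. *)
Lemma near_records_weight n (b : 'I_n -> bool) (x : nat) :
  \sum_(f | near_records b x f) \prod_j w (f j) <=
  (F x + n%:R * (a.+1%:R * eta)) ^+ n * \prod_(j | b j) (n - j)%:R^-1.
Proof.
have eta0 : 0 <= eta by apply: le_trans (weta 0).
set e := a.+1%:R * eta; have e0 : 0 <= e by rewrite mulr_ge0.
elim: n b x => [|n IH] b x.
  have nI0 (i : 'I_0) : False by have := ltn_ord i; rewrite ltn0.
  rewrite expr0 mul1r [leRHS]big1 => [|i]; last by case: (nI0 i).
  apply: (@le_trans _ _ (\sum_(f : {ffun 'I_0 -> 'I_N}) 1)); last first.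
    by rewrite sumr_const card_ffun !card_ord expn0.
  rewrite big_mkcond; apply: ler_sum => f _; case: ifP => // _.
  by rewrite big1 // => i; case: (nI0 i).
pose b' i := b (lift ord0 i).
set Pi' := \prod_(i | b' i) (n - i)%:R^-1 : R.
have Pi'0 : 0 <= Pi' by apply: prodr_ge0 => i _; rewrite invr_ge0.
have -> : \prod_(j | b j) (n.+1 - j)%:R^-1 = (if b ord0 then n.+1%:R^-1 else 1) * Pi' :> R.
  rewrite big_mkcond big_ord_recl /= subn0; congr (_ * _).
  by rewrite /Pi' [RHS]big_mkcond.
rewrite (reindex _ (onW_bij _ (cons_ffun_bij n))) /=.
rewrite [leLHS](_ : _ = \sum_(p | near_records b x (cons_ffun p))
    (w p.1 * \prod_j w (p.2 j))); last first.
  apply: eq_bigr => p _; rewrite big_ord_recl cons_ffun0; congr (_ * _).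
  by apply: eq_bigr => i _; rewrite cons_ffunS.
(* The strict bound for the remaining values: at most y + a means below y + a + 1. *)
pose x' (y : nat) := if b ord0 then (y + a.+1)%N else x.
have sub p : near_records b x (cons_ffun p) ->
    (p.1 < x)%N && near_records b' (x' p.1) p.2.
  case/andP => /forallP fx /forallP fb; have p1x := fx ord0.
  rewrite cons_ffun0 in p1x; rewrite p1x /=; apply/andP; split.
    apply/forallP => j; rewrite /x'; case: ifP => b0; last first.
      by have := fx (lift ord0 j); rewrite cons_ffunS.
    have /forallP/(_ (lift ord0 j)) := fb ord0.
    by rewrite b0 cons_ffun0 cons_ffunS /= addnS ltnS.
  apply/forallP => j; apply/forallP => j'.
  have /forallP/(_ (lift ord0 j')) := fb (lift ord0 j).
  by rewrite !cons_ffunS /= /bump /= !add1n ltnS.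
have W0 m (f : {ffun 'I_m -> 'I_N}) : 0 <= \prod_j w (f j) by apply: prodr_ge0.
apply: (@le_trans _ _ (\sum_(y : 'I_N | (y < x)%N) w y *
    \sum_(f | near_records b' (x' y) f) \prod_j w (f j))).
  under [leRHS]eq_bigr do rewrite mulr_sumr.
  rewrite pair_big_dep /= big_mkcond [leRHS]big_mkcond; apply: ler_sum => p _.
  case: ifPn => [/sub ->//|_]; case: ifP => // _; apply: mulr_ge0 => //; exact: W0.
apply: (@le_trans _ _ (\sum_(y : 'I_N | (y < x)%N) w y *
    ((F (x' y) + n%:R * e) ^+ n * Pi'))).
  by apply: ler_sum => y _; rewrite ler_wpM2l // IH.
apply: (@le_trans _ _ (\sum_(y < x) w y * ((F (x' y) + n%:R * e) ^+ n * Pi'))).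
  have g0 y : 0 <= w y * ((F (x' y) + n%:R * e) ^+ n * Pi').
    by rewrite !mulr_ge0 // exprn_ge0 // addr_ge0 ?F0 // mulr_ge0.
  exact: (@sum_ord_cond_le (fun y => w y * ((F (x' y) + n%:R * e) ^+ n * Pi')) N x g0).
under eq_bigr do rewrite mulrA.
rewrite -mulr_suml [leRHS]mulrA ler_wpM2r //.
rewrite (_ : n.+1%:R * e = e + n%:R * e); last by rewrite -natr1; ring.
rewrite /x'; case: (b ord0).
  apply: (@le_trans _ _ (\sum_(y < x) w y * (F y + (e + n%:R * e)) ^+ n)).
    apply: ler_sum => y _; rewrite ler_wpM2l // lerXn2r ?nnegrE //.
    - by rewrite addr_ge0 ?F0 // mulr_ge0.
    - by rewrite addr_ge0 ?F0 // addr_ge0 ?F0 // mulr_ge0.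
    - by rewrite addrA lerD2r Fshift.
  by apply: telescope; rewrite addr_ge0 ?F0 // mulr_ge0.
rewrite mulr1 -mulr_suml exprS -/(F x).
apply: ler_pM => //.
- by rewrite exprn_ge0 // addr_ge0 ?F0 // mulr_ge0.
- by rewrite lerDl addr_ge0 // mulr_ge0.
- rewrite lerXn2r ?nnegrE //.
  + by rewrite addr_ge0 ?F0 // mulr_ge0.
  + by rewrite !addr_ge0 ?F0 // mulr_ge0.
  + by rewrite lerD2l lerDr.
Qed.

End Records.

(** * Trigonometric partition of unity *)

Section CosPower.
Context {R : realType}.
Implicit Types (x y : R).

Lemma cosMcos x y : cos x * cos y = (cos (x + y) + cos (x - y)) / 2.
Proof. by rewrite cosD cosB; field. Qed.

Lemma cos_pow_expand (y : R) (n : nat) :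
  2 ^+ n * cos y ^+ n =
  \sum_(j < n.+1) 'C(n, j)%:R * cos ((n%:R - 2 * j%:R) * y).
Proof.
elim: n => [|n IH].
  by rewrite big_ord1 !expr0 bin0 !mul1r mulr0 subr0 mul0r cos0.
pose h (j : nat) : R := cos ((n.+1%:R - 2 * j%:R) * y).
have -> : 2 ^+ n.+1 * cos y ^+ n.+1 = 2 * (2 ^+ n * cos y ^+ n) * cos y.
  by rewrite !exprS; ring.
rewrite IH mulr_sumr mulr_suml.
transitivity (\sum_(j < n.+1) 'C(n, j)%:R * h j + \sum_(j < n.+1) 'C(n, j)%:R * h j.+1).
  rewrite -big_split /=; apply: eq_bigr => j _.
  rewrite -mulrA -[X in _ * X]mulrA cosMcos.
  rewrite [X in cos X + _](_ : _ = (n.+1%:R - 2 * j%:R) * y); last by rewrite -natr1; ring.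
  rewrite [X in _ + cos X](_ : _ = (n.+1%:R - 2 * j.+1%:R) * y); last by rewrite -!natr1; ring.
  by rewrite -/(h j) -/(h j.+1); field.
have -> : \sum_(j < n.+1) 'C(n, j)%:R * h j = h 0%N + \sum_(j < n.+1) 'C(n, j.+1)%:R * h j.+1.
  rewrite big_ord_recl bin0 mul1r; congr (_ + _).
  rewrite [RHS]big_ord_recr /= bin_small // mul0r addr0.
  by apply: eq_bigr => j _; rewrite /= /bump /= add1n.
rewrite [RHS]big_ord_recl bin0 mul1r -addrA; congr (_ + _).
rewrite -big_split /=; apply: eq_bigr => j _.
by rewrite /bump /= add1n binS natrD mulrDl.
Qed.

(** A nontrivial character sums to zero over the N-th roots of unity: multiplied by 2 sin b, the sum
    telescopes over a multiple of the period. *)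
Lemma sum_cos_arith (A : R) (s N : nat) : (0 < s < N)%N ->
  \sum_(c < N) cos (A - 2 * s%:R * pi * c%:R / N%:R) = 0.
Proof.
move=> /andP[s0 sN].
have N0 : (0 : R) < N%:R by rewrite ltr0n (leq_trans _ sN).
pose b : R := s%:R * pi / N%:R.
have sb : sin b != 0.
  have sR : (0 : R) < s%:R by rewrite ltr0n.
  rewrite gt_eqF // sin_gt0_pi // /b divr_gt0 ?mulr_gt0 ?pi_gt0 //=.
  by rewrite ltr_pdivrMr // mulrC ltr_pM2l ?pi_gt0 // ltr_nat.
have tel n : 2 * sin b * \sum_(c < n) cos (A - 2 * b * c%:R) =
    sin (A + b) - sin (A + b - 2 * b * n%:R).
  elim: n => [|n IH]; first by rewrite big_ord0 !mulr0 subr0 subrr.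
  rewrite big_ord_recr /= mulrDr IH.
  have -> : A + b - 2 * b * n.+1%:R = (A - 2 * b * n%:R) - b by rewrite -natr1; ring.
  have -> : A + b - 2 * b * n%:R = (A - 2 * b * n%:R) + b by ring.
  by rewrite (sinB (A - _)) (sinD (A - _)); ring.
apply: (mulfI sb); apply: (@mulfI _ 2) => //.
rewrite !mulr0 mulrA (eq_bigr (fun c : 'I_N => cos (A - 2 * b * c%:R))); last first.
  by move=> c _; congr (cos (A - _)); rewrite /b; field; rewrite gt_eqF.
rewrite tel; have -> : 2 * b * N%:R = (pi *+ 2) *+ s.
  by rewrite /b -mulr_natr -(mulr_natr pi); field; rewrite gt_eqF.
by rewrite -{1}[A + b](subrK ((pi *+ 2) *+ s)) (periodicn (@sinD2pi R)) subrr.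
Qed.

Lemma bin_central_max (M l : nat) : ('C(M.*2, l) <= 'C(M.*2, M))%N.
Proof.
have up j : (j <= M)%N -> ('C(M.*2, M - j) <= 'C(M.*2, M))%N.
  elim: j => [|j IH] jM; first by rewrite subn0.
  apply: leq_trans (IH (ltnW jM)).
  have -> : (M - j)%N = (M - j.+1).+1 by lia.
  rewrite -(leq_pmul2l (ltn0Sn (M - j.+1))) mul_bin_left leq_mul2r.
  by apply/orP; right; lia.
have [lM|Ml] := leqP l M.
  by have := up (M - l)%N (leq_subr _ _); rewrite subKn.
have [lM2|] := leqP l M.*2; last by move=> ?; rewrite bin_small.
by rewrite -bin_sub //; have := up (l - M)%N; rewrite (_ : M - (l - M) = M.*2 - l)%N;
  [apply; lia|lia].
Qed.

Lemma exp4_le_bin_central (M : nat) : (2 ^+ M.*2 : R) <= (M.*2.+1)%:R * 'C(M.*2, M)%:R.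
Proof.
have := cos_pow_expand 0 M.*2; rewrite cos0 expr1n mulr1 => ->.
apply: (@le_trans _ _ (\sum_(j < M.*2.+1) 'C(M.*2, M)%:R)).
  by apply: ler_sum => j _; rewrite mulr0 cos0 mulr1 ler_nat bin_central_max.
by rewrite sumr_const card_ord mulr_natl.
Qed.

End CosPower.

Section SoftCells.
Context {R : realType} (M : nat) (theta : R).
Local Notation N := M.+1.

Definition freq (l : nat) : R := M.*2%:R - 2 * l%:R.
Definition cell_coef (l : nat) : R := 'C(M.*2, l)%:R / ('C(M.*2, M)%:R * N%:R).
(** Cell [c] is centred where theta x = pi c / N - pi / 2; the N centres divide one period pi of an
    even power of the cosine. *)
Definition cell_phase (c : nat) : R := pi / 2 - pi * c%:R / N%:R.

(* [soft_cell c] is a multiple of the (2 M)-th power of a shifted cosine: for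
   [c < M.+1] these form a partition of unity by trigonometric polynomials. *)
Definition soft_cell (c : nat) (x : R) : R :=
  \sum_(l < M.*2.+1) cell_coef l * cos (freq l * (theta * x + cell_phase c)).

(** The expectation of [soft_cell c] under the standard Gaussian law. *)
Definition cell_weight (c : nat) : R :=
  \sum_(l < M.*2.+1) cell_coef l *
    (expR (- ((freq l * theta) ^+ 2 / 2)) * cos (freq l * cell_phase c)).

Let C0 : (0 : R) < 'C(M.*2, M)%:R.
Proof. by rewrite ltr0n bin_gt0 -addnn leq_addr. Qed.

Let N0 : (0 : R) < N%:R. Proof. by rewrite ltr0n. Qed.

Let M2 : M.*2%:R = 2 * M%:R :> R. Proof. by rewrite -mul2n natrM. Qed.

Lemma soft_cellE c x : soft_cell c x =
  2 ^+ M.*2 / ('C(M.*2, M)%:R * N%:R) * cos (theta * x + cell_phase c) ^+ M.*2.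
Proof.
rewrite mulrAC cos_pow_expand mulr_suml; apply: eq_bigr => l _.
by rewrite /cell_coef mulrAC.
Qed.

Lemma soft_cell_ge0 c x : 0 <= soft_cell c x.
Proof.
rewrite soft_cellE; apply: mulr_ge0; first by rewrite divr_ge0 ?exprn_ge0 ?mulr_ge0.
by rewrite -mul2n exprM exprn_ge0 // sqr_ge0.
Qed.

(** Averaging over the N phases keeps only the zero frequency, of index M: the others are 2 (M - l)
    with 0 < |M - l| < N. *)
Lemma sum_soft_cell x : \sum_(c < N) soft_cell c x = 1.
Proof.
rewrite exchange_big /=.
have termE (l : 'I_M.*2.+1) :
    \sum_(c < N) cell_coef l * cos (freq l * (theta * x + cell_phase c)) =
    if l == M :> nat then 1 else 0.
  rewrite -mulr_sumr; case: eqP => [lM|/eqP lM].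
    rewrite (eq_bigr (fun=> 1)); last first.
      by move=> c _; rewrite /freq lM M2 subrr mul0r cos0.
    by rewrite sumr_const card_ord /cell_coef lM; field; rewrite !gt_eqF.
  have lM2 : (l <= M.*2)%N by rewrite -ltnS.
  pose s := (maxn l M - minn l M)%N.
  have s0 : (0 < s < N)%N by rewrite /s; move: lM lM2; lia.
  rewrite (eq_bigr (fun c : 'I_N => cos (2 * s%:R * (theta * x + pi / 2) -
      2 * s%:R * pi * c%:R / N%:R))); first by rewrite sum_cos_arith ?mulr0.
  move=> c _; rewrite /freq /cell_phase /s; have [Ml|lM'] := leqP M l.
    rewrite -cosN; congr cos; rewrite natrB // M2.
    by field; rewrite gt_eqF.
  congr cos; rewrite natrB ?(ltnW lM') //.
  by rewrite M2; field; rewrite gt_eqF.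
under eq_bigr do rewrite termE.
have MM : (M < M.*2.+1)%N by rewrite ltnS -addnn leq_addr.
rewrite (bigD1 (Ordinal MM)) //= eqxx big1 ?addr0 // => l lM.
by rewrite ifN //; apply: contra lM => /eqP lM; apply/eqP/val_inj.
Qed.

Definition near_cell (kappa x : R) (c : nat) : bool :=
  `|theta * x + cell_phase c| <= kappa.

(** For theta x within pi/4 of 0 the angle stays within 3 pi/4, away from the other maxima of |cos|
    at pi and -pi; so |cos| is at most cos kappa on far cells. The normalization 4^M / C(2M, M)
    costs only a factor 2M+1. *)
Lemma soft_cell_far (kappa x : R) : 0 < kappa <= pi / 4 -> `|theta * x| <= pi / 4 ->
  \sum_(c < N | ~~ near_cell kappa x c) soft_cell c x <=
  M.*2.+1%:R * cos kappa ^+ M.*2.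
Proof.
move=> /andP[k0 k4] x4.
have pi0 : 0 < pi :> R := pi_gt0 R.
have ck0 : 0 <= cos kappa by rewrite cos_ge0_pihalf //; lra.
apply: (@le_trans _ _ (\sum_(c < N) (2 ^+ M.*2 / ('C(M.*2, M)%:R * N%:R) *
    cos kappa ^+ M.*2))).
  rewrite big_mkcond; apply: ler_sum => c _.
  have coef0 : 0 <= 2 ^+ M.*2 / ('C(M.*2, M)%:R * N%:R) :> R.
    by rewrite divr_ge0 ?exprn_ge0 ?mulr_ge0.
  case: ifPn => [far|_]; last by rewrite mulr_ge0 // exprn_ge0.
  rewrite soft_cellE ler_wpM2l //.
  have -> : cos (theta * x + cell_phase c) ^+ M.*2 =
      `|cos (theta * x + cell_phase c)| ^+ M.*2.
    by rewrite -mul2n !exprM real_normK ?num_real.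
  rewrite lerXn2r ?nnegrE //; rewrite /near_cell -ltNge in far.
  have y3 : `|theta * x + cell_phase c| <= 3 * (pi / 4).
    have cN : (0 : R) <= (pi : R) * c%:R / N%:R <= (pi : R).
      apply/andP; split; first by rewrite divr_ge0 ?mulr_ge0 ?(ltW pi0).
      by rewrite ler_pdivrMr // ler_pM2l // ler_nat ltnW.
    rewrite /cell_phase; move: x4 cN; move: (pi * c%:R / N%:R) => z.
    by rewrite !ler_norml => /andP[? ?] /andP[? ?]; apply/andP; split; lra.
  rewrite -(cos_norm (theta * x + _)).
  set y := `|theta * x + _| in far y3 *.
  have mono (u v : R) : u \in `[0, pi] -> v \in `[0, pi] -> (cos u <= cos v) = (v <= u).
    by move=> hu hv; rewrite !leNgt ltr_cos.
  have yk : cos y <= cos kappa.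
    by rewrite mono ?in_itv /=; [exact: ltW| |]; apply/andP; split; lra.
  have y34 : cos (3 * (pi / 4)) <= cos y.
    by rewrite mono ?in_itv /=; [| |]; rewrite ?y3 //; apply/andP; split; lra.
  have k34 : cos (pi / 4) <= cos kappa.
    by rewrite mono ?in_itv /=; [exact: k4| |]; apply/andP; split; lra.
  have p34 : cos (3 * (pi / 4)) = - cos (pi / 4) :> R.
    rewrite (_ : 3 * (pi / 4) = pi - pi / 4); last by field.
    by rewrite cosB cospi sinpi; ring.
  by rewrite ler_norml; apply/andP; split; lra.
rewrite sumr_const card_ord -[leLHS]mulr_natl mulrA ler_wpM2r ?exprn_ge0 //.
rewrite (_ : N%:R * _ = 2 ^+ M.*2 / 'C(M.*2, M)%:R); last by field; rewrite !gt_eqF.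
by rewrite ler_pdivrMr // exp4_le_bin_central.
Qed.

(** Each coefficient is at most 1/N, and the Gaussian factor at frequency 2 (M - l) is at most q^|M
    - l|: two geometric series remain. The difference of [maxn] and [minn] is |l - M|. *)
Lemma cell_weight_le c : theta != 0 ->
  cell_weight c <= 2 / (1 - expR (- (2 * theta ^+ 2))) / N%:R.
Proof.
move=> th0; set q := expR (- (2 * theta ^+ 2)).
have q0 : 0 <= q by exact: expR_ge0.
have q1 : q < 1 by rewrite expR_lt1 oppr_lt0 mulr_gt0 // exprn_even_gt0.
have geo n : \sum_(i < n) q ^+ i <= (1 - q)^-1.
  have := subrX1 q n; rewrite -opprB -[q - 1]opprB mulNr => /oppr_inj h.
  by rewrite -div1r ler_pdivlMr ?subr_gt0 // mulrC -h gerBl exprn_ge0.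
apply: (@le_trans _ _ (\sum_(l < M.*2.+1) (q ^+ (maxn l M - minn l M) / N%:R))).
  apply: ler_sum => l _; rewrite mulrC.
  have coef0 : 0 <= cell_coef l by rewrite divr_ge0 ?mulr_ge0.
  have coef1 : cell_coef l <= N%:R^-1.
    rewrite /cell_coef invfM mulrA ler_piMl ?invr_ge0 //.
    by rewrite ler_pdivrMr // mul1r ler_nat bin_central_max.
  have e0 := expR_ge0 (- ((freq l * theta) ^+ 2 / 2)).
  apply: (@le_trans _ _ (expR (- ((freq l * theta) ^+ 2 / 2)) * cell_coef l)).
    by rewrite ler_wpM2r // ler_piMr // cos_le1.
  apply: ler_pM => //.
  rewrite -expRM_natl ler_expR mulrN lerN2.
  have -> : (freq l * theta) ^+ 2 / 2 = 2 * theta ^+ 2 * (M%:R - l%:R) ^+ 2.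
    by rewrite /freq M2; field.
  have -> : (M%:R - l%:R) ^+ 2 = ((maxn l M - minn l M)%:R) ^+ 2 :> R.
    have [Ml|lM'] := leqP M l.
      by rewrite natrB // -sqrrN opprB.
    by rewrite natrB ?(ltnW lM').
  rewrite mulrC ler_wpM2l ?(mulr_ge0 _ (sqr_ge0 _)) //.
  by rewrite -natrX ler_nat -mulnn; case: (_ - _)%N => // n; rewrite leq_pmulr.
rewrite -mulr_suml ler_pM2r ?invr_gt0 //.
rewrite -(big_mkord xpredT (fun l => q ^+ (maxn l M - minn l M))).
rewrite (big_cat_nat (n := M)) //=; last by rewrite -addnn -addnS leq_addr.
rewrite (_ : 2 / (1 - q) = (1 - q)^-1 + (1 - q)^-1); last by rewrite mulrDl !mul1r.
apply: lerD.
  rewrite big_mkord (reindex_inj rev_ord_inj) /=.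
  apply: le_trans (geo M.+1); rewrite [leRHS]big_ord_recl /= expr0.
  apply: (@le_trans _ _ (\sum_(i < M) q ^+ i.+1)); last by rewrite lerDr.
  apply: ler_sum => i _.
  have iM := ltn_ord i; rewrite (maxn_idPr _) ?(minn_idPl _) ?leq_subr //.
  by rewrite subKn.
rewrite -{1}[M]add0n big_addn (_ : M.*2.+1 - M = M.+1)%N; last by lia.
rewrite big_mkord; apply: le_trans (geo M.+1); apply: ler_sum => i _.
by rewrite (maxn_idPl _) ?leq_addl // (minn_idPr _) ?leq_addl // addnK.
Qed.

End SoftCells.

(** Schur test for the operator norm. Cauchy-Schwarz comes from the sign of a quadratic polynomial
    in s ([key]). *)
Lemma sum_sqr_mulmx_le (R : realType) m (A : 'M[R]_m) (t : 'rV[R]_m) (rho gam : R) :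
  0 <= rho -> (forall i, \sum_j `|A i j| <= rho) -> (forall j, \sum_i `|A i j| <= gam) ->
  \sum_j (t *m A) 0 j ^+ 2 <= gam * rho * \sum_i t 0 i ^+ 2.
Proof.
move=> rho0 rowA colA.
have CS j : (t *m A) 0 j ^+ 2 <= gam * \sum_i t 0 i ^+ 2 * `|A i j|.
  have s0 i : 0 <= Num.sqrt `|A i j| by exact: sqrtr_ge0.
  have ss i : Num.sqrt `|A i j| ^+ 2 = `|A i j| by rewrite sqr_sqrtr.
  have le1 : `|(t *m A) 0 j| <= \sum_i `|t 0 i| * `|A i j|.
    rewrite mxE; apply: le_trans (ler_norm_sum _ _ _) _.
    by apply: ler_sum => i _; rewrite normrM.
  have S0 : 0 <= \sum_i `|t 0 i| * `|A i j| by apply: sumr_ge0 => i _; exact: mulr_ge0.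
  set x := \sum_i `|t 0 i| * `|A i j| in le1 S0.
  set y := \sum_i `|A i j|; set z := \sum_i t 0 i ^+ 2 * `|A i j|.
  have y0 : 0 <= y by exact: sumr_ge0.
  have z0 : 0 <= z by apply: sumr_ge0 => i _; rewrite mulr_ge0 ?sqr_ge0.
  have key (s : R) : 0 <= s ^+ 2 * y - 2 * s * x + z.
    have -> : s ^+ 2 * y - 2 * s * x + z = \sum_i (s - `|t 0 i|) ^+ 2 * `|A i j|.
      rewrite /y /x /z !mulr_sumr -sumrB -big_split /=; apply: eq_bigr => i _.
      by rewrite -(real_normK (num_real (t 0 i))); ring.
    by apply: sumr_ge0 => i _; rewrite mulr_ge0 ?sqr_ge0.
  have xyz : x ^+ 2 <= y * z.
    have [y00|yn0] := eqVneq y 0.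
      have : x = 0; last by move=> ->; rewrite expr0n y00 mul0r.
      apply/eqP; rewrite eq_le S0 andbT leNgt; apply/negP => x0.
      have := key ((z + 1) / x); rewrite y00 mulr0 mulrA divfK ?gt_eqF //; lra.
    have y1 : 0 < y by rewrite lt_neqAle eq_sym yn0.
    have := key (x / y); rewrite (_ : _ + z = (y * z - x ^+ 2) / y).
      by rewrite pmulr_lge0 ?invr_gt0 // subr_ge0.
    by field.
  rewrite -(real_normK (num_real _)).
  apply: (@le_trans _ _ (x ^+ 2)); first by rewrite lerXn2r ?nnegrE.
  by apply: le_trans xyz _; rewrite ler_wpM2r // colA.
apply: (@le_trans _ _ (\sum_j gam * \sum_i t 0 i ^+ 2 * `|A i j|)).
  by apply: ler_sum => j _; exact: CS.
have [m0|m0] := posnP m.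
  rewrite !big1 ?mulr0 // => i _; have := ltn_ord i; rewrite {2}m0 ltn0 //.
have gam0 : 0 <= gam by apply: le_trans (colA (Ordinal m0)); exact: sumr_ge0.
rewrite -mulr_sumr -mulrA ler_wpM2l // exchange_big /= mulr_sumr.
apply: ler_sum => i _.
by rewrite -mulr_sumr mulrC ler_wpM2r ?sqr_ge0.
Qed.

(** * Orthonormalization of a weakly correlated family *)

Section NearOrthonormal.
Context {R : realType} d {T : measurableType d} (P : probability T R).
Variables (I : eqType) (X : I -> T -> R) (c : I -> I -> R) (delta : R).
Hypothesis XG : gaussian_field P X c.
Hypothesis csym : forall u v, c u v = c v u.
Hypothesis c1 : forall u, c u u = 1.
Hypothesis cdelta : forall (F : seq I) u, uniq F -> u \notin F -> \sum_(v <- F) `|c u v| <= delta.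
Hypothesis delta0 : 0 <= delta.
Hypothesis delta10 : delta <= 10%:R^-1.

Lemma near_orthonormal (J : finType) (v : J -> I) : injective v ->
  exists g : J -> T -> R, [/\ forall j, measurable_fun setT (g j),
    forall (b : J -> R) (phi : R), \int[P]_w cos (\sum_j b j * g j w + phi) =
      expR (- ((\sum_j b j ^+ 2) / 2)) * cos phi &
    forall (t1 t2 : J -> R) (V a : R),
      2 * (\sum_j t1 j ^+ 2) + 8%:R * delta ^+ 2 * (\sum_j t2 j ^+ 2) <= V ->
      0 < V -> 0 <= a ->
      (P [set w | (a <= \sum_j (t1 j * g j w + t2 j * (X (v j) w - g j w)))%R] <=
       (expR (- (a ^+ 2 / (2 * V))))%:E)%E].
Proof.
move=> vinj; set m := #|J|.
pose vv (i : 'I_m) := v (enum_val i).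
have vvinj : injective vv by move=> i j /vinj /enum_val_inj.
pose S : 'M[R]_m := \matrix_(i, j) c (vv i) (vv j).
have sumJ (f : J -> R) : \sum_j f j = \sum_(i < m) f (enum_val i).
  rewrite (reindex (@enum_val J predT)) //=.
  by exists enum_rank => x _; [exact: enum_valK|exact: enum_rankK].
have [L [LL uL rowL colL]] : exists L : 'M[R]_m, [/\ L *m L^T = S, L \in unitmx,
    forall i, \sum_j `|(L - 1%:M) i j| <= 2 * delta &
    forall j, \sum_i `|(L - 1%:M) i j| <= 2 * delta].
  apply: (@cholesky _ _ S (fun=> delta)) => //.
    by apply/matrixP => i j; rewrite !mxE csym.
  move=> i; rewrite (bigD1 i) //= !mxE c1 eqxx subrr normr0 add0r.
  have := @cdelta [seq vv j | j <- enum [pred j | j != i]] (vv i).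
  rewrite map_inj_uniq ?enum_uniq // big_map big_enum_cond /= => /(_ isT).
  rewrite mem_map // mem_enum inE eqxx => /(_ isT); apply: le_trans.
  rewrite le_eqVlt; apply/orP; left; apply/eqP; apply: eq_big => j; first by rewrite andbT.
  by move=> ji; rewrite !mxE eq_sym (negbTE ji) subr0.
pose B := invmx L.
pose lst (A : 'rV[R]_m) : seq (R * I) := [seq (A 0 i, vv i) | i <- enum 'I_m].
have lstE (A : 'rV[R]_m) w : lincomb X (lst A) w = \sum_i A 0 i * X (vv i) w.
  by rewrite /lincomb big_map big_enum.
have quadE (A : 'rV[R]_m) : quad c (lst A) = \sum_k (A *m L) 0 k ^+ 2.
  transitivity ((A *m L *m (A *m L)^T) 0 0); last first.
    by rewrite mxE; apply: eq_bigr => k _; rewrite [_^T _ _]mxE expr2.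
  rewrite trmx_mul mulmxA -(mulmxA A) LL mxE /quad big_map big_enum /=.
  under eq_bigr do rewrite big_map big_enum /=.
  rewrite exchange_big /=; apply: eq_bigr => j _; rewrite !mxE mulr_suml.
  by apply: eq_bigr => i _; rewrite !mxE; ring.
pose g j := lincomb X (lst (row (enum_rank j) B)).
have gE (i : 'I_m) w : g (enum_val i) w = \sum_k B i k * X (vv k) w.
  by rewrite /g lstE enum_valK; apply: eq_bigr => k _; rewrite mxE.
have comb (t1 t2 : J -> R) : exists2 Ls : seq (R * I),
    forall w, lincomb X Ls w = \sum_j (t1 j * g j w + t2 j * (X (v j) w - g j w)) &
    quad c Ls = \sum_k (\row_i t1 (enum_val i) + \row_i t2 (enum_val i) *m (L - 1%:M)) 0 k ^+ 2.
  pose T1 : 'rV[R]_m := \row_i t1 (enum_val i); pose T2 : 'rV[R]_m := \row_i t2 (enum_val i).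
  exists (lst (T1 *m B + (T2 - T2 *m B))) => [w|].
    rewrite lstE sumJ.
    have TB (t : 'rV[R]_m) : \sum_k (t *m B) 0 k * X (vv k) w = \sum_i t 0 i * g (enum_val i) w.
      under eq_bigr do rewrite mxE mulr_suml.
      rewrite exchange_big /=; apply: eq_bigr => i _; rewrite gE mulr_sumr.
      by apply: eq_bigr => k _; rewrite mulrA.
    transitivity (\sum_k (T1 *m B) 0 k * X (vv k) w +
        (\sum_k T2 0 k * X (vv k) w - \sum_k (T2 *m B) 0 k * X (vv k) w)).
      rewrite -sumrB -big_split /=; apply: eq_bigr => k _.
      have -> : (T1 *m B + (T2 - T2 *m B)) 0 k =
          (T1 *m B) 0 k + (T2 0 k - (T2 *m B) 0 k) by rewrite !mxE.
      by ring.
    rewrite !TB -sumrB -big_split /=; apply: eq_bigr => i _; rewrite !mxE /vv; ring.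
  rewrite quadE; apply: eq_bigr => k _; congr (_ 0 k ^+ 2).
  rewrite !mulmxDl mulNmx -!mulmxA /B mulVmx // !mulmx1.
  by rewrite mulmxDr mulmxN mulmx1.
exists g; split.
- by move=> j; exact: (measurable_lincomb XG).
- move=> b phi; have [Ls LsE qE] := comb b (fun=> 0).
  have := gaussian_field_cos XG Ls phi.
  rewrite (_ : quad c Ls = \sum_j b j ^+ 2); last first.
    rewrite qE sumJ; apply: eq_bigr => k _; congr (_ ^+ 2).
    rewrite (_ : \row_i (0 : R) = 0); last by apply/matrixP => ? ?; rewrite !mxE.
    by rewrite mul0mx addr0 mxE.
  move=> <-; apply: eq_Rintegral => w _; rewrite LsE; congr (cos (_ + _)).
  by apply: eq_bigr => j _; rewrite mul0r addr0.
- move=> t1 t2 V a leV V0 a0; have [Ls LsE qE] := comb t1 t2.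
  rewrite (_ : [set w | _] = [set w | (a <= lincomb X Ls w)%R]); last first.
    by apply/seteqP; split=> w /=; rewrite LsE.
  apply: (gaussian_field_chernoff XG) => //; apply: le_trans leV; rewrite qE.
  set T1 : 'rV[R]_m := \row_i t1 (enum_val i); set T2 : 'rV[R]_m := \row_i t2 (enum_val i).
  have h := @sum_sqr_mulmx_le _ _ (L - 1%:M) T2 (2 * delta) (2 * delta)
    (mulr_ge0 (ler0n _ 2) delta0) rowL colL.
  apply: (@le_trans _ _ (2 * (\sum_k T1 0 k ^+ 2) + 2 * \sum_k (T2 *m (L - 1%:M)) 0 k ^+ 2)).
    rewrite !mulr_sumr -big_split /=; apply: ler_sum => k _; rewrite [in leLHS]mxE.
    set x := T1 0 k; set y := (T2 *m _) 0 k; have := sqr_ge0 (x - y); nra.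
  have e1 : \sum_k T1 0 k ^+ 2 = \sum_j t1 j ^+ 2.
    by rewrite sumJ; apply: eq_bigr => k _; rewrite mxE.
  have e2 : \sum_k T2 0 k ^+ 2 = \sum_j t2 j ^+ 2.
    by rewrite sumJ; apply: eq_bigr => k _; rewrite mxE.
  rewrite e1; rewrite e2 in h; lra.
Qed.

End NearOrthonormal.

(** * Factorizing expectations *)

Section BoundedIntegrals.
Context {R : realType} d {T : measurableType d} (P : probability T R).

Definition bounded_rv (f : T -> R) : Prop :=
  measurable_fun setT f /\ exists k, forall w, `|f w| <= k.

Lemma bounded_rv_integrable f : bounded_rv f -> P.-integrable setT (EFin \o f).
Proof. by move=> [mf [k fk]]; exact: integrable_bounded_fun fk. Qed.

Lemma bounded_rv_cst k : bounded_rv (cst k).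
Proof. by split=> //; exists `|k|. Qed.

Lemma bounded_rvM f g : bounded_rv f -> bounded_rv g -> bounded_rv (fun w => f w * g w).
Proof.
move=> [mf [k fk]] [mg [l gl]]; split; first exact: measurable_funM.
by exists (k * l) => w; rewrite normrM ler_pM.
Qed.

Lemma bounded_rvD f g : bounded_rv f -> bounded_rv g -> bounded_rv (fun w => f w + g w).
Proof.
move=> [mf [k fk]] [mg [l gl]]; split; first exact: measurable_funD.
by exists (k + l) => w; rewrite (le_trans (ler_normD _ _)) // lerD.
Qed.

Lemma bounded_rv_sum (I : Type) (s : seq I) (f : I -> T -> R) :
  (forall i, bounded_rv (f i)) -> bounded_rv (fun w => \sum_(i <- s) f i w).
Proof.
move=> bf; elim: s => [|i s IH].
  by under eq_fun do rewrite big_nil; exact: bounded_rv_cst.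
by under eq_fun do rewrite big_cons; exact: bounded_rvD.
Qed.

Lemma bounded_rv_prod (I : Type) (s : seq I) (f : I -> T -> R) :
  (forall i, bounded_rv (f i)) -> bounded_rv (fun w => \prod_(i <- s) f i w).
Proof.
move=> bf; elim: s => [|i s IH].
  by under eq_fun do rewrite big_nil; exact: bounded_rv_cst.
by under eq_fun do rewrite big_cons; exact: bounded_rvM.
Qed.

Lemma Rintegral_sum (I : Type) (s : seq I) (f : I -> T -> R) :
  (forall i, bounded_rv (f i)) ->
  \int[P]_w (\sum_(i <- s) f i w) = \sum_(i <- s) \int[P]_w f i w.
Proof.
move=> bf; elim: s => [|i s IH].
  by rewrite big_nil; under eq_Rintegral do rewrite big_nil; rewrite Rintegral_prob_cst.
rewrite big_cons -IH -RintegralD //; last 2 first.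
- exact/bounded_rv_integrable.
- exact/bounded_rv_integrable/bounded_rv_sum.
by apply: eq_Rintegral => w _; rewrite big_cons.
Qed.

Lemma RintegralMl (k : R) f : bounded_rv f ->
  \int[P]_w (k * f w) = k * \int[P]_w f w.
Proof. by move=> bf; rewrite RintegralZl //; exact: bounded_rv_integrable. Qed.

Variables (J : finType) (g : J -> T -> R).
Hypothesis mg : forall j, measurable_fun setT (g j).
Hypothesis g_cos : forall (b : J -> R) (phi : R),
  \int[P]_w cos (\sum_j b j * g j w + phi) = expR (- ((\sum_j b j ^+ 2) / 2)) * cos phi.

Lemma bounded_rv_cos (f : T -> R) : measurable_fun setT f -> bounded_rv (fun w => cos (f w)).
Proof.
move=> mf; split; last by exists 1 => w; exact: cos_max.
apply: (@measurableT_comp _ _ _ _ _ _ cos) => //.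
by apply: continuous_measurable_fun; exact: continuous_cos.
Qed.

Lemma bounded_rv_cosg b j phi : bounded_rv (fun w => cos (b * g j w + phi)).
Proof. by apply: bounded_rv_cos; apply: measurable_funD => //; exact: measurable_funM. Qed.

(** The leading cosine, whose frequencies vanish on [s], absorbs the factors one at a time by the
    product-to-sum formula. Both resulting cosines have the same squared frequency, so the Gaussian
    factors agree and the phases recombine into a product. *)
Let cos_prod_seq (s : seq J) (b phi : J -> R) : uniq s ->
  forall (B : J -> R) (psi : R), (forall j, j \in s -> B j = 0) ->
  \int[P]_w (cos (\sum_j B j * g j w + psi) * \prod_(j <- s) cos (b j * g j w + phi j)) =
  expR (- ((\sum_j B j ^+ 2) / 2)) * cos psi *
  \prod_(j <- s) (expR (- (b j ^+ 2 / 2)) * cos (phi j)).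
Proof.
elim: s => [|j0 s IH] /=.
  move=> _ B psi _; rewrite big_nil mulr1 -g_cos.
  by apply: eq_Rintegral => w _; rewrite big_nil mulr1.
move=> /andP[j0s us] B psi B0.
pose B' (e : R) j := B j + (if j == j0 then e * b j0 else 0).
have B'0 e j : j \in s -> B' e j = 0.
  move=> js; rewrite /B' B0 ?inE ?js ?orbT //.
  by rewrite ifN ?addr0 //; apply: contraNneq j0s => <-.
have Bj0 : B j0 = 0 by apply: B0; rewrite mem_head.
have sumB' e w : \sum_j B' e j * g j w = \sum_j B j * g j w + e * b j0 * g j0 w.
  rewrite (bigD1 j0) //= [\sum_j B j * _](bigD1 j0) //= /B' eqxx Bj0 add0r mul0r add0r addrC.
  by congr (_ + _); apply: eq_bigr => j /negbTE ->; rewrite addr0.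
have sqB' e : e ^+ 2 = 1 -> \sum_j B' e j ^+ 2 = \sum_j B j ^+ 2 + b j0 ^+ 2.
  move=> e1; rewrite (bigD1 j0) //= [\sum_j B j ^+ 2](bigD1 j0) //= /B' eqxx Bj0 add0r.
  rewrite exprMn e1 mul1r expr0n /= add0r addrC.
  by congr (_ + _); apply: eq_bigr => j /negbTE ->; rewrite addr0.
have bB e psi' : bounded_rv (fun w => cos (\sum_j B' e j * g j w + psi') *
    \prod_(j <- s) cos (b j * g j w + phi j)).
  apply: bounded_rvM; last by apply: bounded_rv_prod => j; exact: bounded_rv_cosg.
  apply: bounded_rv_cos; apply: measurable_funD => //.
  by apply: measurable_sum => j; exact: measurable_funM.
transitivity (\int[P]_w (2^-1 * (cos (\sum_j B' 1 j * g j w + (psi + phi j0)) *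
      \prod_(j <- s) cos (b j * g j w + phi j) +
    cos (\sum_j B' (- 1) j * g j w + (psi - phi j0)) *
      \prod_(j <- s) cos (b j * g j w + phi j)))).
  apply: eq_Rintegral => w _; rewrite big_cons !sumB'.
  set S := \sum_j _; set Q := \prod_(j <- s) _.
  rewrite mulrA cosMcos -mulrDl mulrA; congr (_ * Q); rewrite mulrC; congr (_ * (_ + _)).
    by congr cos; ring.
  by congr cos; ring.
rewrite RintegralMl; last exact: bounded_rvD.
rewrite RintegralD //; last 2 first.
- exact: bounded_rv_integrable.
- exact: bounded_rv_integrable.
rewrite !IH //; [|exact: B'0|exact: B'0].
rewrite !sqB' ?expr1n ?sqrrN ?expr1n // big_cons cosD cosB.
rewrite [X in expR X](_ : _ = - ((\sum_j B j ^+ 2) / 2) + - (b j0 ^+ 2 / 2)); last by field.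
by rewrite expRD; field.
Qed.

Lemma integral_cos_prod (b phi : J -> R) :
  \int[P]_w (\prod_j cos (b j * g j w + phi j)) =
  \prod_j (expR (- (b j ^+ 2 / 2)) * cos (phi j)).
Proof.
have := @cos_prod_seq (index_enum J) b phi (index_enum_uniq J) (fun=> 0) 0 (fun _ _ => erefl).
rewrite big1; last by move=> j _; rewrite expr0n.
rewrite mul0r oppr0 expR0 mul1r cos0 mul1r => <-.
apply: eq_Rintegral => w _.
rewrite [X in cos (X + 0)]big1; last by move=> j _; rewrite mul0r.
by rewrite addr0 cos0 mul1r.
Qed.

Variables (M : nat) (theta : R).
Local Notation N := M.+1.

Lemma bounded_rv_soft_cell c j : bounded_rv (fun w => soft_cell M theta c (g j w)).
Proof.
apply: bounded_rv_sum => l; apply: bounded_rvM; first exact: bounded_rv_cst.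
apply: bounded_rv_cos; apply: measurable_funM => //; apply: measurable_funD => //.
exact: measurable_funM.
Qed.

Lemma integral_soft_cell_prod (c : J -> nat) :
  \int[P]_w (\prod_j soft_cell M theta (c j) (g j w)) = \prod_j cell_weight M theta (c j).
Proof.
pose phi (j : J) (l : 'I_M.*2.+1) : R := freq M l * cell_phase M (c j).
rewrite /cell_weight bigA_distr_bigA /=.
transitivity (\int[P]_w (\sum_(l : {ffun J -> 'I_M.*2.+1}) (\prod_j cell_coef M (l j)) *
    \prod_j cos (freq M (l j) * theta * g j w + phi j (l j)))).
  apply: eq_Rintegral => w _; rewrite /soft_cell bigA_distr_bigA /=.
  apply: eq_bigr => l _; rewrite -big_split /=; apply: eq_bigr => j _.
  by congr (_ * cos _); rewrite /phi mulrDr mulrA.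
rewrite Rintegral_sum; last first.
  move=> l; apply: bounded_rvM; first exact: bounded_rv_cst.
  by apply: bounded_rv_prod => j; exact: bounded_rv_cosg.
apply: eq_bigr => l _; rewrite RintegralMl; last first.
  by apply: bounded_rv_prod => j; exact: bounded_rv_cosg.
by rewrite integral_cos_prod -big_split.
Qed.

Lemma integral_soft_cell c j :
  \int[P]_w soft_cell M theta c (g j w) = cell_weight M theta c.
Proof.
pose phi (l : 'I_M.*2.+1) : R := freq M l * cell_phase M c.
transitivity (\int[P]_w (\sum_(l < M.*2.+1) cell_coef M l *
    cos (freq M l * theta * g j w + phi l))).
  apply: eq_Rintegral => w _; apply: eq_bigr => l _.
  by congr (_ * cos _); rewrite /phi mulrDr mulrA.
rewrite Rintegral_sum; last first.
  by move=> l; apply: bounded_rvM; [exact: bounded_rv_cst|exact: bounded_rv_cosg].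
apply: eq_bigr => l _; rewrite RintegralMl; last exact: bounded_rv_cosg.
congr (_ * _).
have := integral_cos_prod (fun i => if i == j then freq M l * theta else 0)
  (fun i => if i == j then phi l else 0).
rewrite [RHS](bigD1 j) //= eqxx [X in _ * _ * X]big1; last first.
  by move=> i /negbTE ->; rewrite expr0n /= mul0r oppr0 expR0 cos0 mulr1.
rewrite mulr1 => <-; apply: eq_Rintegral => w _.
rewrite (bigD1 j) //= eqxx big1 ?mulr1 // => i /negbTE ->.
by rewrite mul0r add0r cos0.
Qed.

(** The terms of [cell_weight] may have both signs; positivity is read off its being an expectation
    for some [g j], hence the argument [j]. *)
Lemma cell_weight_ge0 c : J -> 0 <= cell_weight M theta c.
Proof.
move=> j; rewrite -(integral_soft_cell c j).
by apply: Rintegral_ge0 => w _; exact: soft_cell_ge0.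
Qed.

Lemma sum_cell_weight : J -> \sum_(c < N) cell_weight M theta c = 1.
Proof.
move=> j; under eq_bigr do rewrite -(integral_soft_cell _ j).
rewrite -Rintegral_sum => [|c]; last exact: bounded_rv_soft_cell.
rewrite -[RHS](Rintegral_prob_cst P); apply: eq_Rintegral => w _.
by rewrite sum_soft_cell.
Qed.

End BoundedIntegrals.

Section PowerBounds.
Context {R : realFieldType}.

Lemma exprBn_ge (x : R) n : 0 <= x <= 1 -> 1 - n%:R * x <= (1 - x) ^+ n.
Proof.
move=> /andP[x0 x1]; elim: n => [|n IH]; first by rewrite mul0r subr0 expr0.
rewrite exprS; apply: (@le_trans _ _ ((1 - x) * (1 - n%:R * x))).
  rewrite -natr1; have : 0 <= n%:R * x * x by rewrite !mulr_ge0.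
  by lra.
by rewrite ler_wpM2l // subr_ge0.
Qed.

Lemma exprDn_le2 (x : R) n : 0 <= x -> n%:R * x <= 2^-1 -> (1 + x) ^+ n <= 2.
Proof.
move=> x0 nx; have [->|n0] := posnP n; first by rewrite expr0; lra.
have x1 : x <= 1.
  have : x <= n%:R * x by rewrite ler_peMl // ler1n.
  by lra.
have h : 2^-1 <= (1 - x) ^+ n.
  by apply: le_trans (exprBn_ge n _); [lra|rewrite x0].
have h1 : (1 + x) ^+ n * (1 - x) ^+ n <= 1.
  rewrite -exprMn exprn_ile1 //; last by nra.
  by rewrite mulr_ge0 //; lra.
have h0 : 0 <= (1 + x) ^+ n by rewrite exprn_ge0 // addr_ge0.
nra.
Qed.

End PowerBounds.

(** * Probability of near records *)

Section RecordCells.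
Context {R : realType} (M n a : nat) (theta kappa h : R).
Local Notation N := M.+1.

Definition record_cells (b : 'I_n -> bool) (x : 'I_n -> R) : R :=
  \sum_(f : {ffun 'I_n -> 'I_N} | near_records a b N f)
    \prod_j soft_cell M theta (f j) (x j).

Hypothesis theta0 : 0 < theta.
Hypothesis kappa0 : 0 < kappa <= pi / 4.
Hypothesis mass : n%:R * (M.*2.+1%:R * cos kappa ^+ M.*2) <= 2^-1.
Hypothesis slack : N%:R * (2 * kappa + theta * h) <= pi * a%:R.

(** By [mass], a point puts all but 1/(2n) of its mass in cells within [kappa], and n such factors
    leave at least 1/2. Passing from points to such cells moves each by at most [kappa] in the scale
    of [theta], which [slack] converts into [a] cells. *)
Lemma record_cells_ge (b : 'I_n -> bool) (x : 'I_n -> R) :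
  (forall j, ~~ b j) \/
  ((forall j, `|theta * x j| <= pi / 4) /\
   (forall j j' : 'I_n, b j -> (j < j')%N -> x j' <= x j + h)) ->
  2^-1 <= record_cells b x.
Proof.
case=> [nb|[xs rec]].
  rewrite /record_cells (eq_bigl predT); last first.
    move=> f; rewrite /near_records; apply/andP; split; apply/forallP => j; first exact: ltn_ord.
    by apply/forallP => j'; rewrite (negbTE (nb j)).
  rewrite -(bigA_distr_bigA (fun j (y : 'I_N) => soft_cell M theta y (x j))) /=.
  rewrite big1; first by lra.
  by move=> j _; rewrite sum_soft_cell.
have mass' := mass; set mu := M.*2.+1%:R * cos kappa ^+ M.*2 in mass'.
have pi0 : 0 < pi :> R := pi_gt0 R.
have mu0 : 0 <= mu.
  rewrite mulr_ge0 // exprn_ge0 // cos_ge0_pihalf //.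
  by move/andP: (kappa0) => [? ?]; lra.
apply: (@le_trans _ _ (\prod_(j < n) \sum_(y < N | near_cell M theta kappa (x j) y)
    soft_cell M theta y (x j))).
  have cell1 j : 1 - mu <= \sum_(y < N | near_cell M theta kappa (x j) y) soft_cell M theta y (x j).
    have := sum_soft_cell M theta (x j).
    rewrite (bigID (fun y : 'I_N => near_cell M theta kappa (x j) y)) /= => S1.
    have := soft_cell_far M kappa0 (xs j); rewrite -/mu; lra.
  have [n0|n0] := posnP n.
    rewrite big1 => [|j _]; first by lra.
    by have := ltn_ord j; rewrite {2}n0 ltn0.
  have mu1 : mu <= 1.
    have : mu <= n%:R * mu by rewrite ler_peMl // ler1n.
    by lra.
  apply: (@le_trans _ _ ((1 - mu) ^+ n)).
    by apply: le_trans (exprBn_ge n _); [lra|rewrite mu0].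
  rewrite -[X in _ ^+ X]card_ord -prodr_const; apply: ler_prod => j _.
  by rewrite subr_ge0 mu1 cell1.
under eq_bigr do rewrite big_mkcond /=.
rewrite bigA_distr_bigA /= /record_cells [leRHS]big_mkcond /=.
apply: ler_sum => f _.
have [/forallP near|] := boolP [forall j, near_cell M theta kappa (x j) (f j)]; last first.
  rewrite negb_forall => /existsP[j /negbTE nj].
  rewrite (bigD1 j) //= nj mul0r; case: ifP => // _.
  by apply: prodr_ge0 => i _; exact: soft_cell_ge0.
rewrite ifT; first by apply: ler_prod => j _; rewrite near soft_cell_ge0 lexx.
apply/andP; split; apply/forallP => j; first exact: ltn_ord.
apply/forallP => j'; apply/implyP => bj; apply/implyP => jj'.
have := near j; have := near j'; rewrite /near_cell /cell_phase => nj' nj.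
have := rec j j' bj jj'; rewrite -(ler_pM2l theta0) mulrDr => rj.
have N0 : (0 : R) < N%:R by rewrite ltr0n.
have key : (pi : R) * (f j')%:R / N%:R <= (pi : R) * (f j)%:R / N%:R + (2 * kappa + theta * h).
  move: nj nj' rj; move: (pi * (f j)%:R / N%:R) (pi * (f j')%:R / N%:R) => u v.
  by rewrite !ler_norml => /andP[? ?] /andP[? ?] ?; lra.
have : (pi : R) * (f j')%:R <= (pi : R) * (f j)%:R + pi * a%:R.
  apply: (@le_trans _ _ ((pi : R) * (f j)%:R + N%:R * (2 * kappa + theta * h))); last by rewrite lerD2l.
  have := ler_wpM2l (ltW N0) key; rewrite mulrDr ![N%:R * (_ / _)]mulrC !divfK ?gt_eqF //.
by rewrite -mulrDr ler_pM2l // -natrD ler_nat.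
Qed.

End RecordCells.

Section RecordsProbability.
Context {R : realType} d {T : measurableType d} (P : probability T R).
Variables (m n : nat) (g : 'I_m * 'I_n -> T -> R).
Hypothesis mg : forall j, measurable_fun setT (g j).
Hypothesis g_cos : forall (b : 'I_m * 'I_n -> R) (phi : R),
  \int[P]_w cos (\sum_j b j * g j w + phi) = expR (- ((\sum_j b j ^+ 2) / 2)) * cos phi.
Variables (M a : nat) (theta kappa h : R).
Local Notation N := M.+1.
Hypothesis theta0 : 0 < theta.
Hypothesis kappa0 : 0 < kappa <= pi / 4.
Hypothesis mass : n%:R * (M.*2.+1%:R * cos kappa ^+ M.*2) <= 2^-1.
Hypothesis slack : N%:R * (2 * kappa + theta * h) <= pi * a%:R.
Hypothesis atoms : n%:R * (n%:R * (a.+1%:R *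
  (2 / (1 - expR (- (2 * theta ^+ 2))) / N%:R))) <= 2^-1.

Variable b : 'I_m -> 'I_n -> bool.
Local Notation W i := (\sum_(f : {ffun 'I_n -> 'I_N} | near_records a (b i) N f)
  \prod_j cell_weight M theta (f j)).

(** The weights have total mass 1, so [atoms] bounds the power in [near_records_weight] by 2. *)
Lemma record_weight_le i :
  0 <= W i <= 2 * \prod_(j | b i j) (n - j)%:R^-1.
Proof.
have [n0|n0] := posnP n.
  have nI (j : 'I_n) : False by have := ltn_ord j; rewrite {2}n0 ltn0.
  rewrite [\prod_(j | b i j) _]big1 => [|j]; last by case: (nI j).
  apply/andP; split; first by apply: sumr_ge0 => f _; apply: prodr_ge0 => j; case: (nI j).
  apply: (@le_trans _ _ (\sum_(f : {ffun 'I_n -> 'I_N}) 1)).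
    rewrite big_mkcond; apply: ler_sum => f _; case: ifP => // _.
    by rewrite big1 // => j; case: (nI j).
  by rewrite sumr_const card_ffun !card_ord n0 expn0 mulr1 ler1n.
pose j0 : 'I_m * 'I_n := (i, Ordinal n0).
have w0 y : 0 <= cell_weight M theta y := cell_weight_ge0 mg g_cos M theta y j0.
have weta y : cell_weight M theta y <= 2 / (1 - expR (- (2 * theta ^+ 2))) / N%:R.
  by apply: cell_weight_le; rewrite gt_eqF.
apply/andP; split; first by apply: sumr_ge0 => f _; exact: prodr_ge0.
apply: le_trans (near_records_weight N a w0 weta (b i) N) _.
rewrite (sum_cell_weight mg g_cos M theta j0).
apply: ler_wpM2r; first by apply: prodr_ge0 => j _; rewrite invr_ge0.
apply: exprDn_le2 => //.
have := weta 0%N; move: (w0 0%N) => w00 w01.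
by do 2![apply: mulr_ge0 => //]; exact: le_trans w00 w01.
Qed.

(** Markov's inequality for [Phi], which is at least 1 on [Q] and has a factorizing expectation. The
    4 is the doubling in [Phi] times the 2 of [record_weight_le]. *)
Lemma records_probability (Q : set T) : measurable Q ->
  (forall w, Q w -> forall i, (forall j, ~~ b i j) \/
    ((forall j, `|theta * g (i, j) w| <= pi / 4) /\
     (forall j j' : 'I_n, b i j -> (j < j')%N -> g (i, j') w <= g (i, j) w + h))) ->
  (P Q <= (4 ^+ m * \prod_i \prod_(j | b i j) (n - j)%:R^-1)%:E)%E.
Proof.
move=> mQ Qrec.
pose Phi w : R := \prod_i (2 * record_cells M a theta (b i) (fun j => g (i, j) w)).
have bPhi1 i : bounded_rv (fun w => record_cells M a theta (b i) (fun j => g (i, j) w)).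
  rewrite [X in bounded_rv X](_ : _ = fun w => \sum_(f : {ffun 'I_n -> 'I_N})
      (if near_records a (b i) N f then \prod_j soft_cell M theta (f j) (g (i, j) w) else 0)).
    apply: bounded_rv_sum => f; case: (near_records _ _ _ f); last exact: bounded_rv_cst.
    by apply: bounded_rv_prod => j; exact: bounded_rv_soft_cell.
  by apply/funext => w; rewrite /record_cells big_mkcond.
have bPhi : bounded_rv Phi.
  by apply: bounded_rv_prod => i; apply: bounded_rvM; [exact: bounded_rv_cst|exact: bPhi1].
have rc0 i w : 0 <= record_cells M a theta (b i) (fun j => g (i, j) w).
  by apply: sumr_ge0 => f _; apply: prodr_ge0 => j _; exact: soft_cell_ge0.
have Phi0 w : 0 <= Phi w by apply: prodr_ge0 => i _; rewrite mulr_ge0.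
have PhiQ w : Q w -> 1 <= Phi w.
  move=> Qw; rewrite (_ : 1 = \prod_(i < m) 1 :> R); last by rewrite big1.
  apply: ler_prod => i _; rewrite ler01 /=.
  have := record_cells_ge theta0 kappa0 mass slack (Qrec w Qw i); lra.
have intPhi : \int[P]_w Phi w = 2 ^+ m * \prod_i W i.
  pose r i (f : {ffun 'I_n -> 'I_N}) : R := (near_records a (b i) N f)%:R.
  have WE i : W i = \sum_(f : {ffun 'I_n -> 'I_N}) r i f * \prod_j cell_weight M theta (f j).
    rewrite big_mkcond; apply: eq_bigr => f _; rewrite /r.
    by case: ifP => _; rewrite ?mul1r ?mul0r.
  under eq_bigr do rewrite WE; rewrite bigA_distr_bigA /=.
  transitivity (\int[P]_w (2 ^+ m * \sum_(f : {ffun 'I_m -> {ffun 'I_n -> 'I_N}})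
      (\prod_i r i (f i)) * \prod_p soft_cell M theta (f p.1 p.2) (g p w))).
    apply: eq_Rintegral => w _; rewrite /Phi big_split /= prodr_const card_ord; congr (_ * _).
    transitivity (\prod_i \sum_(f : {ffun 'I_n -> 'I_N}) r i f *
        \prod_j soft_cell M theta (f j) (g (i, j) w)).
      apply: eq_bigr => i _; rewrite /record_cells big_mkcond; apply: eq_bigr => f _.
      by rewrite /r; case: ifP => _; rewrite ?mul1r ?mul0r.
    rewrite bigA_distr_bigA /=; apply: eq_bigr => f _; rewrite big_split /=; congr (_ * _).
    by rewrite pair_big /=; apply: eq_bigr => -[].
  have bprod (f : {ffun 'I_m -> {ffun 'I_n -> 'I_N}}) :
      bounded_rv (fun w => \prod_p soft_cell M theta (f p.1 p.2) (g p w)).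
    by apply: bounded_rv_prod => p; exact: bounded_rv_soft_cell.
  have bterm (f : {ffun 'I_m -> {ffun 'I_n -> 'I_N}}) : bounded_rv (fun w =>
      (\prod_i r i (f i)) * \prod_p soft_cell M theta (f p.1 p.2) (g p w)).
    by apply: bounded_rvM => //; exact: bounded_rv_cst.
  rewrite RintegralMl; last exact: bounded_rv_sum.
  rewrite Rintegral_sum //; congr (_ * _); apply: eq_bigr => f _.
  rewrite RintegralMl // big_split /=; congr (_ * _).
  rewrite (integral_soft_cell_prod mg g_cos M theta (fun p => f p.1 p.2)).
  by rewrite [RHS]pair_big.
apply: (@le_trans _ _ (\int[P]_w (Phi w)%:E)%E).
  rewrite -[X in P X]setIT -integral_indic //.
  apply: ge0_le_integral => //.
  - by apply/measurable_EFinP; exact: measurable_indic.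
  - by apply/measurable_EFinP; exact: bPhi.1.
  - move=> w _; rewrite lee_fin indicE.
    by case: (boolP (w \in _)) => [/set_mem /PhiQ|_].
rewrite -[leLHS]fineK; last exact/integrable_fin_num/bounded_rv_integrable.
rewrite -/(Rintegral P setT Phi) intPhi lee_fin.
apply: (@le_trans _ _ (2 ^+ m * \prod_(i < m) (2 * \prod_(j | b i j) (n - j)%:R^-1))).
  rewrite ler_wpM2l ?exprn_ge0 //; apply: ler_prod => i _; exact: record_weight_le.
rewrite big_split /= prodr_const card_ord mulrA -exprMn.
by rewrite (_ : 2 * 2 = 4) //; ring.
Qed.

End RecordsProbability.

(** * Small slopes *)

Section RowGroups.
Variables (k : nat) (s : seq (int * int)).
Hypothesis k0 : (0 < k)%N.
Hypothesis us : uniq s.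
Local Notation n := (k + k)%N.

(** The grid with offset [o] has segments starting at the multiples of [n] minus [o]: [pos] is the
    position of a site in its segment, [lead] the left end of that segment. *)
Let pos (o : nat) (u : int * int) : int := ((u.1 + o%:Z) %% n%:Z)%Z.
Let lead (o : nat) (u : int * int) : int * int :=
  (((u.1 + o%:Z) %/ n%:Z)%Z * n%:Z - o%:Z, u.2).
Let kept (o : nat) := [seq u <- s | pos o u < k%:Z].

Let pos_lt o u : 0 <= pos o u < n%:Z.
Proof. by rewrite modz_ge0 ?ltz_pmod //; lia. Qed.

Let leadK o u : u = hshift (lead o u) `|pos o u|%N.
Proof.
have /andP[p0 _] := pos_lt o u.
have := divz_eq (u.1 + o%:Z) n%:Z; rewrite -/(pos o u) => e.
rewrite /hshift /lead /= gez0_abs // [LHS]surjective_pairing; congr (_, _).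
by move: e; lia.
Qed.

Let kept_offset : exists2 o, (o = 0 \/ o = k)%N & (size s <= 2 * size (kept o))%N.
Proof.
have h : (size s <= size (kept 0) + size (kept k))%N.
  rewrite !size_filter.
  rewrite -(count_predC (fun u => pos 0 u < k%:Z) s) leq_add2l.
  apply: sub_count => u /=; rewrite -leNgt => h.
  have /andP[_ pn] := pos_lt 0 u.
  have /andP[p0 p2] := pos_lt k u.
  have e0 := divz_eq (u.1 + 0%N%:Z) n%:Z.
  have ek := divz_eq (u.1 + k%:Z) n%:Z.
  rewrite -/(pos 0 u) in e0; rewrite -/(pos k u) in ek.
  move: h pn p0 p2 e0 ek; set a := (_ %/ _)%Z; set b := ((u.1 + k%:Z) %/ _)%Z.
  move: (pos 0 u) (pos k u) (u.1) => x y z.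
  have [ab|[ab|ab]] : b <= a \/ (b = a + 1 \/ a + 2 <= b) by lia.
  - move=> *; have : b * n%:Z <= a * n%:Z by rewrite ler_wpM2r.
    by lia.
  - by rewrite ab mulrDl mul1r; lia.
  - move=> *; have : (a + 2) * n%:Z <= b * n%:Z by rewrite ler_wpM2r.
    by rewrite mulrDl; lia.
have [h1|h1] := leqP (size (kept k)) (size (kept 0)).
- by exists 0%N; [left|lia].
- by exists k; [right|lia].
Qed.

(* Two grids of length-[2 k] row segments, one the translate of the other by
   [k], have complementary first halves; we keep the better one. *)
Lemma row_groups : exists m (base : 'I_m -> int * int) (A : 'I_m -> {set 'I_n}),
  [/\ injective (fun p : 'I_m * 'I_n => hshift (base p.1) p.2),
      forall i, (0 < #|A i|)%N,
      forall i j, j \in A i -> (j < k)%N /\ hshift (base i) j \in s &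
      (size s <= 2 * \sum_i #|A i|)%N].
Proof.
case: kept_offset => o _ so.
pose B := undup [seq lead o u | u <- kept o].
have uB : uniq B by exact: undup_uniq.
pose base (i : 'I_(size B)) := tnth (in_tuple B) i.
have baseP i : exists2 u, u \in kept o & base i = lead o u.
  have : base i \in B by exact: mem_tnth.
  by rewrite mem_undup => /mapP[u us' e]; exists u.
have n0 : n%:Z != 0 by lia.
have pos_val u (us' : u \in kept o) : (`|pos o u| < k)%N.
  have /andP[p0 _] := pos_lt o u.
  by move: us'; rewrite mem_filter => /andP[+ _]; lia.
pose A (i : 'I_(size B)) := finset (fun j : 'I_n => (j < k)%N && (hshift (base i) j \in s)) : {set 'I_n}.
exists (size B), base, A; split.
- move=> [i j] [i' j'] /=; have [u _ bu] := baseP i; have [u' _ bu'] := baseP i'.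
  have base_inj : injective base by exact: (elimT (tuple_uniqP (in_tuple B)) uB).
  move=> e; have e2 : (base i).2 = (base i').2 by case: e.
  have : (base i).1 + j%:Z = (base i').1 + j'%:Z by case: e.
  have ij := ltn_ord j; have ij' := ltn_ord j'.
  have b1 : (base i).1 = ((u.1 + o%:Z) %/ n%:Z)%Z * n%:Z - o%:Z by rewrite bu.
  have b1' : (base i').1 = ((u'.1 + o%:Z) %/ n%:Z)%Z * n%:Z - o%:Z by rewrite bu'.
  rewrite b1 b1' => e1.
  have [ab|ab|ab] := ltgtP ((u.1 + o%:Z) %/ n%:Z)%Z ((u'.1 + o%:Z) %/ n%:Z)%Z.
  + have : (((u.1 + o%:Z) %/ n%:Z)%Z + 1) * n%:Z <= ((u'.1 + o%:Z) %/ n%:Z)%Z * n%:Z.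
      by rewrite ler_wpM2r // lezD1.
    by rewrite mulrDl; lia.
  + have : (((u'.1 + o%:Z) %/ n%:Z)%Z + 1) * n%:Z <= ((u.1 + o%:Z) %/ n%:Z)%Z * n%:Z.
      by rewrite ler_wpM2r // lezD1.
    by rewrite mulrDl; lia.
  + have jj : j = j' by apply: val_inj => /=; move: e1; rewrite ab; lia.
    congr (_, _) => //; apply: base_inj.
    by rewrite [LHS]surjective_pairing [RHS]surjective_pairing e2 b1 b1' ab.
- move=> i; apply/card_gt0P; have [u us' bu] := baseP i.
  have pk := pos_val u us'.
  have pn : (`|pos o u| < n)%N by lia.
  exists (Ordinal pn); rewrite inE /= pk bu -leadK.
  by move: us'; rewrite mem_filter => /andP[].
- by move=> i j; rewrite inE => /andP[].
apply: leq_trans so _; rewrite leq_mul2l /=.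
pose pts := [seq hshift (base p.1) (nat_of_ord p.2) | p : 'I_(size B) * 'I_n <- enum [pred p : 'I_(size B) * 'I_n | p.2 \in A p.1]].
have -> : (\sum_i #|A i| = size pts)%N.
  rewrite size_map -cardE -sum1_card.
  under eq_bigr do rewrite -sum1_card.
  by rewrite pair_big_dep.
apply: uniq_leq_size; first exact: filter_uniq.
move=> u uk; apply/mapP.
have : lead o u \in B by rewrite mem_undup map_f.
move=> /(nthP (0, 0)) [i iB ei].
have pk := pos_val u uk.
have pn : (`|pos o u| < n)%N by lia.
have bi : base (Ordinal iB) = lead o u by rewrite /base (tnth_nth (0, 0)).
exists (Ordinal iB, Ordinal pn); last by rewrite /= bi -leadK.
rewrite mem_enum inE /= inE /= pk bi -leadK.
by move: uk; rewrite mem_filter => /andP[].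
Qed.

End RowGroups.

Lemma hshiftD u r r' : hshift (hshift u r) r' = hshift u (r + r').
Proof. by rewrite /hshift /= -addrA -PoszD. Qed.

Lemma measurable_ge d (T : measurableType d) (R : realType) (Z : T -> R) (a : R) :
  measurable_fun setT Z -> measurable [set w | (a <= Z w)%R].
Proof.
move=> mZ; rewrite (_ : [set w | _] = Z @^-1` `[a, +oo[%classic).
  by rewrite -[_ @^-1` _]setTI; exact: mZ.
by apply/seteqP; split=> w /=; rewrite in_itv /= andbT.
Qed.

Lemma measurable_exists_ge d (T : measurableType d) (R : realType) (C : finType)
    (Y : C -> T -> R) (a : R) :
  (forall c, measurable_fun setT (Y c)) -> measurable [set w | [exists c, (a <= Y c w)%R]].
Proof.
move=> mY; rewrite (_ : [set w | _] = \big[setU/set0]_c [set w | (a <= Y c w)%R]).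
  by apply: bigsetU_measurable => c _; exact: measurable_ge.
apply/seteqP; split=> w; rewrite -bigcup_seq /=.
  by move=> /existsP[c h]; exists c => //; rewrite /= mem_index_enum.
by move=> [c _ h]; apply/existsP; exists c.
Qed.

(** * Simultaneous deviations *)

Section UnionBound.
Context {R : realType} d {T : measurableType d} (P : probability T R).

(** A choice of one witness for each index makes the sum at least [r]; there are |C|^r choices. *)
Lemma union_selection (r : nat) (C : finType) (Y : 'I_r -> C -> T -> R) (z : R) :
  (forall a c, measurable_fun setT (Y a c)) ->
  (forall f : {ffun 'I_r -> C},
    (P [set w | (r%:R <= \sum_a Y a (f a) w)%R] <= (z ^+ r)%:E)%E) ->
  (P [set w | forall a, [exists c, (1 <= Y a c w)%R]] <= ((#|C|%:R * z) ^+ r)%:E)%E.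
Proof.
move=> mY Yz.
have mS (f : {ffun 'I_r -> C}) : measurable [set w | (r%:R <= \sum_a Y a (f a) w)%R].
  by apply: measurable_ge; exact: measurable_sum.
pose U : set T := \big[setU/set0]_(f : {ffun 'I_r -> C}) [set w | (r%:R <= \sum_a Y a (f a) w)%R].
apply: (@le_trans _ _ (P U)).
  apply: le_measure; rewrite ?inE.
  - apply: measurable_forall_fin => a.
    exact: measurable_exists_ge.
  - by apply: bigsetU_measurable => f _; exact: mS.
  - move=> w /= h; rewrite /U -bigcup_seq.
    have /choice[f fh] : forall a, exists c, 1 <= Y a c w by move=> a; exact/existsP.
    exists [ffun a => f a]; first by rewrite /= mem_index_enum.
    rewrite /= -[X in X%:R]card_ord -sumr_const; apply: ler_sum => a _.
    by rewrite ffunE.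
apply: le_trans (measure_big_setU_le _ _ _) _; first by move=> f _; exact: mS.
apply: (@le_trans _ _ (\sum_(f : {ffun 'I_r -> C}) (z ^+ r)%:E)%E); first by apply: lee_sum => f _; exact: Yz.
by rewrite sumEFin lee_fin sumr_const card_ffun card_ord exprMn -natrX mulr_natl.
Qed.

End UnionBound.

Section Deviations.
Context {R : realType} d {T : measurableType d} (P : probability T R).
Variables (J : finType) (g Y : J -> T -> R) (delta L h v0 : R).
Hypothesis mg : forall j, measurable_fun setT (g j).
Hypothesis mY : forall j, measurable_fun setT (Y j).
Hypothesis chernoff : forall (t1 t2 : J -> R) (V a : R),
  2 * (\sum_j t1 j ^+ 2) + 8%:R * delta ^+ 2 * (\sum_j t2 j ^+ 2) <= V ->
  0 < V -> 0 <= a ->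
  (P [set w | (a <= \sum_j (t1 j * g j w + t2 j * Y j w))%R] <=
   (expR (- (a ^+ 2 / (2 * V))))%:E)%E.
Hypothesis v00 : 0 < v0.
Hypothesis Lhv : 2 * L ^- 2 + 8%:R * delta ^+ 2 * h ^- 2 <= v0.

(** [c.1] selects between g / L and Y / h, and [c.2] is a sign: the four choices encode the two
    bounds on absolute values as one-sided inequalities. *)
Definition deviation (j : J) (c : bool * bool) (w : T) : R :=
  (if c.1 then (-1) ^+ c.2 / L else 0) * g j w + (if c.1 then 0 else (-1) ^+ c.2 / h) * Y j w.

Lemma measurable_deviation j c : measurable_fun setT (deviation j c).
Proof. by apply: measurable_funD; exact: measurable_funM. Qed.

Lemma deviation_lt1 j w : 0 < L -> 0 < h -> (forall c, deviation j c w < 1) ->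
  `|g j w| <= L /\ `|Y j w| <= h.
Proof.
move=> L0 h0 dev1; split; rewrite ler_norml; apply/andP; split.
- have := dev1 (true, true); rewrite /deviation /= mul0r addr0 expr1.
  by rewrite mulrAC ltr_pdivrMr // mulN1r mul1r; lra.
- have := dev1 (true, false); rewrite /deviation /= mul0r addr0 expr0.
  by rewrite mulrAC ltr_pdivrMr // !mul1r; lra.
- have := dev1 (false, true); rewrite /deviation /= mul0r add0r expr1.
  by rewrite mulrAC ltr_pdivrMr // mulN1r mul1r; lra.
- have := dev1 (false, false); rewrite /deviation /= mul0r add0r expr0.
  by rewrite mulrAC ltr_pdivrMr // !mul1r; lra.
Qed.

Let sum_delta (r : nat) (p : 'I_r -> J) (x : 'I_r -> R) (y : J -> R) :
  \sum_j (\sum_a (if j == p a then x a else 0)) * y j = \sum_a x a * y (p a).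
Proof.
under eq_bigr do rewrite mulr_suml.
rewrite exchange_big /=; apply: eq_bigr => a _.
by rewrite (bigD1 (p a)) //= eqxx big1 ?addr0 // => j /negbTE ->; rewrite mul0r.
Qed.

Let sum_delta_sqr (r : nat) (p : 'I_r -> J) (x : 'I_r -> R) : injective p ->
  \sum_j (\sum_a (if j == p a then x a else 0)) ^+ 2 = \sum_a x a ^+ 2.
Proof.
move=> pinj; under eq_bigr do rewrite expr2.
rewrite sum_delta; apply: eq_bigr => a _; rewrite (bigD1 a) //= eqxx big1 ?addr0 ?expr2 //.
by move=> b /negbTE ba; rewrite ifN // (inj_eq pinj) eq_sym ba.
Qed.

(** The selected indices being distinct, a sum of [r] deviations has variance at most r v0; Chernoff
    at level [r] then gives an r-th power. *)
Lemma prob_deviations (r : nat) (C : finType) (p : 'I_r -> C -> J) (c : C -> bool * bool) :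
  (forall f : {ffun 'I_r -> C}, injective (fun a => p a (f a))) ->
  (P [set w | forall a, [exists x, (1 <= deviation (p a x) (c x) w)%R]] <=
   ((#|C|%:R * expR (- (2 * v0)^-1)) ^+ r)%:E)%E.
Proof.
move=> pinj; apply: union_selection => [a x|f]; first exact: measurable_deviation.
have [r0|r0] := posnP r; first by rewrite [X in _ ^+ X]r0 expr0 probability_le1 //; apply: measurable_ge;
  apply: measurable_sum => a; exact: measurable_deviation.
pose x a : R := if (c (f a)).1 then (-1) ^+ (c (f a)).2 / L else 0.
pose y a : R := if (c (f a)).1 then 0 else (-1) ^+ (c (f a)).2 / h.
have sq (b : bool) (u : R) : ((-1) ^+ b / u) ^+ 2 = u ^- 2.
  by rewrite exprMn sqrr_sign mul1r exprVn.
have r0' : (0 : R) < r%:R by rewrite ltr0n.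
have := @chernoff (fun j => \sum_a (if j == p a (f a) then x a else 0))
  (fun j => \sum_a (if j == p a (f a) then y a else 0)) (r%:R * v0) r%:R.
rewrite !sum_delta_sqr //.
have -> : [set w | (r%:R <= \sum_j ((\sum_a (if j == p a (f a) then x a else 0)) * g j w +
    (\sum_a (if j == p a (f a) then y a else 0)) * Y j w))%R] =
    [set w | (r%:R <= \sum_a deviation (p a (f a)) (c (f a)) w)%R].
  by apply/seteqP; split=> w /=; rewrite !big_split /= !sum_delta.
have -> : expR (- (r%:R ^+ 2 / (2 * (r%:R * v0)))) = expR (- (2 * v0)^-1) ^+ r.
  by rewrite -expRM_natl; congr expR; field; rewrite !gt_eqF.
apply => //; last exact: mulr_gt0.
rewrite !mulr_sumr -big_split /= -[X in _ <= X%:R * _](card_ord r) -sumr_const mulr_suml.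
apply: ler_sum => a _; rewrite mul1r /x /y.
have := sqr_ge0 (h^-1); have := sqr_ge0 L^-1; rewrite !exprVn => hL hh.
have hd : 0 <= 8%:R * delta ^+ 2 * h ^- 2 by rewrite mulr_ge0 // mulr_ge0 // sqr_ge0.
have lv := Lhv; case: ifP => _; rewrite ?sq expr0n /= ?mulr0 ?addr0 ?add0r; lra.
Qed.

End Deviations.

Section SmallSlopes.
Context {R : realType} d {T : measurableType d} (P : probability T R).
Variables (X : int * int -> T -> R) (c : int * int -> int * int -> R) (delta : R).
Hypothesis XG : gaussian_field P X c.
Hypothesis csym : forall u v, c u v = c v u.
Hypothesis c1 : forall u, c u u = 1.
Hypothesis cdelta : forall (F : seq (int * int)) u, uniq F -> u \notin F ->
  \sum_(v <- F) `|c u v| <= delta.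
Hypothesis delta0 : 0 <= delta.
Hypothesis delta10 : delta <= 10%:R^-1.

Definition small_slope (n : nat) (l : R) (w : T) : set (int * int) :=
  [set u | forall r : 'I_n, X (hshift u r.+1) w - X u w <= l * r.+1%:R].

Let mX u : measurable_fun setT (X u) := gaussian_field_measurable XG u.

Lemma measurable_small_slope n l u : measurable [set w | small_slope n l w u].
Proof.
apply: measurable_forall_fin => r.
rewrite [Z in measurable Z](_ : _ = [set w | (- (l * r.+1%:R) <= X u w - X (hshift u r.+1) w)%R]).
  by apply: measurable_ge; exact: measurable_funB.
by apply/seteqP; split=> w /= ?; lra.
Qed.

Variables (k M a : nat) (sigma v0 L kappa theta h l : R).
Local Notation n := (k + k)%N.
Local Notation N := M.+1.
Hypothesis k0 : (0 < k)%N.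
Hypothesis sigma0 : 0 <= sigma.
Hypothesis sigma_le : 8%:R * sigma <= 18%:R^-1 ^+ 2.
Hypothesis k_sigma : k%:R^-1 <= sigma ^+ 2.
Hypothesis v00 : 0 < v0.
Hypothesis zeta_sigma : (n * 4)%:R * expR (- (2 * v0)^-1) <= (sigma ^+ 2) ^+ k.
Hypothesis L0 : 0 < L.
Hypothesis h0 : 0 < h.
Hypothesis Lhv : 2 * L ^- 2 + 8%:R * delta ^+ 2 * h ^- 2 <= v0.
Hypothesis theta0 : 0 < theta.
Hypothesis thetaL : theta * L <= pi / 4.
Hypothesis kappa0 : 0 < kappa <= pi / 4.
Hypothesis mass : n%:R * (M.*2.+1%:R * cos kappa ^+ M.*2) <= 2^-1.
Hypothesis slack : N%:R * (2 * kappa + theta * (3%:R * h)) <= pi * a%:R.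
Hypothesis atoms : n%:R * (n%:R * (a.+1%:R *
  (2 / (1 - expR (- (2 * theta ^+ 2))) / N%:R))) <= 2^-1.
Hypothesis l0 : 0 <= l.
Hypothesis lh : l * n%:R <= h.

(** The event is split according to the set [D] of segments with a large deviation. Either the
    segments in [D] or the others hold half of the [t] selected sites, and in both cases the
    probability is at most (4 sigma)^t. *)
Lemma prob_small_slope (s : seq (int * int)) : uniq s ->
  (P [set w | forall u, u \in s -> small_slope n l w u] <= (18%:R^-1 ^+ size s)%:E)%E.
Proof.
move=> us; have [m [base [A [vinj Apos As sA]]]] := row_groups k0 us.
pose v (p : 'I_m * 'I_n) := hshift (base p.1) p.2.
have [g [mg g_cos chern]] := near_orthonormal XG csym c1 cdelta delta0 delta10 vinj.
pose Y (j : 'I_m * 'I_n) w := X (v j) w - g j w.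
have mY j : measurable_fun setT (Y j) by exact: measurable_funB.
pose C : finType := ('I_n * (bool * bool))%type.
pose dev i (x : C) w := deviation g Y L h (i, x.1) x.2 w.
have mdev i x : measurable_fun setT (dev i x) by exact: measurable_deviation.
pose bad i w := [exists x, (1 <= dev i x w)%R].
have mbad i : measurable [set w | bad i w] by exact: measurable_exists_ge.
pose Q (D : {set 'I_m}) : set T := [set w |
  (forall i, if i \in D then bad i w else ~~ bad i w) /\
  (forall p : 'I_m * 'I_n, p.1 \notin D -> p.2 \in A p.1 -> small_slope n l w (v p))].
have mQ D : measurable (Q D).
  apply: measurableI; [apply: measurable_forall_fin => i|apply: measurable_forall_fin => p].
    case: (i \in D); first exact: mbad.
    rewrite [Z in measurable Z](_ : _ = ~` [set w | bad i w]); first exact: measurableC.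
    by apply/seteqP; split=> w hw; [exact: (elimN idP hw)|exact: (introN idP hw)].
  case: (boolP (p.1 \notin D)) => [pD|_]; last first.
    by rewrite [Z in measurable Z](_ : _ = setT) //; apply/seteqP; split=> w.
  case: (boolP (p.2 \in A p.1)) => [pA|_]; last first.
    by rewrite [Z in measurable Z](_ : _ = setT) //; apply/seteqP; split=> w.
  rewrite [Z in measurable Z](_ : _ = [set w | small_slope n l w (v p)]).
    exact: measurable_small_slope.
  by apply/seteqP; split=> w /= hh; [exact: hh|move=> _ _].
have z0 : 0 <= sigma ^+ 2 by exact: sqr_ge0.
have sigma1 : sigma <= 1 by move: sigma_le; lra.
have z1 : sigma ^+ 2 <= 1 by rewrite expr_le1.
have Ak i : (#|A i| <= k)%N.
  rewrite cardE -(size_map (fun j : 'I_n => nat_of_ord j)) -[leqRHS](size_iota 0).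
  apply: uniq_leq_size; first by rewrite map_inj_uniq ?enum_uniq //; exact: val_inj.
  by move=> j /mapP[j']; rewrite mem_enum => /As[jk _] ->; rewrite mem_iota.
pose t := (\sum_i #|A i|)%N.
have mt : (m <= t)%N.
  by rewrite -[leqLHS]card_ord -sum1_card; apply: leq_sum => i _; exact: Apos.
(* Only the deviations are used here: each bad segment costs sigma^(2k) and holds at most [k]
   selected sites. *)
have badD D : (P (Q D) <= ((sigma ^+ 2) ^+ (\sum_(i in D) #|A i|))%:E)%E.
  apply: (@le_trans _ _ (P [set w | forall b : 'I_#|D|,
      [exists x, (1 <= dev (enum_val b) x w)%R]])).
    apply: le_measure; rewrite ?inE //.
      by apply: measurable_forall_fin => b; exact: mbad.
    by move=> w [hw _] b; have := hw (enum_val b); rewrite enum_valP.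
  apply: le_trans (@prob_deviations _ _ _ P _ g Y delta L h v0 mg mY chern v00 Lhv
    #|D| C (fun b x => (enum_val b, x.1)) (fun x => x.2) _) _.
    by move=> f b b' [/enum_val_inj].
  rewrite lee_fin card_prod card_prod card_bool card_ord.
  apply: (@le_trans _ _ (((sigma ^+ 2) ^+ k) ^+ #|D|)).
    by apply: lerXn2r; rewrite ?nnegrE ?mulr_ge0 ?expR_ge0 ?exprn_ge0.
  rewrite -exprM; apply: ler_wiXn2l => //.
  by rewrite mulnC -sum_nat_const; apply: leq_sum => i _.
(* Only the records outside [D] are used here: each selected site has j < k, hence costs 1 / (n -
   j), at most 1/k and so at most sigma^2. *)
have recD D : (P (Q D) <= (4 ^+ m * (sigma ^+ 2) ^+ (\sum_(i | i \notin D) #|A i|))%:E)%E.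
  pose b i j := (i \notin D) && (j \in A i).
  apply: le_trans (records_probability mg g_cos theta0 kappa0 mass slack atoms
    (b := b) (mQ D) _) _.
    move=> w [hbad hrec] i; have := hbad i; case: ifPn => iD.
      by move=> _; left=> j; rewrite /b iD.
    move=> /existsPn good; right.
    have gYh j : `|g (i, j) w| <= L /\ `|Y (i, j) w| <= h.
      by apply: deviation_lt1 => // x; rewrite ltNge; exact: (good (j, x)).
    have gL j := (gYh j).1; have Yh j := (gYh j).2.
    split=> [j|j j' /andP[_ jA] jj'].
      rewrite normrM (gtr0_norm theta0); apply: le_trans thetaL.
      by rewrite ler_pM2l.
    (* In [small_slope] the displacement r + 1 has index r. *)
    have rn' : ((j' - j).-1 < n)%N
      by exact: leq_ltn_trans (leq_trans (leq_pred _) (leq_subr _ _)) (ltn_ord j').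
    have := hrec (i, j) iD jA (Ordinal rn') => /=.
    rewrite prednK ?subn_gt0 // => hX.
    have eX : hshift (v (i, j)) (j' - j) = v (i, j').
      by rewrite /v hshiftD subnKC // ltnW.
    rewrite eX in hX.
    have lr : l * (j' - j)%:R <= h.
      apply: le_trans lh; rewrite ler_wpM2l // ler_nat.
      exact: leq_trans (leq_subr _ _) (ltnW (ltn_ord j')).
    (* The bound 3 h: one [h] from the slope, as l n is at most [h], and one from each of the two
       errors. *)
    have := Yh j; have := Yh j'; rewrite /Y !ler_norml => /andP[? ?] /andP[? ?].
    by lra.
  rewrite lee_fin ler_wpM2l ?exprn_ge0 //.
  rewrite -[leRHS]prodrXr big_mkcond /=.
  rewrite [leRHS]big_mkcond; apply: ler_prod => i _; apply/andP; split.
    by apply: prodr_ge0 => j _; rewrite invr_ge0.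
  rewrite /b; case: ifPn => iD /=; last by rewrite big_pred0.
  rewrite -prodr_const; apply: ler_prod => j /As[jk _].
  rewrite invr_ge0 ler0n /=; apply: le_trans k_sigma.
  by rewrite lef_pV2 ?posrE ?ltr0n ?ler_nat //; clear -k0 jk; lia.
have allD D : (P (Q D) <= ((4 * sigma) ^+ t)%:E)%E.
  have st : t = (\sum_(i in D) #|A i| + \sum_(i | i \notin D) #|A i|)%N.
    by rewrite /t (bigID (fun i => i \in D)).
  rewrite exprMn.
  have [ht|ht] := leqP t (2 * \sum_(i in D) #|A i|).
    apply: le_trans (badD D) _; rewrite lee_fin -exprM.
    apply: (@le_trans _ _ (sigma ^+ t)); first exact: ler_wiXn2l.
    by rewrite ler_peMl ?exprn_ge0 // exprn_ege1 //; lra.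
  apply: le_trans (recD D) _; rewrite lee_fin -exprM ler_pM ?exprn_ge0 //.
    by rewrite ler_weXn2l //; lra.
  by apply: ler_wiXn2l => //; clear -st ht; lia.
pose U : set T := \big[setU/set0]_(D : {set 'I_m}) Q D.
apply: (@le_trans _ _ (P U)).
  apply: le_measure; rewrite ?inE.
  - rewrite [Z in measurable Z](_ : _ = [set w | forall i, small_slope n l w (tnth (in_tuple s) i)]).
      by apply: measurable_forall_fin => i; exact: measurable_small_slope.
    apply/seteqP; split=> w hw; first by move=> i; apply: hw; exact: mem_tnth.
    by move=> u us'; have /tnthP[i ->] : u \in in_tuple s by []; exact: hw.
  - by apply: bigsetU_measurable => D _; exact: mQ.
  - move=> w hw; rewrite /U -bigcup_seq; exists (finset (fun i => bad i w)).
      by rewrite /= mem_index_enum.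
    split=> [i|p _ pA]; first by rewrite inE; case: (boolP (bad i w)).
    by apply: hw; exact: (As _ _ pA).2.
apply: le_trans (measure_big_setU_le _ _ _) _; first by move=> D _; exact: mQ.
apply: (@le_trans _ _ (\sum_(D : {set 'I_m}) ((4 * sigma) ^+ t)%:E)%E).
  by apply: lee_sum => D _; exact: allD.
have cS : #|{set 'I_m}| = (2 ^ m)%N.
  by rewrite -cardsT -powersetT card_powerset cardsT card_ord.
rewrite sumEFin lee_fin sumr_const cS -[_ *+ (2 ^ m)]mulr_natl natrX.
(* There are 2^m sets [D] with m at most [t]. Since 8 sigma is at most 18^-2, the loss of half of
   the sites in [sA] is compensated. *)
apply: (@le_trans _ _ ((8%:R * sigma) ^+ t)).
  rewrite (_ : 8%:R * sigma = 2 * (4 * sigma)); last by ring.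
  rewrite [leRHS]exprMn ler_wpM2r ?exprn_ge0 ?mulr_ge0 //.
  by rewrite ler_weXn2l //; lra.
apply: (@le_trans _ _ ((18%:R^-1 ^+ 2) ^+ t)).
  by apply: lerXn2r; rewrite ?nnegrE ?mulr_ge0 // exprn_ge0.
rewrite -exprM; apply: ler_wiXn2l => //.
by rewrite invf_le1 // ler1n.
Qed.

End SmallSlopes.

(** * Choice of the constants *)

Lemma exists_nat_gt (R : realType) (x : R) : exists n : nat, x < n%:R.
Proof.
exists (Num.Def.archi_bound `|x|); apply: le_lt_trans (ler_norm x) _.
by apply: archi_boundP.
Qed.

(** Squaring M x^M (1 - x) <= 1, which compares x^M with the terms of a geometric sum. *)
Lemma odd_mul_expr_le (R : realFieldType) (x : R) M : 0 <= x < 1 -> (0 < M)%N ->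
  M.*2.+1%:R * x ^+ M.*2 <= 3%:R / (M%:R * (1 - x) ^+ 2).
Proof.
move=> /andP[x0 x1] M0.
have M0' : (0 : R) < M%:R by rewrite ltr0n.
have xM : 0 <= x ^+ M by exact: exprn_ge0.
have h : M%:R * x ^+ M * (1 - x) <= 1.
  have : M%:R * x ^+ M <= \sum_(i < M) x ^+ i.
    rewrite -[X in X%:R * _](card_ord M) -sumr_const mulr_suml; apply: ler_sum => i _.
    by rewrite mul1r; apply: ler_wiXn2l; rewrite ?x0 ?(ltW x1) ?(ltnW (ltn_ord i)).
  have x1' : 0 <= 1 - x by rewrite subr_ge0 ltW.
  move=> /(ler_wpM2r x1') /le_trans; apply.
  have := subrX1 x M; lra.
have x1' : 0 < 1 - x by rewrite subr_gt0.
rewrite ler_pdivlMr ?mulr_gt0 ?exprn_gt0 // -addnn exprD.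
have -> : (M + M).+1%:R = 2 * M%:R + 1 :> R by rewrite -natr1 natrD; ring.
have M1 : (1 : R) <= M%:R by rewrite ler1n.
set y := x ^+ M in xM h *; set m := M%:R in M0' M1 h *; set z := 1 - x in h x1' *.
have y0 : 0 <= m * y * z by rewrite !mulr_ge0 // ltW.
have : (m * y * z) ^+ 2 <= 1 by rewrite expr_le1.
have -> : (2 * m + 1) * (y * y) * (m * z ^+ 2) = (2 + m^-1) * (m * y * z) ^+ 2.
  by field; rewrite gt_eqF.
have : m^-1 <= 1 by rewrite invf_le1.
have m0 : 0 <= m^-1 by rewrite invr_ge0 ltW.
have := sqr_ge0 (m * y * z); nra.
Qed.

(** The order of the choices avoids circularity: [k] and the variance level [v0], then [L] and
    [theta], the tolerance [eps], the widths [kappa] and [h], the number of cells, and finally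
    [delta]. The slack [a] grows with the number N of cells, but only the ratio (a + 1) / N
    matters. *)
Lemma small_slope_constants (R : realType) : exists (delta l : R) (n : nat),
  [/\ 0 < delta, 0 < l &
  forall d (T : measurableType d) (P : probability T R) (X : int * int -> T -> R)
    (c : int * int -> int * int -> R),
  gaussian_field P X c -> (forall u v, c u v = c v u) -> (forall u, c u u = 1) ->
  (forall (F : seq (int * int)) u, uniq F -> u \notin F -> \sum_(v <- F) `|c u v| <= delta) ->
  forall s : seq (int * int), uniq s ->
  (P [set w | forall u, u \in s -> small_slope X n l w u] <= (18%:R^-1 ^+ size s)%:E)%E].
Proof.
pose sigma : R := 8%:R^-1 * 18%:R^-1 ^+ 2.
have sigma0 : 0 < sigma by rewrite mulr_gt0 // exprn_gt0.
have s2 : 0 < sigma ^+ 2 by rewrite exprn_gt0.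
have sigma1 : sigma ^+ 2 <= 1.
  by rewrite expr_le1 ?ltW // /sigma; lra.
have [k kP] := exists_nat_gt (sigma ^- 2).
have k0 : (0 < k)%N by rewrite -(ltr0n R); apply: lt_trans kP; rewrite invr_gt0.
have k_sigma : k%:R^-1 <= sigma ^+ 2.
  by rewrite -[leRHS]invrK lef_pV2 ?posrE ?invr_gt0 ?ltr0n // ltW.
pose n := (k + k)%N.
have n0 : (0 : R) < n%:R by rewrite ltr0n /n addn_gt0 k0.
have n1 : (1 : R) <= n%:R by rewrite ler1n /n addn_gt0 k0.
(* exp(-1/y) is at most y, as exp(1/y) is at least 1/y; with 2 v0 = y this controls the 4n
   deviations of a segment. *)
pose y : R := (sigma ^+ 2) ^+ k / (n * 4)%:R.
have n4 : (0 : R) < (n * 4)%:R by rewrite natrM mulr_gt0.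
have y0 : 0 < y by rewrite divr_gt0 // exprn_gt0.
have y1 : y <= 1.
  rewrite ler_pdivrMr // mul1r; apply: (@le_trans _ _ 1); first by rewrite exprn_ile1 // ltW.
  by rewrite natrM; move: n1; lra.
pose v0 := y / 2; have v00 : 0 < v0 by rewrite divr_gt0.
have zeta_sigma : (n * 4)%:R * expR (- (2 * v0)^-1) <= (sigma ^+ 2) ^+ k.
  rewrite (_ : 2 * v0 = y); last by rewrite /v0; field.
  rewrite mulrC -ler_pdivlMr // -/y expRN -[leRHS]invrK lef_pV2 ?posrE ?expR_gt0 ?invr_gt0 //.
  by apply: le_trans (expR_ge1Dx _); rewrite lerDr.
(* Large enough for 2 / L^2 to use at most half of [v0]; the other half is left for [delta]. *)
pose L := 8%:R / y; have L0 : 0 < L by rewrite divr_gt0.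
have L2 : 2 * L ^- 2 <= v0 / 2.
  have -> : L ^- 2 = y ^+ 2 / 64%:R by rewrite /L; field; rewrite gt_eqF.
  rewrite /v0.
  have : y ^+ 2 <= y by rewrite expr2 ler_piMl // ltW.
  move: (y ^+ 2) => y2; lra.
have pi0 : 0 < pi :> R := pi_gt0 R.
have pi2 : 2 <= pi :> R := pi_ge2 R.
pose theta := pi / (4 * L).
have theta0 : 0 < theta by rewrite divr_gt0 // mulr_gt0.
have thetaL : theta * L <= pi / 4.
  by rewrite /theta le_eqVlt; apply/orP; left; apply/eqP; field; rewrite gt_eqF.
pose q := 2 / (1 - expR (- (2 * theta ^+ 2))).
have q0 : 0 < q.
  rewrite divr_gt0 // subr_gt0 expR_lt1 oppr_lt0 mulr_gt0 //.
  by rewrite exprn_gt0.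
(* Solves 2 eps n^2 q = 1/2, which yields [atoms] once (a + 1) / N is at most 2 eps. *)
pose eps := (4 * n%:R ^+ 2 * q)^-1.
have n20 : (0 : R) < n%:R ^+ 2 by rewrite exprn_gt0.
have eps0 : 0 < eps by rewrite invr_gt0; do 2![apply: mulr_gt0 => //].
pose kappa := Num.min (2^-1) (eps / 2).
have kappa00 : 0 < kappa by rewrite lt_min; apply/andP; split; rewrite ?invr_gt0 ?divr_gt0.
have kappa_half : kappa <= 2^-1 by rewrite ge_min lexx.
have kappa_eps : kappa <= eps / 2 by rewrite ge_min lexx orbT.
have kappa0 : 0 < kappa <= pi / 4 by rewrite kappa00 /=; lra.
(* Makes theta * 3 h equal to pi eps / 2; as 2 kappa is at most eps and pi at least 2, the total is
   at most pi eps. *)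
pose h := 2 * L * eps / 3.
have h0 : 0 < h by apply: divr_gt0 => //; do 2![apply: mulr_gt0 => //].
have th : theta * (3 * h) = pi * eps / 2.
  by rewrite /theta /h; field; rewrite gt_eqF.
have cos0 : 0 <= cos kappa by rewrite cos_ge0_pihalf //; apply/andP; split; lra.
have cos1 : cos kappa < 1.
  have s0 : 0 < sin kappa by apply: sin_gt0_pi; apply/andP; split; lra.
  have s20 : 0 < sin kappa ^+ 2 by rewrite exprn_gt0.
  rewrite -(expr_lt1 (n := 2)) //; have := cos2Dsin2 kappa; lra.
pose e := 1 - cos kappa.
have e0 : 0 < e by rewrite subr_gt0.
(* The first term is for [mass]; the second gives eps N >= 2, which absorbs the rounding of [a] and
   the successor in a + 1. *)
have [M MP] := exists_nat_gt (6 * n%:R / e ^+ 2 + 2 / eps).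
have e20 : 0 < e ^+ 2 by rewrite exprn_gt0.
have t1 : 0 < 6 * n%:R / e ^+ 2 by rewrite divr_gt0 // mulr_gt0.
have t2 : 0 < 2 / eps by rewrite divr_gt0.
have M0 : (0 : R) < M%:R by lra.
have mass : n%:R * (M.*2.+1%:R * cos kappa ^+ M.*2) <= 2^-1.
  apply: (@le_trans _ _ (n%:R * (3%:R / (M%:R * e ^+ 2)))).
    rewrite ler_pM2l // odd_mul_expr_le ?cos0 //.
    by rewrite -(ltr0n R).
  have : 6 * n%:R / e ^+ 2 <= M%:R by lra.
  rewrite ler_pdivrMr // mulrA ler_pdivrMr ?mulr_gt0 //; lra.
have Me : 2 / M.+1%:R <= eps.
  rewrite ler_pdivrMr // mulrC -ler_pdivrMr // -natr1; lra.
pose N : R := M.+1%:R; have N0 : 0 < N by rewrite ltr0n.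
pose x := N * (2 * kappa + theta * (3 * h)) / pi.
pose a := (Num.truncn x).+1.
have x0 : 0 <= x.
  rewrite /x th; apply: divr_ge0; last exact: ltW.
  by apply: mulr_ge0; [exact: ltW|apply: addr_ge0; [lra|rewrite divr_ge0 // mulr_ge0 ?ltW]].
have /andP[a1 a2] : x <= a%:R <= x + 1.
  have /andP[h1 h2] := truncn_itv x0.
  by rewrite (ltW h2) /a -natr1 lerD2r h1.
have slack : N * (2 * kappa + theta * (3 * h)) <= pi * a%:R.
  by move: a1; rewrite ler_pdivrMr // [leRHS]mulrC.
have atoms : n%:R * (n%:R * (a.+1%:R *
    (2 / (1 - expR (- (2 * theta ^+ 2))) / N))) <= 2^-1.
  rewrite -/q.
  have xe : x <= eps * N.
    rewrite ler_pdivrMr // th.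
    have : 2 * kappa + pi * eps / 2 <= eps * pi.
      have : 0 <= (pi - 2) * eps by rewrite mulr_ge0 ?subr_ge0 // ltW.
      by lra.
    move=> /(ler_wpM2l (ltW N0)); lra.
  have aN : a.+1%:R <= 2 * eps * N.
    have : 2 <= eps * N by move: Me; rewrite ler_pdivrMr.
    by rewrite -natr1; lra.
  have -> : n%:R * (n%:R * (a.+1%:R * (q / N))) = (a.+1%:R / N) * (n%:R ^+ 2 * q).
    by field; rewrite gt_eqF.
  apply: (@le_trans _ _ (2 * eps * (n%:R ^+ 2 * q))).
    by apply: ler_wpM2r; [rewrite mulr_ge0 ?ltW|rewrite ler_pdivrMr].
  rewrite le_eqVlt; apply/orP; left; apply/eqP; rewrite /eps; field.
  by rewrite !gt_eqF.
pose delta := Num.min (10%:R^-1) (v0 * h ^+ 2 / 16).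
have delta0 : 0 < delta.
  by rewrite lt_min; apply/andP; split => //; rewrite divr_gt0 // mulr_gt0 // exprn_gt0.
have delta10 : delta <= 10%:R^-1 by rewrite ge_min lexx.
have delta_v : delta <= v0 * h ^+ 2 / 16 by rewrite ge_min lexx orbT.
have Lhv : 2 * L ^- 2 + 8%:R * delta ^+ 2 * h ^- 2 <= v0.
  have : 8%:R * delta ^+ 2 * h ^- 2 <= v0 / 2.
    rewrite ler_pdivrMr ?exprn_gt0 //.
    have : delta ^+ 2 <= delta by rewrite expr2 ler_piMl ?ltW //; move: delta10; lra.
    by move: (delta ^+ 2) => d2; lra.
  by move: L2; move: (2 * _) (8 * _ * _) => ? ?; lra.
exists delta, (h / n%:R), n; split=> //; first exact: divr_gt0.
move=> d T P X c XG csym c1 cdelta s us.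
apply: (@prob_small_slope R d T P X c delta XG csym c1 cdelta (ltW delta0) delta10
  k M a sigma v0 L kappa theta h) => //.
- exact: ltW.
- by rewrite /sigma mulrA mulfV // mul1r.
- by rewrite divr_ge0 // ltW.
- by rewrite divfK // gt_eqF.
Qed.

(** * Covariances of the convolution field *)

Section Decay.
Context {R : realType}.
Local Notation mu := (@lebesgue_measure R).

(** The exponent 5/4 is half of 5/2: it exceeds 1, hence integrability on the line, and the product
    over two coordinates dominates a multiple of the norm to the power -5/2 off the unit disc. *)
Definition decay (t : R) : R := (1 + `|t|) `^ (- (5 / 4)).

Lemma decay_gt0 t : 0 < decay t.
Proof. by apply: powR_gt0; rewrite ltr_wpDr. Qed.

Lemma continuous_powR_pos (a x : R) : 0 < x -> {for x, continuous (fun y : R => y `^ a)}.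
Proof.
move=> x0; apply/differentiable_continuous/derivable1_diffP.
by apply: derivable_powR; rewrite in_itv /= andbT.
Qed.

Lemma continuous_decay : continuous decay.
Proof.
move=> t; apply: (@continuous_comp R R R (fun s : R => 1 + `|s|) (fun y : R => y `^ (- (5 / 4)))).
  apply: continuousD; first exact: cvg_cst.
  exact: norm_continuous.
by apply: continuous_powR_pos; rewrite ltr_wpDr.
Qed.

Let F (x : R) : R := - 4 * (1 + x) `^ (- (1 / 4)).

Let is_derive_F (x : R) : - 1 < x -> is_derive x 1 F ((1 + x) `^ (- (5 / 4))).
Proof.
move=> x1; have x0 : 0 < 1 + x by rewrite addrC -ltrBlDr sub0r.
have D1 : is_derive x 1 (fun y : R => 1 + y) 1.
  by rewrite -[X in is_derive _ _ _ X]add0r; apply: is_deriveD.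
have D2 := @is_derive1_powR R (- (1 / 4)) (1 + x) x0.
have D3 := is_derive1_comp D2 D1.
have D4 := is_deriveZ (- 4 : R) D3.
apply: (is_derive_eq D4).
rewrite /GRing.scale /= (_ : - (1 / 4) - 1 = - (5 / 4) :> R); last by field.
by field.
Qed.

Let F_cvg0 : F x @[x --> +oo%R] --> (0 : R).
Proof.
rewrite -(mulr0 (- 4 : R)); apply: cvgM; first exact: cvg_cst.
apply/cvgrPdist_le => /= e e0; near=> x.
have x1 : 0 < 1 + x.
  by rewrite addr_gt0 //; near: x; exact: nbhs_pinfty_gt.
rewrite sub0r normrN ger0_norm ?powR_ge0 // powRN -[leRHS]invrK.
rewrite lef_pV2 ?posrE ?invr_gt0 ?powR_gt0 //.
have -> : e^-1 = ((e^-1) ^+ 4) `^ (1 / 4).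
  rewrite -powR_mulrn ?invr_ge0 ?(ltW e0) // -powRrM.
  by rewrite (_ : 4%:R * (1 / 4) = 1 :> R) ?powRr1 ?invr_ge0 ?(ltW e0) //; field.
rewrite ge0_ler_powR ?nnegrE ?exprn_ge0 ?invr_ge0 ?(ltW e0) ?(ltW x1) //.
apply: (@le_trans _ _ x); last by rewrite lerDr.
near: x; apply: nbhs_pinfty_ge; exact: num_real.
Unshelve. all: by end_near. Qed.

Lemma integral_decay_lty : (\int[mu]_x (decay x)%:E < +oo)%E.
Proof.
have half : (\int[mu]_(x in `[0%R, +oo[) (decay x)%:E = 0%:E - (F 0)%:E)%E.
  transitivity (\int[mu]_(x in `[0%R, +oo[) ((1 + x) `^ (- (5 / 4)))%:E)%E.
    by apply: eq_integral => x; rewrite inE /= in_itv /= andbT => x0; rewrite /decay ger0_norm.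
  apply: ge0_continuous_FTC2y => //.
  - by move=> x _; exact: powR_ge0.
  - apply/continuous_within_itvcyP; split=> [x|].
      rewrite in_itv /= andbT => x0.
      apply: (@continuous_comp R R R (fun s : R => 1 + s) (fun y : R => y `^ (- (5 / 4)))).
        by apply: continuousD; [exact: cvg_cst|exact: cvg_id].
      by apply: continuous_powR_pos; rewrite addr_gt0.
    apply: cvg_at_right_filter.
    apply: (@continuous_comp R R R (fun s : R => 1 + s) (fun y : R => y `^ (- (5 / 4)))).
      by apply: continuousD; [exact: cvg_cst|exact: cvg_id].
    by apply: continuous_powR_pos; rewrite addr0.
  - by move=> x x0; apply: ex_derive; apply: is_derive_F; lra.
  - apply: cvg_at_right_filter.
    apply/differentiable_continuous/derivable1_diffP/ex_derive.
    by apply: is_derive_F; lra.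
  - move=> x; rewrite in_itv /= andbT => x0; rewrite derive1E.
    by apply: derive_val; apply: is_derive_F; lra.
rewrite ge0_symfun_integralT.
- by rewrite -set_itvcy half -EFinB -EFinM ltry.
- by move=> x; exact/ltW/decay_gt0.
- exact: continuous_decay.
- by move=> x; rewrite /decay /= normrN.
Qed.

End Decay.

(** * Integrals and lattice sums in the plane *)

Section PlaneIntegral.
Context {R : realType}.
Local Notation mu := (@lebesgue_measure R).
Local Notation mR := (measurableTypeR R).
Local Notation mu2 := (@lebesgue2 R).

Lemma measurable_shift2 (a : R * R) :
  measurable_fun setT ((fun x => x + a) : mR * mR -> mR * mR).
Proof.
apply/measurable_fun_pairP; split => /=.
  by apply: measurable_funD => //; exact: measurable_fst.
by apply: measurable_funD => //; exact: measurable_snd.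
Qed.

Lemma ge0_integral_iterated (F : mR * mR -> \bar R) : measurable_fun setT F ->
  (forall x, 0 <= F x)%E ->
  (\int[mu2]_x F x = \int[mu]_x \int[mu]_y F (x, y))%E.
Proof. by move=> mF F0; rewrite /lebesgue2 /= fubini_tonelli1. Qed.

Lemma ge0_integral_shift2 (a : R * R) (F : mR * mR -> \bar R) : measurable_fun setT F ->
  (forall x, 0 <= F x)%E -> (\int[mu2]_x F (x + a)%R = \int[mu2]_x F x)%E.
Proof.
move=> mF F0.
rewrite !ge0_integral_iterated //; last exact: (measurableT_comp mF (measurable_shift2 a)).
rewrite -(@ge0_integral_shift R a.1 (fun x => \int[mu]_y F (x, y))%E).
- apply: eq_integral => x _.
  rewrite -(@ge0_integral_shift R a.2 (fun y => F (x + a.1, y)%R)) //.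
  by apply: measurableT_comp => //; exact: measurable_pair1.
- exact: measurable_fun_fubini_tonelli_F.
- by move=> x; apply: integral_ge0.
Qed.

Lemma integral_shift2 (a : R * R) (F : mR * mR -> \bar R) : measurable_fun setT F ->
  (\int[mu2]_x F (x + a)%R = \int[mu2]_x F x)%E.
Proof.
move=> mF; rewrite [LHS]integralE [RHS]integralE; congr (_ - _)%E.
  rewrite -(ge0_integral_shift2 a (measurable_funepos mF)); last exact: funepos_ge0.
  by apply: eq_integral => x _; rewrite !funeposE.
rewrite -(ge0_integral_shift2 a (measurable_funeneg mF)); last exact: funeneg_ge0.
by apply: eq_integral => x _; rewrite !funenegE.
Qed.

Definition decay2 (x : R * R) : R := decay x.1 * decay x.2.

Lemma decay2_gt0 x : 0 < decay2 x.
Proof. by rewrite mulr_gt0 // decay_gt0. Qed.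

Lemma measurable_decay : measurable_fun setT (decay : mR -> mR).
Proof. by apply: continuous_measurable_fun; exact: continuous_decay. Qed.

Lemma measurable_decay2 : measurable_fun setT (decay2 : mR * mR -> mR).
Proof.
apply: measurable_funM.
  exact: (measurableT_comp measurable_decay measurable_fst).
exact: (measurableT_comp measurable_decay measurable_snd).
Qed.

Lemma integral_decay2_lty : (\int[mu2]_x (decay2 x)%:E < +oo)%E.
Proof.
have d0 (t : R) : (0 <= (decay t)%:E)%E by rewrite lee_fin ltW // decay_gt0.
have md : measurable_fun setT (fun t : mR => (decay t)%:E).
  by apply/measurable_EFinP; exact: measurable_decay.
rewrite ge0_integral_iterated; last 2 first.
- by apply/measurable_EFinP; exact: measurable_decay2.
- by move=> x; rewrite lee_fin ltW // decay2_gt0.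
rewrite [X in (X < _)%E](_ : _ = \int[mu]_x ((decay x)%:E * \int[mu]_y (decay y)%:E))%E; last first.
  apply: eq_integral => x _; rewrite -ge0_integralZl //.
have f : (\int[mu]_y (decay y)%:E \is a fin_num)%E.
  by rewrite ge0_fin_numE ?integral_decay_lty // integral_ge0.
rewrite -(fineK f) ge0_integralZr //; last first.
  by rewrite lee_fin fine_ge0 // integral_ge0.
by rewrite -(fineK f) -EFinM ltry.
Qed.

Lemma decay_unit (s t : R) : `|s - t| <= 1 -> decay s <= 2 `^ (5 / 4) * decay t.
Proof.
move=> st.
have t0 : 0 < 1 + `|t| by rewrite ltr_wpDr.
have s0 : 0 < 1 + `|s| by rewrite ltr_wpDr.
rewrite /decay !powRN ler_pdivlMr ?powR_gt0 // mulrC ler_pdivrMr ?powR_gt0 //.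
rewrite -powRM ?(ltW s0) // ge0_ler_powR ?nnegrE ?mulr_ge0 ?(ltW s0) ?(ltW t0) //.
have : `|t| <= `|s| + 1.
  have -> : t = s - (s - t) by ring.
  by apply: le_trans (ler_normB _ _) _; rewrite lerD2l.
have := normr_ge0 s; lra.
Qed.

Definition lattice_point (v : int * int) : R * R := (v.1%:~R, v.2%:~R).

Definition unit_square (v : int * int) : set (mR * mR) :=
  `[v.1%:~R, (v.1 + 1)%:~R[%classic `*` `[v.2%:~R, (v.2 + 1)%:~R[%classic.

Lemma measurable_unit_square v : measurable (unit_square v).
Proof. by apply: measurableX. Qed.

Lemma lebesgue2_unit_square v : mu2 (unit_square v) = 1%E.
Proof.
rewrite /lebesgue2 /= product_measure1E //=.
rewrite !lebesgue_measure_itv /= !lte_fin !ltr_int !ltrDl ltr01 -!EFinB.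
by rewrite !intrD addrC addKr addrC addKr mule1.
Qed.

Lemma unit_square_floor v x : unit_square v x -> v = (Num.floor x.1, Num.floor x.2).
Proof.
move=> [/=]; rewrite !in_itv /= => /floor_def -> /floor_def ->.
by case: v.
Qed.

(** Comparison with an integral: on the unit square at [v], [decay2] shifted by [y] is comparable to
    its value at [v], and the squares are disjoint. Translation invariance makes the bound uniform
    in [y]. *)
Lemma lattice_sum_le : exists K : R, forall (F : seq (int * int)) (y : R * R), uniq F ->
  \sum_(v <- F) decay2 (lattice_point v - y) <= K.
Proof.
have d0 x : (0 <= (decay2 x)%:E)%E by rewrite lee_fin ltW // decay2_gt0.
have md : measurable_fun setT (fun x : mR * mR => (decay2 x)%:E).
  by apply/measurable_EFinP; exact: measurable_decay2.
pose I := fine (\int[mu2]_x (decay2 x)%:E).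
have IE : I%:E = (\int[mu2]_x (decay2 x)%:E)%E.
  by rewrite fineK // ge0_fin_numE ?integral_decay2_lty // integral_ge0.
pose k : R := (2 `^ (5 / 4)) ^+ 2.
have k0 : 0 <= k by exact: sqr_ge0.
exists (k * I) => F y uF; rewrite -lee_fin.
have -> : ((k * I)%:E = \int[mu2]_x (k * decay2 (x + - y))%:E)%E.
  under eq_integral do rewrite EFinM.
  rewrite ge0_integralZl //; last exact: (measurableT_comp md (measurable_shift2 (- y))).
  by rewrite (ge0_integral_shift2 (- y) md) // -IE.
have -> : ((\sum_(v <- F) decay2 (lattice_point v - y))%:E =
    \int[mu2]_x \sum_(v <- F) (decay2 (lattice_point v - y) * \1_(unit_square v) x)%:E)%E.
  rewrite ge0_integral_sum //; first last.
  - by move=> v x _; rewrite lee_fin mulr_ge0 // ltW // decay2_gt0.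
  - move=> v; apply/measurable_EFinP; apply: measurable_funM => //.
    exact: (measurable_indic (measurable_unit_square _)).
  rewrite -sumEFin; apply: eq_bigr => v _.
  under eq_integral do rewrite EFinM.
  rewrite ge0_integralZl //.
  - rewrite integral_indic //; last exact: measurable_unit_square.
    by rewrite setIT [X in (_ * X)%E]lebesgue2_unit_square mule1.
  - by apply/measurable_EFinP; exact: (measurable_indic (measurable_unit_square _)).
apply: ge0_le_integral => //.
- by move=> x _; apply: sume_ge0 => v _; rewrite lee_fin mulr_ge0 // ltW // decay2_gt0.
- apply: emeasurable_sum => v; apply/measurable_EFinP; apply: measurable_funM => //.
  exact: (measurable_indic (measurable_unit_square _)).
- apply/measurable_EFinP; apply: measurable_funM => //.
  exact: (measurableT_comp measurable_decay2 (measurable_shift2 (- y))).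
move=> x _; rewrite sumEFin lee_fin.
have rhs0 : 0 <= k * decay2 (x - y) by rewrite mulr_ge0 // ltW // decay2_gt0.
have [/hasP[v vF /asboolP vx]|/hasPn no] := boolP (has (fun v => `[< unit_square v x >]) F).
  rewrite (bigD1_seq v) //= big1 ?addr0; last first.
    move=> u uv; rewrite indicE memNset ?mulr0 // => ux.
    by move: uv; rewrite (unit_square_floor ux) (unit_square_floor vx) eqxx.
  rewrite indicE mem_set // mulr1 /decay2 /k expr2 mulrACA.
  move: vx => [/=]; rewrite !in_itv /= !intrD => /andP[a1 a2] /andP[b1 b2].
  apply: ler_pM; [exact/ltW/decay_gt0|exact/ltW/decay_gt0| |];
    by apply: decay_unit; rewrite ler_norml /=; apply/andP; split; lra.
rewrite big_seq big1 // => v vF; rewrite indicE memNset ?mulr0 // => vx.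
by have := no v vF; rewrite asboolT.
Qed.

End PlaneIntegral.

Section Integrals.
Context {R : realType} d {T : measurableType d} (P : {measure set T -> \bar R}).

Lemma Rintegral_sum_integrable (I : Type) (s : seq I) (f : I -> T -> R) :
  (forall i, P.-integrable setT (EFin \o f i)) ->
  P.-integrable setT (EFin \o (fun w => \sum_(i <- s) f i w)) /\
  \int[P]_w (\sum_(i <- s) f i w) = \sum_(i <- s) \int[P]_w f i w.
Proof.
move=> intf; elim: s => [|i s [IH1 IH2]].
  rewrite big_nil (_ : (fun w => _) = fun=> 0); last by apply/funext => w; rewrite big_nil.
  by split; [exact: integrable0|rewrite /Rintegral integral0].
rewrite (_ : (fun w => _) = fun w => f i w + \sum_(j <- s) f j w); last first.
  by apply/funext => w; rewrite big_cons.
split; first by exact: (@integrableD _ _ _ P setT measurableT (EFin \o f i)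
  (EFin \o (fun w => \sum_(j <- s) f j w))).
by rewrite RintegralD // IH2 big_cons.
Qed.

Lemma abse_fine_le (x : \bar R) : (`|fine x|%:E <= `|x|)%E.
Proof. by case: x => [r| |] //=; rewrite ?normr0 ?leey. Qed.

End Integrals.

(** * Moments and covariances of the field *)

Section GaussianMoments.
Context {R : realType} d {T : measurableType d} (P : probability T R).

Lemma gaussian_law_mean0 (Z : T -> R) s : gaussian_law P Z s -> \int[P]_w Z w = 0.
Proof.
move=> [mZ s0 lawZ]; have := gaussian_moment1_tilt mZ lawZ 0.
rewrite mul0r mul0r => <-; apply: eq_Rintegral => w _.
by rewrite mul0r expR0 mulr1.
Qed.

Lemma gaussian_law_integrable (Z : T -> R) s : gaussian_law P Z s ->
  P.-integrable setT (EFin \o Z).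
Proof.
move=> [mZ s0 lawZ]; apply: (integrable_dom_expR mZ lawZ (c := 1)) => // w.
by rewrite mul1r; apply: le_trans (expR_ge1Dx _); rewrite lerDr.
Qed.

Lemma gaussian_law_sqr_integrable (Z : T -> R) s : gaussian_law P Z s ->
  P.-integrable setT (EFin \o (fun w => Z w ^+ 2)).
Proof.
move=> [mZ s0 lawZ]; apply: (integrable_dom_expR mZ lawZ (c := 2)) => [|w].
  exact: measurable_funX.
rewrite normrX expRM_natl.
apply: lerXn2r; rewrite ?nnegrE ?expR_ge0 //.
by apply: le_trans (expR_ge1Dx _); rewrite lerDr.
Qed.

Lemma gaussian_law_mul_integrable (Y Z : T -> R) s t :
  gaussian_law P Y s -> gaussian_law P Z t ->
  P.-integrable setT (EFin \o (fun w => Y w * Z w)).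
Proof.
move=> YG ZG; have [mY _ _] := YG; have [mZ _ _] := ZG.
have h : P.-integrable setT (EFin \o (fun w => Y w ^+ 2 + Z w ^+ 2)).
  exact: (integrableD measurableT (gaussian_law_sqr_integrable YG) (gaussian_law_sqr_integrable ZG)).
apply: le_integrable h => //; first by apply/measurable_EFinP; exact: measurable_funM.
move=> w _; rewrite /= lee_fin [leRHS]ger0_norm ?addr_ge0 ?sqr_ge0 //.
rewrite ler_norml; have := sqr_ge0 (Y w + Z w); have := sqr_ge0 (Y w - Z w).
by move=> ? ?; apply/andP; split; nra.
Qed.

Lemma gaussian_law_eq (Y Z : T -> R) s : gaussian_law P Y s -> measurable_fun setT Z ->
  {ae P, forall w, Z w = Y w} -> gaussian_law P Z s.
Proof.
move=> [mY s0 lawY] mZ YZ; split=> // V mV; rewrite -lawY // /pushforward.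
have mYV : measurable (Y @^-1` V) by rewrite -[_ @^-1` _]setTI; exact: mY.
have mZV : measurable (Z @^-1` V) by rewrite -[_ @^-1` _]setTI; exact: mZ.
have PE (A : set T) : measurable A -> P A = (\int[P]_w (\1_A w)%:E)%E.
  by move=> mA; rewrite integral_indic // setIT.
rewrite !PE //; apply: ae_eq_integral => //.
- by apply/measurable_EFinP; exact: measurable_indic.
- by apply/measurable_EFinP; exact: measurable_indic.
apply: filterS YZ => w ZY _; rewrite !indicE; congr (_%:R%:E).
by congr nat_of_bool; apply/idP/idP => /set_mem h; apply/mem_set; move: h; rewrite /preimage /= ZY.
Qed.

End GaussianMoments.

Section FieldMoments.
Context {R : realType} d {T : measurableType d} (P : probability T R).
Variables (I : Type) (X : I -> T -> R) (c : I -> I -> R).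
Hypothesis XG : gaussian_field P X c.
Hypothesis csym : forall u v, c u v = c v u.

Lemma gaussian_field_law u : exists s, gaussian_law P (X u) s.
Proof.
have [s [[mZ s0 lawZ] _]] := XG [:: (1, u)]; exists s.
have e : lincomb X [:: (1, u)] = X u.
  by apply/funext => w; rewrite /lincomb big_seq1 mul1r.
by split; rewrite -?e.
Qed.

Lemma gaussian_field_mean0 u : ('E_P[X u] = 0)%E.
Proof.
have [s XuG] := gaussian_field_law u; rewrite unlock.
rewrite -[LHS]fineK; last exact/integrable_fin_num/(gaussian_law_integrable XuG).
by rewrite -/(Rintegral P setT (X u)) (gaussian_law_mean0 XuG).
Qed.

Lemma gaussian_field_mul_integrable u v :
  P.-integrable setT (EFin \o (fun w => X u w * X v w)).
Proof.
have [s XuG] := gaussian_field_law u; have [t XvG] := gaussian_field_law v.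
exact: gaussian_law_mul_integrable XuG XvG.
Qed.

Lemma lincomb_moment2 L : \int[P]_w (lincomb X L w ^+ 2) = quad c L.
Proof.
have [s [[mZ _ lawZ] <-]] := XG L; exact: (gaussian_moment2 mZ lawZ).
Qed.

(** Polarization, as [gaussian_field] prescribes only the variances of linear combinations. *)
Lemma gaussian_field_covariance u v : \int[P]_w (X u w * X v w) = c u v.
Proof.
have sq w : X u w * X v w = 4^-1 * (lincomb X [:: (1, u); (1, v)] w ^+ 2 +
    - 1 * lincomb X [:: (1, u); (-1, v)] w ^+ 2).
  by rewrite /lincomb !big_cons !big_nil /=; field.
have intL L : P.-integrable setT (EFin \o (fun w => lincomb X L w ^+ 2)).
  by have [s [LG _]] := XG L; exact: gaussian_law_sqr_integrable LG.
have intL' L : P.-integrable setT (EFin \o (fun w => - 1 * lincomb X L w ^+ 2)).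
  exact: (integrableZl measurableT (- 1) (intL L)).
transitivity (\int[P]_w (4^-1 * (lincomb X [:: (1, u); (1, v)] w ^+ 2 +
    - 1 * lincomb X [:: (1, u); (-1, v)] w ^+ 2))).
  by apply: eq_Rintegral => w _; rewrite sq.
rewrite RintegralZl //; last exact: (integrableD measurableT (intL _) (intL' _)).
rewrite RintegralD // RintegralZl // !lincomb_moment2.
by rewrite /quad !big_cons !big_nil /= (csym v u); field.
Qed.

Lemma gaussian_field_covarianceE u v : covariance P (X u) (X v) = (c u v)%:E.
Proof.
rewrite unlock !gaussian_field_mean0 /=.
rewrite (_ : (X u \- cst 0) * (X v \- cst 0) = fun w => X u w * X v w); last first.
  by apply/funext => w; rewrite -[LHS]/((X u w - 0) * (X v w - 0)) !subr0.
rewrite unlock -gaussian_field_covariance [RHS]fineK //.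
exact/integrable_fin_num/gaussian_field_mul_integrable.
Qed.

End FieldMoments.

Section WhiteNoise.
Context {R : realType} d {Omega : measurableType d} (P : probability Omega R).
Local Notation mu2 := (@lebesgue2 R).
Local Notation mR := (measurableTypeR R).
Variables (W : (R * R -> R) -> {RV P >-> R}) (q : R * R -> R) (f : R * R -> {RV P >-> R}).
Hypothesis whiteW : white_noise W.
Hypothesis fW : forall x : R * R, {ae P, forall w, f x w = W (fun y => q (x - y)) w}.
Hypothesis q2 : q \in Lfun mu2 2%:E.
Hypothesis qN : forall x, q (- x) = q x.

Lemma measurable_kernel : measurable_fun setT (q : mR * mR -> mR).
Proof. by move: q2 => /andP[]; rewrite !inE /= => mq _. Qed.

Lemma measurable_translate (x : R * R) : measurable_fun setT ((fun y => q (x - y)) : mR * mR -> mR).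
Proof.
rewrite (_ : (fun y => _) = fun y => q (y + - x)); last first.
  by apply/funext => y; rewrite -qN opprB.
exact: (measurableT_comp measurable_kernel (measurable_shift2 (- x))).
Qed.

Lemma Lfun_translate (x : R * R) : (fun y => q (x - y)) \in Lfun mu2 2%:E.
Proof.
move: q2 => /andP[]; rewrite !inE /= => mq nq; apply/andP; split; rewrite inE /=.
  exact: measurable_translate.
move: nq; rewrite /= /finite_norm unlock /=; congr (_ < _)%E.
congr (_ `^ _)%E.
have mF : measurable_fun setT (fun y : mR * mR => (`|q y| `^ 2)%:E).
  apply/measurable_EFinP; apply: (measurableT_comp (measurable_powR 2)).
  exact: (measurableT_comp _ measurable_kernel).
rewrite -[LHS](ge0_integral_shift2 (- x) mF) => [|y]; last by rewrite lee_fin powR_ge0.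
by apply: eq_integral => y _; rewrite -qN opprD opprK addrC.
Qed.

Definition conv_cov (x y : R * R) : R := \int[mu2]_z (q (x - z) * q (y - z)).

Lemma conv_covC x y : conv_cov x y = conv_cov y x.
Proof. by apply: eq_Rintegral => z _; rewrite mulrC. Qed.

Lemma conv_cov_shift a x y : conv_cov (x + a) (y + a) = conv_cov x y.
Proof.
have mF : measurable_fun setT (fun z : mR * mR => (q (x - z) * q (y - z))%:E).
  apply/measurable_EFinP; apply: measurable_funM; exact: measurable_translate.
rewrite /conv_cov /Rintegral -[X in _ = fine X](integral_shift2 (- a) mF); congr fine.
have e (u z : R * R) : u - (z + - a) = u + a - z by rewrite opprB addrA.
by apply: eq_integral => z _; rewrite -!e.
Qed.

Lemma white_noise_law (n : nat) (t : 'I_n -> R * R) (a : 'I_n -> R) :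
  exists s, gaussian_law P (fun w => \sum_i a i * W (fun y => q (t i - y)) w) s.
Proof.
have [mZ [s [s0 lawZ]]] := whiteW.1 n (fun i => (fun y => q (t i - y))) a
  (fun i => Lfun_translate (t i)).
by exists s; split.
Qed.

Lemma white_noise_law1 (x : R * R) : exists s, gaussian_law P (W (fun y => q (x - y))) s.
Proof.
have [s sG] := @white_noise_law 1 (fun=> x) (fun=> 1); exists s.
have e : (fun w => \sum_(i < 1) 1 * W (fun y => q (x - y)) w) = W (fun y => q (x - y)).
  by apply/funext => w; rewrite big_ord1 mul1r.
by rewrite -e.
Qed.

Lemma white_noise_covariance (x y : R * R) :
  \int[P]_w (W (fun z => q (x - z)) w * W (fun z => q (y - z)) w) = conv_cov x y.
Proof.
have := whiteW.2 _ _ (Lfun_translate x) (Lfun_translate y); rewrite unlock => h.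
by rewrite /Rintegral h.
Qed.

Lemma convolution_gaussian_field : gaussian_field P (fun x => f x : Omega -> R) conv_cov.
Proof.
move=> L; pose n := size L; pose t i := (tnth (in_tuple L) i).2; pose a i := (tnth (in_tuple L) i).1.
pose Z w := \sum_(i < n) a i * W (fun y => q (t i - y)) w.
have [s ZG] := white_noise_law t a; exists s; split.
  apply: (gaussian_law_eq ZG).
    by apply: measurable_sum => p; exact: measurable_funM.
  have : {ae P, forall w, forall i : 'I_n, f (t i) w = W (fun y => q (t i - y)) w}.
    by apply: ae_forall_count => i; exact: fW.
  apply: filterS => w h; rewrite /lincomb big_tnth; apply: eq_bigr => i _.
  by rewrite -h.
have [mZ s0 lawZ] := ZG; rewrite -(gaussian_moment2 mZ lawZ).
have int1 i j : P.-integrable setT (EFin \o (fun w =>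
    (a i * a j) * (W (fun y => q (t i - y)) w * W (fun y => q (t j - y)) w))).
  have [s1 G1] := white_noise_law1 (t i); have [s2 G2] := white_noise_law1 (t j).
  exact: (integrableZl measurableT (a i * a j) (gaussian_law_mul_integrable G1 G2)).
have int2 i := Rintegral_sum_integrable (index_enum 'I_n) (int1 i).
transitivity (\int[P]_w (\sum_i \sum_j (a i * a j) *
    (W (fun y => q (t i - y)) w * W (fun y => q (t j - y)) w))).
  apply: eq_Rintegral => w _; rewrite expr2 mulr_suml; apply: eq_bigr => i _.
  rewrite mulr_sumr; apply: eq_bigr => j _; ring.
rewrite (Rintegral_sum_integrable _ (fun i => (int2 i).1)).2 /quad [RHS]big_tnth.
apply: eq_bigr => i _; rewrite (int2 i).2 [RHS]big_tnth; apply: eq_bigr => j _.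
rewrite RintegralZl ?white_noise_covariance //.
have [s1 G1] := white_noise_law1 (t i); have [s2 G2] := white_noise_law1 (t j).
exact: gaussian_law_mul_integrable G1 G2.
Qed.

End WhiteNoise.

Section Summable.
Context {R : realType}.
Local Notation mu2 := (@lebesgue2 R).
Local Notation mR := (measurableTypeR R).
Variable q : R * R -> R.
Hypothesis q2 : q \in Lfun mu2 2%:E.
Hypothesis qN : forall x, q (- x) = q x.

Lemma decay2N (x : R * R) : decay2 (- x) = decay2 x.
Proof. by rewrite /decay2 /decay /= !normrN. Qed.

(** After exchanging sum and integral, the sum over [v] of decay2 (v - z) is bounded uniformly in z
    by [lattice_sum_le], and the remaining factor has an integral independent of [u]. *)
Lemma summable_conv_cov (B : R) : (forall x, `|q x| <= B * decay2 x) ->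
  exists K : R, 0 < K /\ forall (F : seq (int * int)) u, uniq F ->
    \sum_(v <- F) `|conv_cov q (lattice_point u) (lattice_point v)| <= K.
Proof.
move=> qB; have [K KP] := @lattice_sum_le R.
have B0 : 0 <= B.
  have := le_trans (normr_ge0 _) (qB 0); have := @decay2_gt0 R 0; nra.
have md : measurable_fun setT (fun x : mR * mR => (decay2 x)%:E).
  by apply/measurable_EFinP; exact: measurable_decay2.
have d0 x : (0 <= (@decay2 R x)%:E)%E by rewrite lee_fin ltW // decay2_gt0.
pose I := fine (\int[mu2]_x (decay2 x)%:E).
have IE : I%:E = (\int[mu2]_x (decay2 x)%:E)%E.
  by rewrite fineK // ge0_fin_numE ?integral_decay2_lty // integral_ge0.
have I0 : 0 <= I by apply: fine_ge0; apply: integral_ge0.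
have K0 : 0 <= K by have := KP [::] 0 isT; rewrite big_nil.
exists (B ^+ 2 * K * I + 1); split=> [|F u uF].
  by rewrite ltr_wpDl // !mulr_ge0 // sqr_ge0.
apply: (@le_trans _ _ (B ^+ 2 * K * I)); last by rewrite lerDl.
have mt x : measurable_fun setT (fun z : mR * mR => q (x - z)).
  exact: measurable_translate.
have mdt (x : R * R) : measurable_fun setT (fun z : mR * mR => decay2 (x - z)).
  rewrite (_ : (fun y => _) = fun y => decay2 (y + - x)); last first.
    by apply/funext => y; rewrite -decay2N opprB.
  exact: (measurableT_comp measurable_decay2 (measurable_shift2 (- x))).
have t0 v z : (0 <= (B ^+ 2 * (decay2 (lattice_point u - z) *
    decay2 (lattice_point v - z)))%:E)%E.
  by rewrite lee_fin; apply: mulr_ge0; [exact: sqr_ge0|apply: mulr_ge0; exact/ltW/decay2_gt0].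
have term v : (`|conv_cov q (lattice_point u) (lattice_point v)|%:E <=
    \int[mu2]_z (B ^+ 2 * (decay2 (lattice_point u - z) * decay2 (lattice_point v - z)))%:E)%E.
  apply: le_trans (abse_fine_le _) _.
  apply: le_trans (le_abse_integral _ _ _) _ => //.
    by apply/measurable_EFinP; apply: measurable_funM.
  apply: ge0_le_integral => //.
  - apply/measurable_EFinP/measurableT_comp => //; apply: measurable_funM => //.
  - apply/measurable_EFinP; apply: measurable_funM => //; exact: measurable_funM.
  - move=> z _; rewrite /= lee_fin normrM expr2 mulrACA; apply: ler_pM => //.
rewrite -lee_fin -sumEFin.
apply: le_trans (lee_sum _ (fun v _ => term v)) _.
rewrite -ge0_integral_sum //; first last.
- by move=> v; apply/measurable_EFinP; apply: measurable_funM => //; exact: measurable_funM.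
apply: (@le_trans _ _ (\int[mu2]_z ((B ^+ 2 * K)%:E * (decay2 (z + - lattice_point u))%:E))%E).
  apply: ge0_le_integral => //.
  - move=> z _; apply: sume_ge0 => v _.
    exact: t0.
  - apply: emeasurable_sum => v; apply/measurable_EFinP; apply: measurable_funM => //.
    exact: measurable_funM.
  - apply: emeasurable_funM => //.
    exact: (measurableT_comp md (measurable_shift2 (- lattice_point u))).
  move=> z _; rewrite sumEFin -EFinM lee_fin -mulr_sumr -mulr_sumr -[leRHS]mulrA.
  apply: ler_wpM2l; first exact: sqr_ge0.
  rewrite mulrC -[in leRHS]decay2N opprB; apply: ler_wpM2r; first by rewrite ltW // decay2_gt0.
  exact: KP.
rewrite ge0_integralZl //; first last.
- by rewrite lee_fin mulr_ge0 // sqr_ge0.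
- exact: (measurableT_comp md (measurable_shift2 (- lattice_point u))).
by rewrite (ge0_integral_shift2 (- lattice_point u) md) // -IE.
Qed.

End Summable.

Section KernelDecay.
Context {R : realType}.

Lemma abs_le_norm2 (x : R * R) : `|x.1| <= norm2 x /\ `|x.2| <= norm2 x.
Proof.
by split; rewrite -sqrtr_sqr /norm2 ler_sqrt ?addr_ge0 ?sqr_ge0 // ?lerDl ?lerDr sqr_ge0.
Qed.

(** Each factor 1 + |x_i| is at most twice the norm. *)
Lemma decay2_ge (x : R * R) : 1 <= norm2 x -> 4 `^ (- (5 / 4)) * norm2 x `^ (- (5 / 2)) <= decay2 x.
Proof.
move=> x1; have [h1 h2] := abs_le_norm2 x; set r := norm2 x in x1 h1 h2 *.
have r0 : 0 < r by lra.
rewrite (_ : - (5 / 2) = 2%:R * - (5 / 4) :> R); last by field.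
rewrite powRrM powR_mulrn ?(ltW r0) // -powRM ?exprn_ge0 ?(ltW r0) //.
rewrite /decay2 /decay -powRM ?addr_ge0 // !powRN lef_pV2 ?posrE ?powR_gt0 ?mulr_gt0 ?exprn_gt0 ?ltr_wpDr //.
rewrite ge0_ler_powR ?nnegrE ?mulr_ge0 ?addr_ge0 ?exprn_ge0 ?(ltW r0) //.
have -> : 4 * r ^+ 2 = (r + r) * (r + r) by ring.
by rewrite ler_pM ?addr_ge0 // lerD.
Qed.

Lemma kernel_decay (q : R * R -> R) (beta : R) : 5 / 2 < beta -> admissible q beta ->
  exists B, forall x, `|q x| <= B * decay2 x.
Proof.
move=> b52 [_ [C4 _] _ [C [C0 qC]]].
have cq : continuous q by case: C4.
have cpt : compact (q @` ((`[-1, 1]%classic : set R) `*` (`[-1, 1]%classic : set R))).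
  apply: continuous_compact; first exact: continuous_subspaceT.
  by apply: compact_setX; exact: segment_compact.
have [B1 B1P] : exists B1, forall x : R * R, norm2 x <= 1 -> `|q x| <= B1.
  have [M [_ MP]] := compact_bounded cpt.
  exists (M + 1) => x x1; apply: (MP (M + 1)); first by rewrite ltrDl.
  exists x => //; have [h1 h2] := abs_le_norm2 x.
  by split; rewrite /= in_itv /= -ler_norml; lra.
have a0 : 0 < 4 `^ (- (5 / 4)) :> R by rewrite powR_gt0.
(* On the unit disc [decay2] is at least 4^(-5/4), and outside at least this times the norm to the
   power -5/2: one denominator serves both. *)
pose B := (C + `|B1|) / 4 `^ (- (5 / 4)).
exists B => x.
have [x1|/ltW x1] := leP (norm2 x) 1.
  apply: le_trans (B1P x x1) _; apply: (@le_trans _ _ (B * (4 `^ (- (5 / 4))))).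
    by rewrite /B divfK ?gt_eqF //; have := ler_norm B1; lra.
  apply: ler_wpM2l; first by rewrite divr_ge0 ?addr_ge0 // ltW.
  have [h1 h2] := abs_le_norm2 x.
  rewrite /decay2 /decay -powRM ?addr_ge0 // !powRN lef_pV2 ?posrE ?powR_gt0 ?mulr_gt0 ?ltr_wpDr //.
  rewrite ge0_ler_powR ?nnegrE ?mulr_ge0 ?addr_ge0 //.
  by rewrite (_ : 4 = (1 + 1) * (1 + 1) :> R) ?ler_pM ?addr_ge0 // ?lerD2l; try lra; ring.
have r0 : 0 < norm2 x by lra.
apply: le_trans (qC (0%N, 0%N) isT x x1) _ => /=.
apply: (@le_trans _ _ (C * norm2 x `^ (- (5 / 2)))).
  by rewrite ler_pM2l // ler_powR // lerN2 ltW.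
apply: (@le_trans _ _ (B * (4 `^ (- (5 / 4)) * norm2 x `^ (- (5 / 2))))).
  rewrite mulrA /B divfK ?gt_eqF // ler_wpM2r ?powR_ge0 // lerDl //.
by apply: ler_wpM2l (decay2_ge x1); rewrite divr_ge0 ?addr_ge0 // ltW.
Qed.

End KernelDecay.

(** * Conclusion *)

Lemma lattice_pointD (R : realType) (u v : int * int) :
  lattice_point (u + v) = lattice_point u + lattice_point v :> R * R.
Proof. by rewrite /lattice_point !intrD. Qed.

Section LatticeField.
Context {R : realType} d {Omega : measurableType d} (P : probability Omega R).
Variables (W : (R * R -> R) -> {RV P >-> R}) (q : R * R -> R) (f : R * R -> {RV P >-> R}).
Variable beta : R.
Hypothesis whiteW : white_noise W.
Hypothesis fW : convolution_field q W f.
Hypothesis admq : admissible q beta.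
Local Notation X := (fun u => lattice_field f u : Omega -> R).

Definition lattice_cov (u v : int * int) : R := conv_cov q (lattice_point u) (lattice_point v).

Lemma lattice_covC u v : lattice_cov u v = lattice_cov v u.
Proof. exact: conv_covC. Qed.

Lemma admissible_L2 : q \in Lfun lebesgue2 2%:E.
Proof. by have [_ [_ qL] _ _] := admq; exact: (qL (0%N, 0%N)). Qed.

Lemma admissible_even x : q (- x) = q x.
Proof. by have [_ _ qN _] := admq. Qed.

Lemma lattice_gaussian_field : gaussian_field P X lattice_cov.
Proof.
move=> L.
have [s [sG sq]] := convolution_gaussian_field whiteW fW.1 admissible_L2 admissible_even
  [seq (p.1, lattice_point p.2) | p <- L].
exists s; split.
  rewrite (_ : lincomb X L =
    lincomb (fun x => f x : Omega -> R) [seq (p.1, lattice_point p.2) | p <- L]) //.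
  by apply/funext => w; rewrite /lincomb big_map.
rewrite sq /quad big_map; apply: eq_bigr => p _.
by rewrite big_map.
Qed.

Lemma lattice_cov_shift u v : lattice_cov u v = lattice_cov (v - u) 0.
Proof.
rewrite lattice_covC /lattice_cov.
rewrite -[RHS](conv_cov_shift admissible_L2 admissible_even (lattice_point u)).
by rewrite -!lattice_pointD subrK add0r.
Qed.

Lemma correlation_variance n delta : correlation_condition (lattice_field f) n delta ->
  forall u, lattice_cov u u = 1.
Proof.
move=> [var1 _] u; have [_] := var1 u; rewrite unlock => E1.
by rewrite -(gaussian_field_covariance lattice_gaussian_field lattice_covC) /Rintegral E1.
Qed.

Lemma correlation_sum delta : correlation_condition (lattice_field f) 1 delta ->
  forall (F : seq (int * int)) u, uniq F -> u \notin F ->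
  \sum_(v <- F) `|lattice_cov u v| <= delta.
Proof.
move=> [_ sum1] F u uF nuF; rewrite -lee_fin; apply/ltW; apply: le_lt_trans sum1.
(* Stationarity moves [u] to the origin, and the sites of sup norm at least 1 are those different
   from 0. *)
pose F' := [seq v - u | v <- F].
have uF' : uniq F' by rewrite map_inj_uniq // => v w /addIr.
apply: esum_ge; exists [set` F'].
  split; first exact: finite_seq.
  move=> v /mapP[v' vF ->] /=.
  have : v' != u by apply: contraNneq nuF => <-.
  apply: contraNT; rewrite -ltNge gt_max => /andP[h1 h2].
  apply/eqP; rewrite [LHS]surjective_pairing [RHS]surjective_pairing.
  by congr (_, _); move: h1 h2 => /=; clear; lia.
rewrite -fsbig_seq // big_map -sumEFin; apply: lee_sum => v _.
have := gaussian_field_covarianceE lattice_gaussian_field lattice_covC (v - u) 0.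
by rewrite -lattice_cov_shift => ->.
Qed.

End LatticeField.

Lemma slope_le_alpha (R : realType) d (Omega : measurableType d) (P : probability Omega R)
    (X : int * int -> {RV P >-> R}) w u r : (0 < r)%N ->
  (((X (hshift u r) w - X u w) / r%:R)%:E <= alpha X w u)%E.
Proof. by move=> r0; apply: ereal_sup_ubound; exists r. Qed.

Lemma alpha_large_slope (R : realType) d (Omega : measurableType d) (P : probability Omega R)
    (X : int * int -> {RV P >-> R}) (l : R) w u : (l%:E < alpha X w u)%E ->
  large_slope (fun u => X u : Omega -> R) l w u.
Proof.
move=> /ereal_sup_gt[_ [r r0 <-]]; rewrite lte_fin => lr; exists r => //.
by rewrite -ler_pdivlMr ?ltr0n // ltW.
Qed.

Lemma alpha_small_slope (R : realType) d (Omega : measurableType d) (P : probability Omega R)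
    (X : int * int -> {RV P >-> R}) (l : R) n w u : (alpha X w u <= l%:E)%E ->
  small_slope (fun u => X u : Omega -> R) n l w u.
Proof.
move=> al r; have := le_trans (slope_le_alpha X w u (ltn0Sn r)) al.
by rewrite lee_fin ler_pdivrMr ?ltr0n.
Qed.

Theorem theorem1p6 (R : realType) :
  (forall (d : measure_display) (Omega : measurableType d)
      (P : probability Omega R) (W : (R * R -> R) -> {RV P >-> R})
      (q : R * R -> R) (f : R * R -> {RV P >-> R}) (beta : R),
    white_noise W -> convolution_field q W f ->
    5%:R / 2%:R < beta -> admissible q beta ->
    exists l1 : R, 0 < l1 /\
      forall l : R, l1 < l ->
        {ae P, forall w,
          unique_infinite_cluster
            [set u | (alpha (lattice_field f) w u <= l%:E)%E] /\
          only_finite_clusters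
            [set u | (l%:E <= alpha (lattice_field f) w u)%E]})
  /\
  (exists delta0 : R, 0 < delta0 /\
    forall (d : measure_display) (Omega : measurableType d)
      (P : probability Omega R) (W : (R * R -> R) -> {RV P >-> R})
      (q : R * R -> R) (f : R * R -> {RV P >-> R}) (beta : R),
    white_noise W -> convolution_field q W f ->
    16%:R < beta -> admissible q beta ->
    correlation_condition (lattice_field f) 1 delta0 ->
    exists l2 : R, 0 < l2 /\
      forall l : R, l < l2 ->
        {ae P, forall w,
          unique_infinite_cluster
            [set u | (l%:E < alpha (lattice_field f) w u)%E] /\
          only_finite_clusters
            [set u | (alpha (lattice_field f) w u < l%:E)%E]}).
Proof.
have eps0 : 0 <= 18%:R^-1 :> R by rewrite invr_ge0.
split.
  move=> d Omega P W q f beta whiteW fW b52 admq.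
  have [B qB] := kernel_decay b52 admq.
  have [K [K0 csum]] := summable_conv_cov (admissible_L2 admq) (admissible_even admq) qB.
  have XG := lattice_gaussian_field whiteW fW admq.
  (* As lam is at least 1 and at least 190 K, lam^2 / (10 K) is at least 19, and exp(x) is at least
     x. *)
  pose lam := 190%:R * K + 1.
  have lam1 : 1 <= lam by rewrite /lam; lra.
  have lamK : expR (- (lam ^+ 2 / (10%:R * K))) <= 19%:R^-1.
    rewrite expRN lef_pV2 ?posrE ?expR_gt0 //; apply: le_trans (expR_ge1Dx _).
    apply: (@le_trans _ _ (lam ^+ 2 / (10%:R * K))); last by rewrite lerDr.
    rewrite ler_pdivlMr ?mulr_gt0 //.
    apply: (@le_trans _ _ lam); first by rewrite /lam; lra.
    by rewrite expr2 ler_peMl //; lra.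
  exists lam; split=> [|l laml]; first lra.
  have := @ae_percolation R d Omega P (large_slope (fun u => lattice_field f u : Omega -> R) lam)
    18%:R^-1 (measurable_large_slope XG lam) eps0 (lexx _).
  move=> /(_ (fun s us => prob_large_slope XG (@lattice_covC _ q) csum K0 _ lamK us)) H.
  have {}H := H (le_trans ler01 lam1).
  apply: filterS H => w; apply.
    move=> u /= /negP; rewrite -ltNge => lu; apply: alpha_large_slope.
    by apply: lt_trans lu; rewrite lte_fin.
  by move=> u /= lu; apply: alpha_large_slope; apply: lt_le_trans lu; rewrite lte_fin.
have [delta [l2 [n [delta0 l20 small]]]] := small_slope_constants R.
exists delta; split=> // d Omega P W q f beta whiteW fW _ admq corr.
exists l2; split=> // l ll2.
have XG := lattice_gaussian_field whiteW fW admq.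
have := @ae_percolation R d Omega P (small_slope (fun u => lattice_field f u : Omega -> R) n l2)
  18%:R^-1 (measurable_small_slope XG n l2) eps0 (lexx _).
move=> /(_ (small _ _ _ _ _ XG (@lattice_covC _ q) (correlation_variance whiteW fW admq corr)
  (correlation_sum whiteW fW admq corr))).
(* For every [l] below [l2], a value of [alpha] at most [l] keeps the first [n] slopes at most [l2]:
   one exceptional set serves all levels. *)
apply: filterS => w; apply.
  move=> u /= /negP; rewrite -leNgt => lu; apply: alpha_small_slope.
  by apply: le_trans lu _; rewrite lee_fin ltW.
move=> u /= lu; apply: alpha_small_slope.
by apply/ltW/(lt_trans lu); rewrite lte_fin.
Qed.
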